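(* Let $(W,S)$ be a Coxeter system of type PM. Let $X_D$ be the Davis realization of a regular building of type $(W,S)$ and thickness vector $\mathbf{q}+1$, with $\mathbf{q}\geq 2$. Let $n=\dim X_D$. Then $$1+e_{\mathbf{q}}(W)=\inf\{p>1 \mid \ell^pH_n(X_D)\neq\{0\}\},$$ $$1+e_{\mathbf{q}}(W)^{-1}=\sup\{p>1 \mid \ell^p\overline{H^n}(X_D)\neq\{0\}\}.$$
   Context: Throughout, $(W,S)$ is a Coxeter system with $S$ finite and $W$ infinite, and $p>1$ is real. For $T\subseteq S$, $W_T=\langle T\rangle$. Buildings. A chamber system over $S$ is a set $\mathcal{C}$ (of chambers) with an equivalence relation ($s$-equivalence) for each $s\in S$; distinct $s$-equivalent chambers are $s$-adjacent. A gallery of type $(s_1,\dots,s_k)$ is a sequence $c_0,\dots,c_k$ with $c_{i-1}$ $s_i$-adjacent to $c_i$. A building of type $(W,S)$ is a chamber system $\mathcal{C}$ over $S$ whose $s$-equivalence classes all have at least two elements, with a map $d_W:\mathcal{C}\times\mathcal{C}\to W$ such that for every reduced word $s_1\cdots s_k$, two chambers $c,c'$ are joined by a gallery of type $(s_1,\dots,s_k)$ if and only if $d_W(c,c')=s_1\cdots s_k$. It is regular with (finite) thickness vector $\mathbf{q}+1$, $\mathbf{q}=(q_s)_{s\in S}$, if every $s$-equivalence class has exactly $q_s+1<\infty$ elements; $\mathbf{q}\ge 2$ means $q_s\geq 2$ for all $s$. For $w\in W$ with reduced expression $s_1\cdots s_k$ put $q_w=q_{s_1}\cdots q_{s_k}$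 (independent of the reduced expression), and $$e_{\mathbf{q}}(W)=\limsup_n \tfrac1n\log|\{w\in W: q_w\leq e^n\}|,$$ with $e_{\mathbf q}(W)^{-1}=+\infty$ if $e_{\mathbf q}(W)=0$. Davis realization. The Davis chamber $D$ is the simplicial complex whose simplices are the nonempty finite chains (for inclusion) of subsets $T\subseteq S$ (including $\emptyset$) with $W_T$ finite; $D_s$ is the subcomplex of chains all of whose members contain $s$. For $x\in D$ let $S(x)=\{s: x\in D_s\}$. The Davis realization is $X_D=(\mathcal{C}\times D)/\sim$, where $(c,x)\sim(c',x')$ iff $x=x'$ and $d_W(c,c')\in W_{S(x)}$. Type PM. A locally finite purely $m$-dimensional simplicial complex $Y$ is a pseudomanifold if every simplex of codimension 1 is contained in exactly two maximal simplices; it is orientable if its simplices can be oriented so that the sum of all maximal simplices is a locally finite $m$-cycle; it is gallery connected if any two maximal simplices can be joined by a finite sequence of maximal simplices in which consecutive ones share a face of codimension 1. The nerve $L$ of $(W,S)$ is the simplicial complex with vertex set $S$ whose simplices are the nonempty $T\subseteq S$ with $W_T$ finite. $(W,S)$ is of type PM if $L$ is an orientable, gallery connected pseudomanifold. When $L$ is $0$-dimensional, the empty simplex counts as a codimension 1 face, so that $L$ is then exactly two points. $\ell^p$-(co)homology. For a locally finite simplicial complex $X$ of bounded geometry (with oriented simplices, $X^{(k)}$ the set of $k$-simplices), $\ell^pC_k(X)$ is the space of formal sums $\sum_{\sigma\in X^{(k)}}a_\sigma\sigma$ with $(a_\sigma)\in\ell^p(X^{(k)})$, and $\ell^pC^k(X)=\ell^p(X^{(k)})$,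 with the usual (bounded) operators $\partial_k:\ell^pC_k\to\ell^pC_{k-1}$ and $d_k:\ell^pC^k\to\ell^pC^{k+1}$. Then $\ell^pH_k(X)=\ker\partial_k/\operatorname{Im}\partial_{k+1}$, $\ell^pH^k(X)=\ker d_k/\operatorname{Im}d_{k-1}$, and the reduced version $\ell^p\overline{H^k}(X)=\ker d_k/\overline{\operatorname{Im}d_{k-1}}$. *)

(* Defs.v *)
From Stdlib Require Relation_Operators.
From HB Require Import structures.
From mathcomp Require Import all_boot all_order all_algebra finmap.
From mathcomp Require Import all_classical all_reals all_analysis.

Set Implicit Arguments.
Unset Strict Implicit.
Unset Printing Implicit Defensive.

Import Order.TTheory GRing.Theory Num.Theory.

Local Open Scope classical_set_scope.
Local Open Scope ring_scope.

(** * Coxeter systems *)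

(* The entry 0 stands for infinity (no relation). *)
Definition is_coxeter_matrix (S : Type) (m : S -> S -> nat) : Prop :=
  [/\ forall s, m s s = 1%N,
      forall s t, m s t = m t s
    & forall s t, s <> t -> m s t <> 1%N].

(* The congruence on words generated by (st)^(m s t) = 1. As m s s = 1, its
   quotient is already a group, namely the one presented by these relations. *)
Inductive coxeter_congr (S : Type) (m : S -> S -> nat) :
    seq S -> seq S -> Prop :=
| coxeter_relation u v s t :
    coxeter_congr m (u ++ flatten (nseq (m s t) [:: s; t]) ++ v) (u ++ v)
| coxeter_refl u : coxeter_congr m u u
| coxeter_sym u v : coxeter_congr m u v -> coxeter_congr m v u
| coxeter_trans u v w :
    coxeter_congr m u v -> coxeter_congr m v w -> coxeter_congr m u w.

Section Coxeter.
Context (W : groupType) (S : finType) (gen : S -> W).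

Definition wprod (u : seq S) : W := (\prod_(s <- u) gen s)%g.

Definition is_coxeter_system : Prop :=
  exists m : S -> S -> nat,
    [/\ is_coxeter_matrix m,
        forall w, exists u, wprod u = w
      & forall u v, wprod u = wprod v <-> coxeter_congr m u v].

Definition reduced (u : seq S) : Prop :=
  forall v, wprod v = wprod u -> (size u <= size v)%N.

Definition is_subgroup (H : set W) : Prop :=
  [/\ H 1%g, forall x y, H x -> H y -> H (x * y)%g & forall x, H x -> H x^-1%g].

Definition parabolic (T : set S) : set W := smallest is_subgroup (gen @` T).

Definition spherical (T : {fset S}) : Prop := finite_set (parabolic [set` T]).

Definition reduced_expression (w : W) : seq S :=
  xget [::] [set u | reduced u /\ wprod u = w].

(* Used for q constant on conjugate generators, as it is for a regular building;
   the choice of reduced expression is then immaterial. *)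
Definition q_weight (q : S -> nat) (w : W) : nat :=
  (\prod_(s <- reduced_expression w) q s)%N.

(* For q >= 2 the sets counted here are finite (S is finite). *)
Definition growth_exponent (R : realType) (q : S -> nat) : \bar R :=
  limn_esup (fun n : nat =>
    (ln (#|` fset_set [set w : W | ((q_weight q w)%:R <= expR (n%:R : R))%R]|%:R)
       / n%:R)%:E).

End Coxeter.

(** * Buildings *)

Record chamber_system (S : Type) := ChamberSystem {
  chamber :> Type;
  sequiv : S -> chamber -> chamber -> Prop;
  sequiv_refl : forall s c, sequiv s c c;
  sequiv_sym : forall s c c', sequiv s c c' -> sequiv s c' c;
  sequiv_trans : forall s c c' c'',
    sequiv s c c' -> sequiv s c' c'' -> sequiv s c c'' }.

Definition sadjacent (S : Type) (C : chamber_system S) (s : S) (c c' : C) :=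
  c <> c' /\ sequiv s c c'.

Fixpoint gallery (S : Type) (C : chamber_system S) (u : seq S) (c c' : C) :=
  if u is s :: u' then exists2 c1, sadjacent s c c1 & gallery u' c1 c'
  else c = c'.

Definition is_building (W : groupType) (S : finType) (gen : S -> W)
    (C : chamber_system S) (dW : C -> C -> W) : Prop :=
  (forall (s : S) (c : C), exists c', sadjacent s c c') /\
  (forall u, reduced gen u ->
     forall c c' : C, gallery u c c' <-> dW c c' = wprod gen u).

Definition is_regular (S : Type) (C : chamber_system S) (q : S -> nat) : Prop :=
  forall (s : S) (c : C), ([set c' : C | sequiv s c c'] #= `I_((q s).+1))%card.

(** * Simplicial complexes *)

(* A simplex is its finite set of vertices. The empty simplex is not included. *)
Record simplicial_complex (V : choiceType) := SimplicialComplex {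
  simplex :> {fset V} -> Prop;
  simplex_neq0 : forall sg, simplex sg -> sg != fset0;
  simplex_sub : forall sg ta : {fset V},
    simplex sg -> (ta `<=` sg)%fset -> ta != fset0 -> simplex ta }.

Section Complexes.
Context (V : choiceType) (K : simplicial_complex V).
Implicit Types sg ta : {fset V}.

Definition simplices_of_dim (k : nat) : set {fset V} :=
  [set sg | K sg /\ #|` sg| = k.+1].

Definition has_dimension (n : nat) : Prop :=
  simplices_of_dim n !=set0 /\ forall sg, K sg -> (#|` sg| <= n.+1)%N.

Definition maximal_simplices : set {fset V} :=
  [set sg | K sg /\ forall ta, K ta -> (sg `<=` ta)%fset -> ta = sg].

Definition purely_dimensional (m : nat) : Prop :=
  has_dimension m /\
  forall sg, K sg -> exists2 ta, simplices_of_dim m ta & (sg `<=` ta)%fset.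

Definition locally_finite : Prop :=
  forall sg, K sg -> finite_set [set ta | K ta /\ (sg `<=` ta)%fset].

(* The empty simplex qualifies only when m = 0. *)
Definition codim1 (m : nat) : set {fset V} :=
  [set ta | (K ta \/ ta = fset0) /\ #|` ta| = m].

Definition pseudomanifold (m : nat) : Prop :=
  [/\ locally_finite, purely_dimensional m
    & forall ta, codim1 m ta ->
        ([set sg | maximal_simplices sg /\ (ta `<=` sg)%fset] #= `I_2)%card].

Definition gallery_connected (m : nat) : Prop :=
  forall sg sg', maximal_simplices sg -> maximal_simplices sg' ->
    Relation_Operators.clos_refl_trans {fset V} (fun s1 s2 =>
      [/\ maximal_simplices s1, maximal_simplices s2
        & exists2 ta, codim1 m ta & (ta `<=` s1)%fset /\ (ta `<=` s2)%fset])
      sg sg'.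

(* Each simplex is oriented by an enumeration of its vertices, which matters
   only up to even permutations. *)
Definition is_orientation (o : {fset V} -> seq V) : Prop :=
  forall sg, K sg -> perm_eq (o sg) (enum_fset sg).

Fixpoint inversions (t s : seq V) : nat :=
  if s is x :: s' then
    (count (fun y => (index y t < index x t)%N) s' + inversions t s')%N
  else 0%N.

(* [sg : ta] = (-1)^i * (sign of the permutation from o sg minus its i-th vertex
   to o ta) when ta is sg minus its i-th vertex. *)
Definition incidence (o : {fset V} -> seq V) sg ta : int :=
  if (ta `<=` sg)%fset && (#|` sg| == #|` ta|.+1) then
    (-1) ^+ (find (fun v => v \notin ta) (o sg)
             + inversions (o ta) [seq v <- o sg | v \in ta])
  else 0.

(* The two operators act on all degrees at once: incidence numbers vanish
   outside codimension 1. In a locally finite complex both sums are finite. *)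
Definition boundary (R : pzRingType) (o : {fset V} -> seq V)
    (a : {fset V} -> R) : {fset V} -> R :=
  fun ta => if `[< K ta >]
  then \sum_(sg \in simplex K) (incidence o sg ta)%:~R * a sg
  else 0.

Definition coboundary (R : pzRingType) (o : {fset V} -> seq V)
    (a : {fset V} -> R) : {fset V} -> R :=
  fun sg => if `[< K sg >]
  then \sum_(ta \in simplex K) (incidence o sg ta)%:~R * a ta
  else 0.

(* In dimension 0 this is no condition: vertices have no codimension 1 face
   in K. *)
Definition orientable : Prop :=
  exists2 o, is_orientation o &
    boundary o (\1_maximal_simplices : {fset V} -> int) = cst 0.

End Complexes.

(* The set of cosets z + B, z in Z, i.e. Z / B for linear subspaces B of Z. *)
Definition quotient (T : Type) (R : pzRingType) (Z B : set (T -> R)) :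
    set (set (T -> R)) :=
  [set [set z \+ b | b in B] | z in Z].

(** * l^p (co)homology *)

Section LpHomology.
Context (R : realType) (V : choiceType) (K : simplicial_complex V).
Context (o : {fset V} -> seq V) (p : R).

Definition lp_norm (a : {fset V} -> R) : \bar R :=
  ((\esum_(sg in [set: {fset V}]) (`|a sg| `^ p)%:E) `^ p^-1)%E.

(* The elements of l^p of the set of simplices with j vertices, extended by 0;
   so lp_chain k.+1 is the space of l^p k-chains (or k-cochains), and
   lp_chain 0 is 0. *)
Definition lp_chain (j : nat) : set ({fset V} -> R) :=
  [set a | (forall sg, ~ (K sg /\ #|` sg| = j) -> a sg = 0)
           /\ (lp_norm a < +oo)%E].

Definition lp_closure (B : set ({fset V} -> R)) : set ({fset V} -> R) :=
  [set a | (lp_norm a < +oo)%E /\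
     forall e : R, 0 < e -> exists2 b, B b & (lp_norm (a \- b)%R < e%:E)%E].

Definition lp_cycles (k : nat) : set ({fset V} -> R) :=
  [set a | lp_chain k.+1 a /\ boundary K o a = cst 0].

Definition lp_boundaries (k : nat) : set ({fset V} -> R) :=
  boundary K o @` lp_chain k.+2.

Definition lp_cocycles (k : nat) : set ({fset V} -> R) :=
  [set a | lp_chain k.+1 a /\ coboundary K o a = cst 0].

Definition lp_coboundaries (k : nat) : set ({fset V} -> R) :=
  coboundary K o @` lp_chain k.

Definition lp_homology (k : nat) : set (set ({fset V} -> R)) :=
  quotient (lp_cycles k) (lp_boundaries k).

Definition lp_reduced_cohomology (k : nat) : set (set ({fset V} -> R)) :=
  quotient (lp_cocycles k) (lp_closure (lp_coboundaries k)).

(* A quotient by B is {0} when B is its only coset. *)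
Definition lp_homology_nonzero (k : nat) : Prop :=
  lp_homology k <> [set lp_boundaries k].

Definition lp_reduced_cohomology_nonzero (k : nat) : Prop :=
  lp_reduced_cohomology k <> [set lp_closure (lp_coboundaries k)].

End LpHomology.

(** * Nerve, Davis chamber and Davis realization *)

Section Davis.
Context (W : groupType) (S : finType) (gen : S -> W).

Lemma spherical_sub (T T' : {fset S}) :
  spherical gen T -> (T' `<=` T)%fset -> spherical gen T'.
Proof.
move=> fT T'T; apply: sub_finite_set fT.
move=> w w_in H [sgH genH]; apply: w_in; split=> //.
apply: subset_trans genH; apply: image_subset => s /=.
exact: (fsubsetP T'T).
Qed.

Definition nerve : simplicial_complex S.
Proof.
apply: (@SimplicialComplex _ [set T | T != fset0 /\ spherical gen T]).
- by move=> T [].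
- by move=> T T' [_ fT] T'T T'0; split=> //; exact: spherical_sub fT T'T.
Defined.

Definition type_PM : Prop :=
  exists m : nat, [/\ pseudomanifold nerve m, orientable nerve
                    & gallery_connected nerve m].

Definition davis_chamber : simplicial_complex {fset S}.
Proof.
apply: (@SimplicialComplex _ [set sg | [/\ sg != fset0,
  forall T, T \in sg -> spherical gen T
  & forall T T', T \in sg -> T' \in sg -> (T `<=` T')%fset \/ (T' `<=` T)%fset]]).
- by move=> sg [].
- move=> sg ta [_ sph chain] /fsubsetP tasg ta0; split=> //.
  + by move=> T /tasg; exact: sph.
  + by move=> T T' /tasg + /tasg; exact: chain.
Defined.

Definition mirror (s : S) : set {fset {fset S}} :=
  [set sg | davis_chamber sg /\ forall T, T \in sg -> s \in T].

(* S(x) for x a vertex of the Davis chamber. *)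
Definition mirrors_at (x : {fset S}) : set S := [set s | mirror s [fset x]%fset].

Context (C : chamber_system S) (dW : C -> C -> W).

Definition davis_class (c : C) (x : {fset S}) : set (C * {fset S}) :=
  [set cx | x = cx.2 /\ parabolic gen (mirrors_at x) (dW c cx.1)].

(* The simplicial structure of (C x D)/~: the vertices are the classes of pairs
   (c, x) with x a vertex of D, and the simplices are the images of c x sg.
   The members of a chain sg all contain its least member T, and S(y) = T for y
   in the open simplex sg; hence c x sg and c' x sg' have the same vertices iff
   sg = sg' and dW c c' is in W_T, i.e. iff ~ identifies them. *)
Definition davis_realization : simplicial_complex (set (C * {fset S})).
Proof.
apply: (@SimplicialComplex _ [set ta | exists (c : C) (sg : {fset {fset S}}),
  davis_chamber sg /\ ta = [fset davis_class c x | x in sg]%fset]).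
- move=> _ [c [sg [sgD ->]]]; have /fset0Pn[x xsg] := simplex_neq0 sgD.
  by apply/fset0Pn; exists (davis_class c x); exact: in_imfset.
- move=> _ ta [c [sg [sgD ->]]] /fsubsetP tasg ta0.
  exists c, [fset x in sg | davis_class c x \in ta]%fset.
  have taE : ta = [fset davis_class c x |
      x in [fset x in sg | davis_class c x \in ta]%fset]%fset.
    apply/fsetP => v; apply/idP/imfsetP => /=.
    - move=> vta; have /imfsetP[x /= xsg vE] := tasg _ vta.
      by exists x => //; rewrite !inE /= xsg -vE.
    - by move=> [x + ->]; rewrite !inE => /andP[].
  split=> //; apply: simplex_sub sgD _ _.
  + by apply/fsubsetP => x; rewrite !inE => /andP[].
  + by apply: contra_neq ta0 => sg0; rewrite taE sg0 imfset0.
Defined.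

End Davis.

(* Main.v *)
(* Let m = dim L and n = m + 1. The maximal simplices of X_D are pairs (chamber c,
   flag of spherical subsets of S), and a face of codimension 1 either misses a
   nonempty member of the flag, and then lies in exactly two maximal simplices,
   both in c, or misses the empty set, and then corresponds to a panel. Since L
   is an orientable gallery connected pseudomanifold, an n-chain is a cycle iff
   on each chamber c it is f(c) times a fundamental class, where the sum of f
   over every panel vanishes.

   If such an f is in l^p and f(c0) <> 0, its sum over the q_w chambers at
   distance w from c0 is +-f(c0), so convexity gives sum_w q_w^(1-p) < oo;
   conversely f(c) = (-1)^l(w) / q_w with w = d(c0, c) is in l^p when that series
   converges. The series sum_w q_w^(-t) has abscissa of convergence e_q(W).

   By duality the reduced cohomology in degree n is nonzero iff the series
   converges for the conjugate exponent, i.e. for t = 1/(p-1). If it converges,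
   the cycle above pairs to zero with all coboundaries. If it diverges, then,
   modulo coboundaries, a chamber is up to sign the sum of the chambers at
   distance w, hence any average of these sums, and averages with weights
   q_w^(-1/(p-1)) have arbitrarily small norm. *)

Require Import Defs.
From HB Require Import structures.
From mathcomp Require Import all_boot all_order all_algebra finmap.
From mathcomp Require Import all_classical all_reals all_analysis.
From mathcomp Require Import lra ring zify.

Set Implicit Arguments.
Unset Strict Implicit.
Unset Printing Implicit Defensive.

Import Order.TTheory GRing.Theory Num.Theory.

Local Open Scope classical_set_scope.
Local Open Scope ring_scope.

(** * Orientations and incidence numbers *)

(** The orientation [o] of the realization is arbitrary, so every sign is measured against one fixed
    order, the vertices of a top simplex listed by rank. Rescaling the coefficient at a top simplex
    by [flag_sign] absorbs both [o] and the fundamental class of the chamber; a boundary coefficient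
    then becomes, up to a sign, a difference of two values inside one chamber or a plain sum over a
    panel. Norms are handled through bounds on finite partial sums, and convexity only through
    Young's inequality, as the tangent line of y^p and as a Hoelder-type estimate. The duality uses
    no dual spaces: a cochain is truncated to a finite one, whose pairing with the cycle is a finite
    double sum, and the tail is controlled by boundedness of the coboundary. The weights
    q_w^(-1/(p-1)) come from minimising sum_w a_w^p q_w, the p-th power of the norm of the average
    with weights a_w, under sum_w a_w = 1. Over a finite set of w the minimum is Z^(1-p) with Z =
    sum_w q_w^(-1/(p-1)), and it is small when Z is large. *)

Section Inversions.
Context (V : choiceType).
Implicit Types (s t r : seq V) (x y z : V).

Lemma index_rem s x y : uniq s -> y != x -> y \in s ->
  index y (rem x s) = (index y s - (index x s < index y s))%N.
Proof.
elim: s => //= a s IH /andP[as_ us] yx.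
have [->|ax] := eqVneq a x.
  by rewrite inE [x == y]eq_sym (negbTE yx) /= subn1.
rewrite inE; have [<-|ay] := eqVneq a y; rewrite /= ?eqxx// ?(negbTE ay) /= => ys.
rewrite ltnS IH//; case: ltnP => // h; rewrite ?subn0// subn1 subSS subn0 prednK//.
exact: leq_ltn_trans h.
Qed.

Lemma neq_index s x y : y \in s -> y != x -> index y s != index x s.
Proof.
move=> ys; apply: contra => /eqP E; apply/eqP; apply: (index_inj y ys _ E).
by rewrite -index_mem -E index_mem.
Qed.

Lemma ltn_index_rem s x y z : uniq s -> y != x -> z != x -> y \in s -> z \in s ->
  (index y (rem x s) < index z (rem x s))%N = (index y s < index z s)%N.
Proof.
move=> us yx zx ys zs; rewrite !index_rem//.
by have := neq_index ys yx; have := neq_index zs zx; lia.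
Qed.

(** The inversions lost with [x] are the entries before [x] in [s] that come later in [t], and the
    entries after [x] in [s] that come earlier in [t]. Modulo 2 the former are [index x s] minus the
    entries before [x] that come earlier in [t], so only the total number of entries earlier in [t]
    remains. *)
Lemma inversions_rem_same t s x : uniq s -> {subset s <= t} -> x \in s ->
  odd (inversions t s) = odd (inversions t (rem x s)) (+) odd (index x s)
     (+) odd (count (fun y => index y t < index x t)%N s).
Proof.
elim: s => //= a s IH /andP[as_ us] st; rewrite inE.
have sst : {subset s <= t} by move=> z zs; apply: st; rewrite inE zs orbT.
have [->|ax] := eqVneq x a; rewrite /= ?eqxx.
  by rewrite ltnn add0n oddD addbF addbC.
move=> xs.
rewrite !oddD IH//= (permP (perm_to_rem xs)) /= oddD.
have ne : index a t != index x t.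
  rewrite eq_sym in ax.
  by apply: neq_index => //; exact/st/mem_head.
have -> : (index x t < index a t)%N = ~~ (index a t < index x t)%N.
  by move: ne; case: ltngtP.
rewrite !oddb; case: (index a t < index x t)%N; case: (odd (count _ (rem x s)));
  case: (odd (inversions _ _)); case: (odd (index x s)); case: (odd _) => //.
Qed.

Lemma count_index t x : uniq t -> x \in t ->
  count (fun y => index y t < index x t)%N t = index x t.
Proof.
elim: t => //= a t IH /andP[at_ ut]; rewrite inE.
have [->|xa] := eqVneq x a; rewrite /= ?eqxx.
  by move=> _; rewrite add0n; apply/eqP; rewrite -leqn0 leqNgt -has_count; apply/hasPn.
move=> xt; rewrite ltn0Sn add1n -[in RHS](IH ut xt); congr _.+1.
apply: eq_in_count => y yt; have [E|_] := eqVneq a y; first by rewrite E yt in at_.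
by rewrite ltnS.
Qed.

Lemma inversions_eq_order t t' s : {in s &, forall y z,
    (index y t < index z t)%N = (index y t' < index z t')%N} ->
  inversions t s = inversions t' s.
Proof.
elim: s => //= a s IH h; rewrite IH; last first.
  by move=> y z ys zs; apply: h; rewrite inE ?ys ?zs orbT.
by congr addn; apply: eq_in_count => y ys; apply: h; rewrite inE ?eqxx ?ys ?orbT.
Qed.

(** The entries of [s] that precede [x] in [t] number exactly [index x t]. The result is the
    cofactor sign (-1)^(i+j) in the expansion of a permutation matrix along one entry. *)
Lemma inversions_rem t s x : uniq t -> perm_eq t s -> x \in t ->
  odd (inversions t s) =
    odd (index x t) (+) odd (index x s) (+) odd (inversions (rem x t) (rem x s)).
Proof.
move=> ut ts xt; have us : uniq s by rewrite -(perm_uniq ts).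
have xs : x \in s by rewrite -(perm_mem ts).
rewrite (@inversions_rem_same t s x)//; last by move=> z; rewrite (perm_mem ts).
rewrite -(permP ts) count_index// (@inversions_eq_order (rem x t) t); last first.
  move=> y z; rewrite !mem_rem_uniq// !inE => /andP[yx ys] /andP[zx zs].
  by rewrite ltn_index_rem// (perm_mem ts).
by case: (odd (inversions _ _)); case: (odd (index x s)); case: (odd _).
Qed.

(** Multiplicativity of the signature. Deleting the head of [r] from all three lists produces each
    of its three positions twice, so they cancel modulo 2 and induction on the length applies. *)
Lemma inversions_trans r s t : uniq r -> perm_eq r s -> perm_eq s t ->
  odd (inversions r t) = odd (inversions r s) (+) odd (inversions s t).
Proof.
move: {2}(size r) (leqnn (size r)) => k; elim: k r s t => [|k IH] r s t.
  rewrite leqn0 => /nilP -> _; rewrite perm_sym => /perm_nilP ->.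
  by rewrite perm_sym => /perm_nilP ->.
case: r => [|x r] rk ur rs st.
  move: rs st; rewrite perm_sym => /perm_nilP ->.
  by rewrite perm_sym => /perm_nilP ->.
have xr : x \in x :: r by exact: mem_head.
have us : uniq s by rewrite -(perm_uniq rs).
have xs : x \in s by rewrite -(perm_mem rs).
have xt : x \in t by rewrite -(perm_mem st).
have rt := perm_trans rs st.
rewrite (inversions_rem ur rs xr) (inversions_rem ur rt xr) (inversions_rem us st xs).
have p1 : perm_eq (rem x (x :: r)) (rem x s).
  by rewrite -(perm_cons x) -(permPl (perm_to_rem xr)) -(permPr (perm_to_rem xs)).
have p2 : perm_eq (rem x s) (rem x t).
  by rewrite -(perm_cons x) -(permPl (perm_to_rem xs)) -(permPr (perm_to_rem xt)).
rewrite (IH (rem x (x :: r)) (rem x s) (rem x t))//; last by rewrite rem_uniq.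
- by do 6?case: (odd _).
- by rewrite /= eqxx.
Qed.

Lemma inversions_id s : uniq s -> odd (inversions s s) = false.
Proof. by move=> us; have := inversions_trans us (perm_refl s) (perm_refl s); case: odd. Qed.

Lemma inversions_sym r s : uniq r -> perm_eq r s ->
  odd (inversions r s) = odd (inversions s r).
Proof.
move=> ur rs; have := inversions_trans ur rs (_ : perm_eq s r).
by rewrite perm_sym => /(_ rs); rewrite inversions_id//; case: odd; case: odd.
Qed.

Lemma rem_cat_notin x a b : x \notin a -> rem x (a ++ b) = a ++ rem x b.
Proof.
elim: a => //= y a IH; rewrite inE negb_or eq_sym => /andP[/negbTE -> /IH ->] //.
Qed.

Lemma inversions_swap a x y b : uniq (a ++ x :: y :: b) ->
  odd (inversions (a ++ x :: y :: b) (a ++ y :: x :: b)).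
Proof.
move=> u; have p : perm_eq (a ++ x :: y :: b) (a ++ y :: x :: b).
  by rewrite perm_cat2l -cat1s -(cat1s y b) -(cat1s y) -(cat1s x b) perm_catCA.
have xin : x \in a ++ x :: y :: b by rewrite mem_cat mem_head orbT.
have [xa xy] : x \notin a /\ x != y.
  move: u; rewrite cat_uniq /= => /and3P[_]; rewrite negb_or => /andP[-> _].
  by rewrite inE negb_or => /andP[/andP[]].
have remE t : rem x (a ++ x :: t) = a ++ t.
  by rewrite rem_cat_notin//= eqxx.
have remE' : rem x (a ++ y :: x :: b) = a ++ y :: b.
  by rewrite rem_cat_notin//= eq_sym (negbTE xy) eqxx.
rewrite (inversions_rem u p xin) remE remE' inversions_id; last first.
  by have := rem_uniq x u; rewrite remE.
by rewrite !index_cat (negbTE xa) /= eqxx [y == x]eq_sym (negbTE xy) !oddD /=; case: odd.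
Qed.

(* The sign by which the incidence number computed from vertex orderings [t] of
   [sg] and [rem x t] of [ta] differs from the one of the orientation [o]. *)
Lemma incidence_rem (K : simplicial_complex V) (o : {fset V} -> seq V)
    (sg ta : {fset V}) (t : seq V) x :
  is_orientation K o -> K sg -> K ta ->
  uniq t -> sg =i t -> x \in t -> ta =i rem x t ->
  incidence o sg ta = (-1) ^+ (index x t + inversions t (o sg) + inversions (rem x t) (o ta)).
Proof.
move=> oK sgK taK ut sgt xt tat.
have osg := oK _ sgK.
have ota := oK _ taK.
have tsg : perm_eq t (o sg).
  apply: uniq_perm => //; first by rewrite (perm_uniq osg) fset_uniq.
  by move=> z; rewrite (perm_mem osg) -sgt.
have us : uniq (o sg) by rewrite -(perm_uniq tsg).
have rta : perm_eq (rem x t) (o ta).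
  apply: uniq_perm; rewrite ?rem_uniq//; first by rewrite (perm_uniq ota) fset_uniq.
  by move=> z; rewrite (perm_mem ota) -tat.
have xsg : x \in o sg by rewrite -(perm_mem tsg).
have sub : (ta `<=` sg)%fset.
  by apply/fsubsetP => z; rewrite tat sgt; exact: mem_rem.
have szsg : #|` sg| = size t by rewrite (perm_size tsg) (perm_size osg).
have szta : #|` ta| = size (rem x t) by rewrite (perm_size rta) (perm_size ota).
rewrite /incidence sub szsg szta size_rem// prednK ?eqxx/=; last by case: (t) xt.
have memta z : z \in o sg -> (z \in ta) = (z != x).
  by rewrite -(perm_mem tsg) tat mem_rem_uniq// !inE => ->; rewrite andbT.
have -> : find (fun v => v \notin ta) (o sg) = index x (o sg).
  by rewrite /index; apply: eq_in_find => z /memta ->; rewrite negbK.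
have -> : [seq v <- o sg | v \in ta] = rem x (o sg).
  by rewrite rem_filter//; apply: eq_in_filter => z /memta.
rewrite -signr_odd -[RHS]signr_odd !oddD.
have p1 : perm_eq (rem x t) (rem x (o sg)).
  by rewrite -(perm_cons x) -(permPl (perm_to_rem xt)) -(permPr (perm_to_rem xsg)).
rewrite (inversions_rem ut tsg xt).
rewrite (@inversions_trans (o ta) (rem x t))//; last by rewrite perm_sym.
  rewrite (@inversions_sym (o ta)); last by rewrite perm_sym.
    by do 4?case: (odd _).
  by rewrite (perm_uniq ota) fset_uniq.
by rewrite (perm_uniq ota) fset_uniq.
Qed.

End Inversions.

(** * Sums of p-th powers *)

(** The graph of y^p lies above its tangent at [t]. This is Young's inequality for y and t^(p-1)
    with exponents p and p/(p-1), multiplied by p. *)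
Lemma powR_tangent (R : realType) (p t y : R) : 1 < p -> 0 <= t -> 0 <= y ->
  p * (t `^ (p - 1) * y) <= y `^ p + (p - 1) * t `^ p.
Proof.
move=> p1 t0 y0; have p0 : 0 < p by lra.
have pm0 : 0 < p - 1 by lra.
have pN0 : p != 0 by rewrite gt_eqF.
have pmN0 : p - 1 != 0 by rewrite gt_eqF.
have := @conjugate_powR R y (t `^ (p - 1)) p (p / (p - 1)) y0 (powR_ge0 _ _) p0.
rewrite divr_gt0// invf_div => /(_ isT) /=.
have -> : p^-1 + (p - 1) / p = 1 by field.
move=> /(_ erefl); rewrite -powRrM.
have -> : (p - 1) * (p / (p - 1)) = p by field.
move=> h; rewrite mulrC -ler_pdivlMr// mulrC; apply: le_trans h _.
by rewrite le_eqVlt; apply/orP; left; apply/eqP; field.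
Qed.

(** Jensen's inequality, to be used with [t] the mean: all tangents are taken at the same [t], so
    their linear parts compare by the hypothesis, and p - 1 of the p copies of the sum of t^p
    cancel. *)
Lemma sum_powR_tangent (R : realType) (I : eqType) (p t : R) (l : seq I) (f : I -> R) :
  1 < p -> 0 <= t -> (\sum_(i <- l) t <= \sum_(i <- l) `|f i|) ->
  \sum_(i <- l) t `^ p <= \sum_(i <- l) `|f i| `^ p.
Proof.
move=> p1 t0 tf.
have h : p * t `^ (p - 1) * (\sum_(i <- l) `|f i|) <=
    \sum_(i <- l) (`|f i| `^ p + (p - 1) * t `^ p).
  by rewrite mulr_sumr; apply: ler_sum => i _; rewrite -mulrA powR_tangent.
have tt : p * t `^ (p - 1) * (\sum_(i <- l) t) = p * (\sum_(i <- l) t `^ p).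
  rewrite !mulr_sumr; apply: eq_bigr => i _; rewrite -mulrA; congr (_ * _).
  have [->|tN0] := eqVneq t 0; first by rewrite mulr0 powR0//; lra.
  by rewrite -[in X in _ * X](powRr1 t0) -powRD ?subrK// tN0 implybT.
have {tf} : p * t `^ (p - 1) * (\sum_(i <- l) t) <= p * t `^ (p - 1) * (\sum_(i <- l) `|f i|).
  by rewrite ler_wpM2l// mulr_ge0 ?powR_ge0//; lra.
rewrite tt => /le_trans /(_ h); rewrite big_split /= -mulr_sumr; lra.
Qed.

Section PSum.
Context (R : realType) (T : choiceType) (p : R).
Hypothesis p0 : 0 < p.
Implicit Types (a b : T -> R) (l : seq T) (M e : R).

(** Bounds the p-th power of the l^p norm without extended reals; [lp_norm_fin] and [lp_norm_lt]
    translate back. *)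
Definition psum_le a M := forall l, uniq l -> \sum_(x <- l) `|a x| `^ p <= M.

Lemma psum_le_ge0 a M : psum_le a M -> 0 <= M.
Proof. by move=> /(_ [::] isT); rewrite big_nil. Qed.

Lemma psum_leW a M M' : M <= M' -> psum_le a M -> psum_le a M'.
Proof. by move=> MM aM l /aM h; exact: le_trans h MM. Qed.

Lemma psum_le0 M : 0 <= M -> psum_le (fun=> 0) M.
Proof. by move=> M0 l _; rewrite big1// => x _; rewrite normr0 powR0// gt_eqF. Qed.

Lemma psum_le_mono a b M : (forall x, `|a x| <= `|b x|) -> psum_le b M -> psum_le a M.
Proof.
move=> ab bM l /bM; apply: le_trans; apply: ler_sum => x _.
by apply: ge0_ler_powR => //; rewrite ?nnegrE// ltW.
Qed.

(** From |x + y| <= 2 max(|x|, |y|). This crude constant replaces Minkowski's inequality, since sums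
    are only ever estimated up to a fixed factor. *)
Lemma powR_normD (x y : R) : `|x + y| `^ p <= 2 `^ p * (`|x| `^ p + `|y| `^ p).
Proof.
wlog xy : x y / `|y| <= `|x|.
  by move=> h; have [/h //|/ltW/h] := leP `|y| `|x|; rewrite addrC [in X in _ <= _ * X]addrC.
have : `|x + y| <= 2 * `|x| by rewrite mulr2n mulrDl !mul1r; apply: le_trans (ler_normD _ _) _; rewrite lerD2l.
move=> h; have := @ge0_ler_powR _ p (ltW p0) `|x + y| (2 * `|x|).
rewrite !nnegrE normr_ge0 mulr_ge0// => /(_ isT isT h) /le_trans; apply.
by rewrite powRM// ler_wpM2l ?powR_ge0// lerDl powR_ge0.
Qed.

Lemma psum_leD a b A B : psum_le a A -> psum_le b B ->
  psum_le (fun x => a x + b x) (2 `^ p * (A + B)).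
Proof.
move=> aA bB l ul; apply: le_trans (_ : 2 `^ p * (\sum_(x <- l) (`|a x| `^ p + `|b x| `^ p)) <= _).
  by rewrite mulr_sumr; apply: ler_sum => x _; exact: powR_normD.
by rewrite ler_wpM2l ?powR_ge0// big_split lerD ?aA ?bB.
Qed.

Lemma psum_leZ c a A : psum_le a A -> psum_le (fun x => c * a x) (`|c| `^ p * A).
Proof.
move=> aA l ul; apply: le_trans (_ : `|c| `^ p * (\sum_(x <- l) (`|a x| `^ p)) <= _).
  by rewrite mulr_sumr; apply: ler_sum => x _; rewrite normrM powRM.
by rewrite ler_wpM2l ?powR_ge0// aA.
Qed.

Lemma psum_leN a A : psum_le a A -> psum_le (fun x => - a x) A.
Proof. by apply: psum_le_mono => x; rewrite normrN. Qed.

(** Density of finitely supported functions in l^p: if the partial sum over [l] is within [e] of the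
    supremum, any list disjoint from [l] carries at most [e]. *)
Lemma psum_le_tail a M e : psum_le a M -> 0 < e ->
  exists2 l, uniq l & psum_le (fun x => if x \in l then 0 else a x) e.
Proof.
move=> aM e0; pose E := [set r | exists2 l, uniq l & r = \sum_(x <- l) `|a x| `^ p].
have supE : has_sup E.
  split; first by exists 0, [::] => //; rewrite big_nil.
  by exists M => _ [l ul ->]; exact: aM.
have [_ [l ul ->] hl] := sup_adherent e0 supE.
exists l => // l' ul'.
rewrite (bigID (mem l)) /= big1 ?add0r; last by move=> x ->; rewrite normr0 powR0// gt_eqF.
rewrite (eq_bigr (fun x => `|a x| `^ p)) => [|x /negbTE ->//].
rewrite -big_filter; set l2 := [seq _ <- _ | _].
have u2 : uniq (l ++ l2).
  rewrite cat_uniq ul filter_uniq// andbT /=; apply/hasPn => x.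
  by rewrite mem_filter => /andP[].
have : \sum_(x <- l ++ l2) `|a x| `^ p <= sup E.
  by apply: ub_le_sup; [case: supE|exists (l ++ l2)].
rewrite big_cat /=; lra.
Qed.

Lemma sum_uniq_le (I : eqType) (l1 l2 : seq I) (F : I -> R) : uniq l1 ->
  {subset l1 <= l2} -> (forall x, 0 <= F x) -> \sum_(x <- l1) F x <= \sum_(x <- l2) F x.
Proof.
move=> u1; elim: l1 u1 l2 => [|x l1 IH] /=.
  by move=> _ l2 _ F0; rewrite big_nil sumr_ge0.
move=> /andP[xl1 u1] l2 sub F0.
have xl2 : x \in l2 by apply/sub/mem_head.
rewrite big_cons (perm_big _ (perm_to_rem xl2)) big_cons lerD2l IH// => z zl1.
have : z \in l2 by apply: sub; rewrite inE zl1 orbT.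
rewrite (perm_mem (perm_to_rem xl2)) inE => /orP[/eqP E|//].
by rewrite -E zl1 in xl1.
Qed.

Lemma esum_le_psum a M :
  ((\esum_(x in [set: T]) (`|a x| `^ p)%:E <= M%:E)%E) <-> psum_le a M.
Proof.
split=> [h l ul|h].
  rewrite -lee_fin; apply: le_trans h; apply: esum_ge; exists [set` l]; first by [].
  by rewrite -fsbig_seq// sumEFin.
apply: ge_ereal_sup => _ [X [finX _] <-].
rewrite fsbig_finite//= sumEFin lee_fin; exact: h.
Qed.

Lemma esum_psum_ge0 a : (0 <= \esum_(x in [set: T]) (`|a x| `^ p)%:E)%E.
Proof. by apply: esum_ge0 => x _; rewrite lee_fin powR_ge0. Qed.

End PSum.

Section LpNorm.
Context (R : realType) (V : choiceType) (p : R).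
Hypothesis p0 : 0 < p.
Implicit Types (a : {fset V} -> R).

Lemma lp_norm_fin a : (lp_norm p a < +oo)%E <-> exists M, psum_le p a M.
Proof.
have pN0 : p^-1 != 0 by rewrite invr_eq0 gt_eqF.
have e0 := esum_psum_ge0 p a; rewrite /lp_norm; split.
  move=> /(lty_poweRy pN0) h; exists (fine (\esum_(x in [set: {fset V}]) (`|a x| `^ p)%:E)).
  by apply/esum_le_psum; rewrite fineK// ge0_fin_numE.
move=> [M /esum_le_psum h]; apply: poweR_lty; apply: le_lt_trans h _; exact: ltry.
Qed.

Lemma lp_norm_lt a e : 0 < e ->
  (lp_norm p a < e%:E)%E <-> exists2 M, M < e `^ p & psum_le p a M.
Proof.
move=> el0; have pN0 : p^-1 != 0 by rewrite invr_eq0 gt_eqF.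
have e0 := esum_psum_ge0 p a; split.
  move=> h; have /(lty_poweRy pN0) : (lp_norm p a < +oo)%E by apply: lt_trans h _; exact: ltry.
  move: h; rewrite /lp_norm; move: e0; set s := \esum_(_ in _) _ => s0 + sfin.
  have sE : s = (fine s)%:E by rewrite fineK// ge0_fin_numE.
  rewrite sE poweR_EFin lte_fin => h; exists (fine s); last by apply/esum_le_psum; rewrite -sE.
  have f0 : 0 <= fine s by exact: fine_ge0.
  have := @gt0_ltr_powR _ p p0 (fine s `^ p^-1) e; rewrite !nnegrE powR_ge0 (ltW el0).
  by move=> /(_ isT isT h); rewrite -powRrM mulVf ?gt_eqF// powRr1.
move=> [M Me /esum_le_psum]; rewrite /lp_norm; move: e0; set s := \esum_(_ in _) _ => s0 sM.
have sE : s = (fine s)%:E by rewrite fineK// ge0_fin_numE//; apply: le_lt_trans sM _; exact: ltry.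
rewrite sE poweR_EFin lte_fin; have f0 : 0 <= fine s by exact: fine_ge0.
have sM' : fine s < e `^ p by rewrite -lte_fin -sE; apply: le_lt_trans sM _; rewrite lte_fin.
have := @gt0_ltr_powR _ p^-1 _ (fine s) (e `^ p); rewrite invr_gt0 !nnegrE f0 powR_ge0.
by move=> /(_ p0 isT isT sM'); rewrite -powRrM mulfV ?gt_eqF// powRr1// ltW.
Qed.

End LpNorm.

(** Continuity of the pairing with [g], from Young's inequality applied to |h|/t and t|g|: the scale
    [t] makes the part with [g] at most e/3, and then [d] makes the part with [h] at most e/3. *)
Lemma pairing_small (R : realType) (T : choiceType) (p p' : R) (g : T -> R) (G e : R) :
  0 < p -> 0 < p' -> p^-1 + p'^-1 = 1 -> psum_le p' g G -> 0 < e ->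
  exists2 d : R, 0 < d & forall h, psum_le p h d -> forall l : seq T, uniq l ->
    `|\sum_(x <- l) h x * g x| < e.
Proof.
move=> p0 p'0 pp' gG e0; have G0 := psum_le_ge0 gG.
have G1 : 0 < G + 1 by lra.
have p'i : 0 < p'^-1 by rewrite invr_gt0.
have pi : 0 < p^-1 by rewrite invr_gt0.
have pge : 1 <= p by rewrite -(invrK p) invf_ge1 ?invr_gt0//; have := p'i; lra.
have p'ge : 1 <= p' by rewrite -(invrK p') invf_ge1 ?invr_gt0//; have := pi; lra.
(* [G] may be 0, hence the denominator [G + 1]; [x] is the coefficient t^p' in front of |g|^p'. *)
pose x := e / 3 / (G + 1); have x0 : 0 < x by rewrite /x !divr_gt0.
pose t := x `^ p'^-1; have t0 : 0 < t by exact: powR_gt0.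
have tp' : t `^ p' = x by rewrite /t -powRrM mulVf ?gt_eqF// powRr1// ltW.
have tp0 : 0 < t `^ p by exact: powR_gt0.
exists (t `^ p * (e / 3)) => [|h hd l ul]; first by rewrite mulr_gt0// divr_gt0.
have young y : `|h y * g y| <= (t `^ p)^-1 * `|h y| `^ p + x * `|g y| `^ p'.
  have := @conjugate_powR R (t^-1 * `|h y|) (t * `|g y|) p p'.
  rewrite !mulr_ge0 ?invr_ge0 ?(ltW t0)// => /(_ isT isT p0 p'0 pp').
  rewrite mulrACA mulVf ?gt_eqF// mul1r -normrM !powRM ?invr_ge0 ?(ltW t0)// tp'.
  rewrite -{1}(powR_inv1 (ltW t0)) -powRrM mulN1r powRN => /le_trans; apply.
  have le1 (z k : R) : 0 <= z -> 1 <= k -> z / k <= z.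
    by move=> z0 k1; rewrite ler_pdivrMr ?ler_peMr//; lra.
  by rewrite lerD// le1// mulr_ge0 ?invr_ge0 ?powR_ge0// ltW.
apply: le_lt_trans (ler_norm_sum _ _ _) _.
apply: le_lt_trans (_ : \sum_(y <- l) ((t `^ p)^-1 * `|h y| `^ p + x * `|g y| `^ p') < _).
  exact: ler_sum.
rewrite big_split /= -!mulr_sumr.
have h1 : (t `^ p)^-1 * \sum_(y <- l) `|h y| `^ p <= e / 3.
  by rewrite mulrC ler_pdivrMr// mulrC hd.
have h2 : x * \sum_(y <- l) `|g y| `^ p' <= e / 3.
  apply: le_trans (_ : x * G <= _); first by rewrite ler_wpM2l ?gG// ltW.
  by rewrite /x mulrAC ler_pdivrMr// ler_wpM2l//; lra.
lra.
Qed.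

(** * Coxeter groups and growth *)

Section CoxeterWords.
Context (W : groupType) (S : finType) (gen : S -> W).
Hypothesis hW : is_coxeter_system gen.
Implicit Types (u v : seq S) (w : W) (s : S).

Lemma wprod_nil : wprod gen [::] = 1%g.
Proof. by rewrite /wprod big_nil. Qed.

Lemma wprod_cat u v : wprod gen (u ++ v) = (wprod gen u * wprod gen v)%g.
Proof. by rewrite /wprod big_cat. Qed.

Lemma wprod1 s : wprod gen [:: s] = gen s.
Proof. by rewrite /wprod big_seq1. Qed.

Lemma wprod_cons s u : wprod gen (s :: u) = (gen s * wprod gen u)%g.
Proof. by rewrite /wprod big_cons. Qed.

Lemma wprod_rcons u s : wprod gen (rcons u s) = (wprod gen u * gen s)%g.
Proof. by rewrite -cats1 wprod_cat wprod1. Qed.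

Lemma odd_size_wprod u v : wprod gen u = wprod gen v -> odd (size u) = odd (size v).
Proof.
have [m [_ _ wprodE]] := hW; move=> /wprodE.
elim=> {u v} [u v s t|//|u v _ ->//|u v w _ -> _ ->//].
rewrite !size_cat !oddD size_flatten /shape map_nseq /= sumn_nseq.
by rewrite mul2n odd_double addFb.
Qed.

Lemma genK s : (gen s * gen s = 1)%g.
Proof.
have [m [[mss _ _] _ wprodE]] := hW.
rewrite -wprod1 -wprod_cat -wprod_nil; apply/wprodE.
by have := coxeter_relation m [::] [::] s s; rewrite mss.
Qed.

Lemma genV s : ((gen s)^-1 = gen s)%g.
Proof. by apply: (mulgI (gen s)); rewrite mulgV genK. Qed.

Lemma wprod_rev u : wprod gen (rev u) = (wprod gen u)^-1%g.
Proof.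
elim: u => [|s u IH]; first by rewrite wprod_nil invg1.
by rewrite rev_cons wprod_rcons IH wprod_cons invgM genV.
Qed.

Lemma reduced_exists w : exists u, reduced gen u /\ wprod gen u = w.
Proof.
have [m [_ /(_ w) [u0 u0w] _]] := hW.
have ex : exists k, `[< exists u, wprod gen u = w /\ size u = k >].
  by exists (size u0); apply/asboolP; exists u0.
have [k /asboolP [u [uw <-]] kmin] := ex_minnP ex.
exists u; split=> // v vu; apply: kmin; apply/asboolP.
by exists v; rewrite vu.
Qed.

Lemma reduced_expressionP w :
  reduced gen (reduced_expression gen w) /\ wprod gen (reduced_expression gen w) = w.
Proof. exact: (xgetPex [::] (reduced_exists w)). Qed.

Lemma reduced_size u v : reduced gen u -> reduced gen v ->
  wprod gen u = wprod gen v -> size u = size v.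
Proof.
by move=> ru rv uv; apply/eqP; rewrite eqn_leq ru ?rv.
Qed.

Lemma reduced_nil : reduced gen [::].
Proof. by []. Qed.

Lemma reduced1 s : reduced gen [:: s].
Proof. by case=> // /odd_size_wprod. Qed.

Lemma reduced_rev u : reduced gen u -> reduced gen (rev u).
Proof.
move=> ru v; rewrite wprod_rev => vu; rewrite size_rev -(size_rev v).
by apply: ru; rewrite wprod_rev vu invgK.
Qed.

Lemma reduced_rconsW u s : reduced gen (rcons u s) -> reduced gen u.
Proof.
move=> ru v vu; rewrite -ltnS -(size_rcons u s) -(size_rcons v s).
by apply: ru; rewrite !wprod_rcons vu.
Qed.

(* Lengths of [w] and [w s] have different parities, so one of the two steps
   between them is an ascent; the exchange condition is not needed. *)
Lemma ascent_or_descent u s : reduced gen u ->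
  reduced gen (rcons u s) \/
  exists v, [/\ reduced gen v, reduced gen (rcons v s)
              & wprod gen (rcons v s) = wprod gen u].
Proof.
move=> ru; have [v [rv vE]] := reduced_exists (wprod gen u * gen s)%g.
have vsE : wprod gen (rcons v s) = wprod gen u.
  by rewrite wprod_rcons vE -mulgA genK mulg1.
have le1 : (size v <= (size u).+1)%N.
  by rewrite -(size_rcons u s); apply: rv; rewrite wprod_rcons.
have le2 : (size u <= (size v).+1)%N.
  by rewrite -(size_rcons v s); apply: ru.
have neq : odd (size v) != odd (size u).
  by rewrite -(odd_size_wprod vsE) size_rcons /=; case: odd.
case: (ltngtP (size u) (size v)) => [ltuv|ltvu|E].
- left=> x xE; rewrite size_rcons (leq_trans ltuv)//; apply: rv.
  by rewrite xE wprod_rcons.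
- right; exists v; split=> // x; rewrite vsE size_rcons => xE.
  by apply: leq_trans ltvu _; exact: ru.
- by rewrite E eqxx in neq.
Qed.

End CoxeterWords.

Lemma sum_uniq_const_le (R : numDomainType) (I : choiceType) (l : seq I) (A : {fset I})
    (F : I -> R) c : uniq l -> {subset l <= A} -> 0 <= c ->
  (forall x, x \in l -> F x <= c) -> \sum_(x <- l) F x <= #|` A|%:R * c.
Proof.
move=> ul lA c0 Fc; apply: le_trans (_ : \sum_(x <- l) c <= _).
  by rewrite !big_seq; apply: ler_sum.
rewrite big_const_seq count_predT iter_addr_0 -(mulr_natl c) ler_wpM2r// ler_nat.
exact: uniq_leq_size.
Qed.

Lemma geometric_sum_le (R : realFieldType) (r : R) n0 m : 0 <= r -> r < 1 ->
  \sum_(i < m) r ^+ (n0 + i) <= (1 - r)^-1.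
Proof.
move=> r0 r1; have d0 : 0 < 1 - r by lra.
have le1 k : r ^+ k <= 1 by rewrite exprn_ile1// ltW.
apply: le_trans (_ : \sum_(i < m) r ^+ i <= _).
  apply: ler_sum => i _; rewrite exprD; apply: ler_piMl => //; exact: exprn_ge0.
rewrite -[leRHS]mul1r ler_pdivlMr//.
have := subrX1 r m; have : 0 <= r ^+ m by exact: exprn_ge0.
set s := \sum_(_ < _) _; nra.
Qed.

(** * The growth exponent as the abscissa of convergence of the weight series *)

Section Growth.
Context (W : groupType) (S : finType) (gen : S -> W).
Hypothesis hW : is_coxeter_system gen.
Context (q : S -> nat).
Hypothesis q_ge2 : forall s, (2 <= q s)%N.
Context (R : realType).
Let qw (w : W) : R := (q_weight gen q w)%:R.
Let ball (n : nat) : set W := [set w : W | qw w <= expR (n%:R : R)].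
Let N n := #|` fset_set (ball n)|.
Let e := growth_exponent gen R q.

Lemma q_weight_ge2X w : (2 ^ size (reduced_expression gen w) <= q_weight gen q w)%N.
Proof.
rewrite /q_weight; elim: (reduced_expression gen w) => [|s l IH] /=.
  by rewrite big_nil.
by rewrite big_cons expnS leq_mul.
Qed.

Lemma qw_ge1 w : 1 <= qw w.
Proof.
rewrite /qw ler1n; apply: leq_trans (q_weight_ge2X w); exact: expn_gt0.
Qed.

Lemma q_weight1 : q_weight gen q 1%g = 1%N.
Proof.
have [r1 /= _] := reduced_expressionP hW 1%g.
have := r1 [::]; rewrite wprod_nil (reduced_expressionP hW 1%g).2 /= leqn0 => /(_ erefl).
by rewrite /q_weight => /nilP ->; rewrite big_nil.
Qed.

(** As q_w >= 2^l(w) and e <= 2^b, elements of [ball n] have length at most b * n. Padding their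
    words with [None] to exactly that length leaves (|S| + 1)^(b n) tuples. Hence balls are finite
    and grow at most exponentially. *)
Lemma ball_words : exists k : nat, forall n, exists l : seq W,
  (size l = #|S|.+1 ^ (k * n))%N /\ forall w, ball n w -> w \in l.
Proof.
pose b := Num.bound (expR (1 : R)); exists b => n.
exists [seq wprod gen (pmap id (tval t)) | t <- enum {: (b * n).-tuple (option S)}].
split; first by rewrite size_map -cardE card_tuple card_option.
move=> w wn; have [_ wE] := reduced_expressionP hW w.
have szw : (size (reduced_expression gen w) <= b * n)%N.
  rewrite -(@leq_exp2l 2)//; apply: leq_trans (q_weight_ge2X w) _.
  rewrite -(ler_nat R); apply: le_trans wn _; rewrite -[n%:R]mul1r expRM_natr natrX exprM.
  rewrite lerXn2r ?nnegrE ?expR_ge0 ?exprn_ge0//.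
  have /ltW := archi_boundP (expR_ge0 (1 : R)) => /le_trans; apply.
  by rewrite -natrX ler_nat ltnW// ltn_expl.
pose t := [seq Some s | s <- reduced_expression gen w] ++
  nseq (b * n - size (reduced_expression gen w)) None.
have szt : size t == (b * n)%N by rewrite size_cat size_map size_nseq subnKC.
apply/mapP; exists (Tuple szt); first by rewrite mem_enum.
rewrite -[LHS]wE /= /t pmap_cat map_pK// [X in _ ++ X](_ : _ = [::]) ?cats0//.
by elim: (b * n - _)%N.
Qed.

Lemma ball_finite n : finite_set (ball n).
Proof.
have [k /(_ n) [l [_ sub]]] := ball_words.
by apply: sub_finite_set (finite_seq l) => w /sub.
Qed.

Lemma mem_ball n w : (w \in fset_set (ball n)) = (qw w <= expR n%:R).
Proof. by rewrite in_fset_set; [apply/idP/idP; rewrite inE|exact: ball_finite]. Qed.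

Lemma N_ge1 n : (1 <= N n)%N.
Proof.
rewrite cardfs_gt0; apply/fset0Pn; exists 1%g.
by rewrite mem_ball /qw q_weight1; apply: le_trans (expR_ge1Dx _); rewrite lerDl.
Qed.

Lemma growth_exponent_ge0 : (0 <= e)%E.
Proof.
apply: limf_esup_ge0; first exact: filter_not_empty.
by move=> n; rewrite lee_fin divr_ge0// ln_ge0// ler1n N_ge1.
Qed.

Lemma growth_exponent_lt (t : R) : (e < t%:E)%E ->
  exists n0, forall n, (n0 <= n)%N -> (0 < n)%N -> (N n)%:R <= expR (t * n%:R).
Proof.
move=> /ereal_inf_lt[_ [A [n0 _ An0] <-] At]; exists n0 => n n0n n_gt0.
have : ((ln (N n)%:R / n%:R)%:E < t%:E)%E.
  by apply: le_lt_trans At; apply: ereal_sup_ubound; exists n => //; exact: An0.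
rewrite lte_fin ltr_pdivrMr ?ltr0n// => /ltW.
by rewrite -ler_expR lnK// posrE ltr0n N_ge1.
Qed.

Lemma growth_exponent_gt (t : R) : (t%:E < e)%E ->
  forall n0, exists n, [/\ (n0 <= n)%N, (0 < n)%N & expR (t * n%:R) < (N n)%:R].
Proof.
move=> te n0; pose A := [set n : nat | (maxn n0 1 <= n)%N].
have : (t%:E < ereal_sup [set (ln (N n)%:R / n%:R)%:E | n in A])%E.
  apply: lt_le_trans te _; apply: ereal_inf_lbound; exists A => //.
  by exists (maxn n0 1).
move=> /ereal_sup_gt[_ [n nA <-]]; move: nA; rewrite /A /= geq_max => /andP[n0n n_gt0].
rewrite lte_fin ltr_pdivlMr ?ltr0n// => h; exists n; split=> //.
by rewrite -ltr_expR lnK// posrE ltr0n N_ge1 in h.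
Qed.

Lemma growth_exponent_fin : e \is a fin_num.
Proof.
rewrite ge0_fin_numE; last exact: growth_exponent_ge0.
have [k kN] := ball_words.
have NK n : (N n)%:R <= ((#|S|.+1)%:R ^+ k : R) ^+ n.
  have [l [sl sub]] := kN n; rewrite -exprM -natrX -sl ler_nat.
  by apply: uniq_leq_size => [|w]; [exact: fset_uniq|rewrite mem_ball => /sub].
pose K : R := ln ((#|S|.+1)%:R ^+ k).
have K1 : 0 < ((#|S|.+1)%:R ^+ k : R) by rewrite exprn_gt0// ltr0n.
rewrite ltNge; apply/negP => ey.
have [|n [_ n0]] := @growth_exponent_gt K _ 0%N; first by apply: lt_le_trans ey; exact: ltry.
rewrite /K expRM_natr lnK ?posrE// => /lt_le_trans /(_ (NK n)).
by rewrite ltxx.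
Qed.

Definition weight_summable (t : R) :=
  exists M, forall l : seq W, uniq l -> \sum_(w <- l) qw w `^ (- t) <= M.

Lemma powRN_le (x y t : R) : 0 <= t -> 0 < x -> x <= y -> y `^ (- t) <= x `^ (- t).
Proof.
move=> t0 x0 xy; have y0 := lt_le_trans x0 xy.
rewrite !powRN lef_pV2 ?posrE ?powR_gt0//; apply: ge0_ler_powR => //; rewrite nnegrE ltW//.
Qed.

(** If t < t' < e, then for arbitrarily large n the ball of radius e^n has more than e^(t'n)
    elements, each contributing at least e^(-tn); the sum over it exceeds e^((t'-t)n), which is
    unbounded. *)
Lemma weight_summable_lt (t : R) : 0 <= t -> weight_summable t -> (e <= t%:E)%E.
Proof.
move=> t0 [M hM]; rewrite leNgt; apply/negP => te.
have ef := growth_exponent_fin; rewrite -(fineK ef) lte_fin in te.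
pose t' := (t + fine e) / 2; have tt' : t < t' by rewrite /t'; lra.
have t'e : (t'%:E < e)%E by rewrite -(fineK ef) lte_fin /t'; lra.
have M0 : 0 <= M by have := hM [::] isT; rewrite big_nil.
(* For n >= n0 one has (t' - t) n > M, and e^x >= 1 + x then suffices to pass the bound [M]. *)
pose n0 := Num.bound (M / (t' - t)).
have [n [n0n n_gt0 hn]] := growth_exponent_gt t'e n0.
have := hM _ (fset_uniq (fset_set (ball n))); apply/negP; rewrite -ltNge.
apply: lt_le_trans (_ : (N n)%:R * expR n%:R `^ (- t) <= _).
  apply: lt_trans (_ : expR (t' * n%:R) * expR n%:R `^ (- t) < _); last first.
    by rewrite ltr_pM2r// powR_gt0 ?expR_gt0.
  rewrite -expRM -expRD; apply: lt_le_trans (expR_ge1Dx _).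
  have : M / (t' - t) < n%:R.
    apply: lt_le_trans (_ : n0%:R <= _); last by rewrite ler_nat.
    by apply: archi_boundP; rewrite divr_ge0//; lra.
  rewrite ltr_pdivrMr; [nra|lra].
have -> : (N n)%:R * expR n%:R `^ (- t) = \sum_(w <- fset_set (ball n)) expR (n%:R : R) `^ (- t).
  by rewrite big_const_seq count_predT iter_addr_0 -(mulr_natl (_ `^ _)).
rewrite big_seq [leRHS]big_seq; apply: ler_sum => w; rewrite mem_ball => wn.
by apply: powRN_le => //; apply: lt_le_trans (qw_ge1 w).
Qed.

(** The group is cut into shells e^n < q_w <= e^(n+1). For e < t' < t and n large, a shell has at
    most e^(t'(n+1)) elements, each contributing at most e^(-tn), so the shells are dominated by
    e^t' times a geometric series of ratio e^(t'-t). *)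
Lemma weight_summable_gt (t : R) : (e < t%:E)%E -> weight_summable t.
Proof.
move=> et; have ef := growth_exponent_fin.
have e0 := growth_exponent_ge0; rewrite -(fineK ef) lee_fin in e0.
rewrite -(fineK ef) lte_fin in et.
pose t' := (t + fine e) / 2; have tt' : t' < t by rewrite /t'; lra.
have et' : (e < t'%:E)%E by rewrite -(fineK ef) lte_fin /t'; lra.
have t'0 : 0 < t' by rewrite /t'; lra.
have [n0 hn0] := growth_exponent_lt et'.
pose r := expR (t' - t); have r0 : 0 <= r by exact: expR_ge0.
have r1 : r < 1 by rewrite /r expR_lt1; lra.
(* The first term pays for the ball of radius e^n0, where each summand is at most 1 because q_w >=
   1; the second sums the shells outside it. *)
exists ((N n0)%:R + expR t' * (1 - r)^-1) => l ul.
suff main m : forall l, uniq l -> (forall w, w \in l -> qw w <= expR (n0 + m)%:R) ->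
    \sum_(w <- l) qw w `^ (- t) <= (N n0)%:R + expR t' * \sum_(i < m) r ^+ (n0 + i).
  (* A finite list lies in some ball: the largest weight m in it satisfies m <= e^m. *)
  have [m hm] : exists m : nat, forall w, w \in l -> qw w <= expR m%:R.
    exists (\max_(w <- l) q_weight gen q w)%N => w wl.
    apply: le_trans (_ : (\max_(w <- l) q_weight gen q w)%N%:R <= _).
      by rewrite /qw ler_nat; exact: (@leq_bigmax_seq _ _ xpredT).
    by apply: le_trans (expR_ge1Dx _); rewrite lerDr.
  apply: le_trans (main m l ul _) _ => [w wl|].
    by apply: le_trans (hm w wl) _; rewrite ler_expR ler_nat leq_addl.
  by rewrite lerD2l ler_wpM2l ?expR_ge0// geometric_sum_le.
elim: m => [|m IH] {ul}l ul hl.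
  rewrite big_ord0 mulr0 addr0 -[leRHS]mulr1; apply: sum_uniq_const_le => // w wl.
    by rewrite mem_ball; have := hl w wl; rewrite addn0.
  rewrite powRN invf_le1 ?powR_gt0//; last by apply: lt_le_trans (qw_ge1 w).
  by rewrite -[leLHS](powRr0 (qw w)) ler_powR ?qw_ge1//; lra.
rewrite (bigID (fun w => qw w <= expR (n0 + m)%:R)) /= big_ord_recr /= mulrDr addrA lerD//.
  rewrite -big_filter; apply: IH; first exact: filter_uniq.
  by move=> w; rewrite mem_filter => /andP[].
rewrite -big_filter; apply: le_trans (_ : (N (n0 + m.+1))%:R * expR (n0 + m)%:R `^ (- t) <= _).
  apply: sum_uniq_const_le; rewrite ?filter_uniq ?powR_ge0//.
    by move=> w; rewrite mem_filter mem_ball => /andP[_ /hl].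
  move=> w; rewrite mem_filter -ltNge => /andP[/ltW wm _].
  by apply: powRN_le; [lra|exact: expR_gt0|].
apply: le_trans (_ : expR (t' * (n0 + m.+1)%:R) * expR (n0 + m)%:R `^ (- t) <= _).
  by rewrite ler_wpM2r ?powR_ge0// hn0 ?leq_addr// addnS.
rewrite -expRM -expRM_natr -!expRD ler_expR addnS -natr1 le_eqVlt; apply/orP; left.
by apply/eqP; ring.
Qed.

End Growth.

(** * Buildings *)

Lemma uniq_flatten_map (A B : eqType) (F : A -> seq B) (l : seq A) : uniq l ->
  (forall x, x \in l -> uniq (F x)) ->
  (forall x y z, x \in l -> y \in l -> z \in F x -> z \in F y -> x = y) ->
  uniq (flatten [seq F x | x <- l]).
Proof.
elim: l => //= x l IH /andP[xl ul] uF dF; rewrite cat_uniq uF ?mem_head//=.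
apply/andP; split; last first.
  apply: IH => // [y yl|y1 y2 z y1l y2l]; first by apply: uF; rewrite inE yl orbT.
  by apply: dF; rewrite inE ?y1l ?y2l orbT.
apply/hasPn => z /flatten_mapP[y yl zy]; apply/negP => zx.
by move: xl; rewrite (dF x y z) ?mem_head ?yl// inE yl orbT.
Qed.

Section Building.
Context (W : groupType) (S : finType) (gen : S -> W).
Hypothesis hW : is_coxeter_system gen.
Context (C : chamber_system S) (dW : C -> C -> W).
Hypothesis hC : is_building gen dW.
Implicit Types (u v : seq S) (w : W) (s : S) (c : C).

Lemma sadjacent_sym s c c' : sadjacent s c c' -> sadjacent s c' c.
Proof. by case=> ne e; split; [move=> E; apply: ne|exact: sequiv_sym]. Qed.

Lemma sadjacent_trans s c c' c'' :
  sadjacent s c c' -> sadjacent s c' c'' -> c <> c'' -> sadjacent s c c''.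
Proof. by case=> _ e [_ e'] ne; split=> //; exact: sequiv_trans e e'. Qed.

Lemma galleryP u c c' : reduced gen u -> gallery u c c' <-> dW c c' = wprod gen u.
Proof. by move=> ru; have [_ h] := hC; exact: h. Qed.

Lemma gallery_rcons u s c c' :
  gallery (rcons u s) c c' <-> exists2 c1, gallery u c c1 & sadjacent s c1 c'.
Proof.
elim: u c => [|t u IH] c /=.
  split=> [[c1 a <-]|[c1 <- a]]; [by exists c|by exists c'].
split=> [[c1 a /IH[c2 g b]]|[c2 [c1 a g] b]].
  by exists c2 => //; exists c1.
by exists c1 => //; apply/IH; exists c2.
Qed.

Lemma gallery_rev u c c' : gallery u c c' -> gallery (rev u) c' c.
Proof.
elim: u c => [|s u IH] c /=; first by move=> ->.
move=> [c1 a /IH g]; rewrite rev_cons; apply/gallery_rcons.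
by exists c1 => //; exact: sadjacent_sym.
Qed.

Lemma dW_refl c : dW c c = 1%g.
Proof. by rewrite -(wprod_nil gen); apply/(galleryP c c (@reduced_nil _ _ gen)). Qed.

Lemma dW_eq1 c c' : dW c c' = 1%g -> c = c'.
Proof. by rewrite -(wprod_nil gen) => /(galleryP c c' (@reduced_nil _ _ gen)). Qed.

Lemma dW_gen s c c' : dW c c' = gen s <-> sadjacent s c c'.
Proof.
rewrite -(wprod1 gen); have h := galleryP c c' (@reduced1 _ _ _ hW s).
split=> [/h[c1 a <-] //|a]; apply/h; by exists c'.
Qed.

Lemma dW_inv c c' : dW c' c = (dW c c')^-1%g.
Proof.
have [u [ru uE]] := reduced_exists hW (dW c c').
rewrite -uE -(wprod_rev hW); apply/galleryP; first exact: reduced_rev.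
by apply: gallery_rev; apply/galleryP.
Qed.

Lemma dW_ascent u s c0 c c' : reduced gen (rcons u s) ->
  dW c0 c = wprod gen u -> sadjacent s c c' -> dW c0 c' = wprod gen (rcons u s).
Proof.
move=> rus d a; apply/galleryP => //; apply/gallery_rcons; exists c => //.
by apply/galleryP => //; exact: reduced_rconsW rus.
Qed.

Lemma dW_descent u s c0 c : reduced gen (rcons u s) ->
  dW c0 c = wprod gen (rcons u s) ->
  exists2 c1, dW c0 c1 = wprod gen u & sadjacent s c1 c.
Proof.
move=> rus /galleryP => /(_ rus) /gallery_rcons[c1 g a]; exists c1 => //.
by apply/galleryP => //; exact: reduced_rconsW rus.
Qed.

Lemma wprod_rcons_neq u s : wprod gen (rcons u s) <> wprod gen u.
Proof. by move=> /(odd_size_wprod hW); rewrite size_rcons /=; case: odd. Qed.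

(** If the two chambers differed they would be [s]-adjacent, so [dW_ascent] would place [c2] one
    step further from [c0] than [c1], against the parity of lengths. *)
Lemma dW_descent_uniq u s c0 c c1 c2 : reduced gen (rcons u s) ->
  dW c0 c1 = wprod gen u -> dW c0 c2 = wprod gen u ->
  sadjacent s c1 c -> sadjacent s c2 c -> c1 = c2.
Proof.
move=> rus d1 d2 a1 a2; apply: contrapT => ne.
have a : sadjacent s c1 c2 by apply: sadjacent_trans a1 (sadjacent_sym a2) ne.
by have := dW_ascent rus d1 a; rewrite d2 => /esym /wprod_rcons_neq.
Qed.

(** [c1] is the projection of [c0] to the panel of [c]: since [rcons u s] is reduced, [dW_ascent]
    puts all other chambers of the panel one step further away. *)
Lemma panel_bottom c0 c s : exists u c1,
  [/\ reduced gen (rcons u s), dW c0 c1 = wprod gen u & sequiv s c1 c].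
Proof.
have [u [ru uE]] := reduced_exists hW (dW c0 c).
have [rus|[v [rv rvs vsE]]] := ascent_or_descent hW s ru.
  by exists u, c; split=> //; exact: sequiv_refl.
have := uE; rewrite -vsE => /esym /(dW_descent rvs)[c1 d [_ e]].
by exists v, c1.
Qed.

Lemma dW_sequiv s c0 c c' : sequiv s c c' ->
  dW c0 c' = dW c0 c \/ dW c0 c' = (dW c0 c * gen s)%g.
Proof.
move=> e; have [u [c1 [rus d1 e1]]] := panel_bottom c0 c s.
have dE c2 : sequiv s c1 c2 -> dW c0 c2 = wprod gen u \/ dW c0 c2 = wprod gen (rcons u s).
  move=> e2; have [<-|ne] := pselect (c1 = c2); [by left|right].
  exact: dW_ascent rus d1 (conj ne e2).
have := dE _ e1; have := dE _ (sequiv_trans e1 e).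
rewrite wprod_rcons => -[] -> [] ->; rewrite -?mulgA ?(genK hW) ?mulg1; tauto.
Qed.

Lemma dW_sequivl s c0 c c' : sequiv s c c' ->
  dW c' c0 = dW c c0 \/ dW c' c0 = (gen s * dW c c0)%g.
Proof.
rewrite (dW_inv c0 c') (dW_inv c0 c) => /(dW_sequiv c0) [] ->; first by left.
by rewrite invgM (genV hW); right.
Qed.

Context (q : S -> nat).
Hypothesis hq : is_regular C q.

(** [{classic C}] equips the bare type of chambers with the equality and choice structures needed
    for finite sets and lists without repetition. *)
Definition adj s c : seq {classic C} :=
  fset_set [set c' : {classic C} | sadjacent s c c'].

Lemma panel_finite s c : finite_set [set c' : {classic C} | sequiv s c c'].
Proof. by apply/finite_setP; exists (q s).+1; exact: hq. Qed.

Lemma mem_adj s c c' : (c' : {classic C}) \in adj s c <-> sadjacent s c c'.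
Proof.
rewrite /adj in_fset_set; last first.
  by apply: sub_finite_set (panel_finite s c) => x [].
by rewrite inE.
Qed.

Lemma adj_uniq s c : uniq (adj s c).
Proof. exact: fset_uniq. Qed.

Lemma perm_panel s c c' : sequiv s c c' ->
  perm_eq ((c : {classic C}) :: adj s c) ((c' : {classic C}) :: adj s c').
Proof.
move=> e; apply: uniq_perm.
- by rewrite /= adj_uniq andbT; apply/negP => /mem_adj[].
- by rewrite /= adj_uniq andbT; apply/negP => /mem_adj[].
have h c1 c2 (x : {classic C}) : sequiv s c1 c2 ->
    x \in (c1 : {classic C}) :: adj s c1 -> x \in (c2 : {classic C}) :: adj s c2.
  move=> e12 xin; rewrite inE; have [//|ne] := eqVneq x c2; apply/mem_adj.
  split; first by move=> E; rewrite E eqxx in ne.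
  apply: (sequiv_trans (sequiv_sym e12)); move: xin; rewrite inE.
  by move=> /orP[/eqP ->|/mem_adj[]//]; exact: sequiv_refl.
by move=> x; apply/idP/idP; apply: h => //; exact: sequiv_sym.
Qed.

Lemma size_adj s c : size (adj s c) = q s.
Proof.
have cE := card_fset_set (hq s c : ([set c' : {classic C} | sequiv s c c'] #= _)%card).
suff : perm_eq ((c : {classic C}) :: adj s c) (fset_set [set c' : {classic C} | sequiv s c c']).
  by move=> /perm_size /=; rewrite cE => -[].
apply: uniq_perm; rewrite ?fset_uniq//.
  by rewrite /= adj_uniq andbT; apply/negP => /mem_adj[].
move=> x; rewrite in_fset_set; last exact: panel_finite.
apply/idP/idP; rewrite !inE /=.
  by move=> /orP[/eqP ->|/mem_adj[]//]; exact: sequiv_refl.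
by move=> e; have [//|ne] := eqVneq x c; apply/mem_adj; split=> // E; rewrite E eqxx in ne.
Qed.

(* The word is read backwards, so that the recursion extends galleries at their
   far end. *)
Fixpoint sphere (c0 : C) u : seq {classic C} :=
  if u is s :: u' then flatten [seq adj s c | c <- sphere c0 u'] else [:: c0 : {classic C}].

(** A chamber of the larger sphere is reached from exactly one chamber of the smaller one, so the
    adjacency lists are disjoint and each step multiplies the size by q_s. *)
Lemma sphere_spec c0 u : reduced gen (rev u) ->
  [/\ uniq (sphere c0 u),
      forall c, (c : {classic C}) \in sphere c0 u <-> dW c0 c = wprod gen (rev u)
    & size (sphere c0 u) = \prod_(s <- u) q s]%N.
Proof.
elim: u => [|s u IH] /=.
  move=> _; split=> //; last by rewrite big_nil.
  move=> c; rewrite inE wprod_nil; split=> [/eqP ->|/dW_eq1 -> //]; exact: dW_refl.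
rewrite rev_cons => rus; have [uu mu su] := IH (reduced_rconsW rus).
split.
- apply: (@uniq_flatten_map {classic C} {classic C} (adj s)) => // [c _|c1 c2 c /mu d1 /mu d2]; first exact: adj_uniq.
  move=> /mem_adj a1 /mem_adj a2; exact: dW_descent_uniq rus d1 d2 a1 a2.
- move=> c; split.
    move=> /(@flatten_mapP {classic C} {classic C})[c1 /mu d1 /mem_adj a]; exact: dW_ascent rus d1 a.
  move=> /(dW_descent rus)[c1 d1 a]; apply/(@flatten_mapP {classic C} {classic C}).
  by exists c1; [apply/mu|apply/mem_adj].
- rewrite size_flatten /shape -map_comp big_cons -su.
  rewrite sumnE big_map (eq_bigr (fun=> q s)) => [|c _]; last exact: size_adj.
  by rewrite big_const_seq count_predT iter_addn_0.
Qed.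

End Building.

(** * Functions on chambers whose panel sums vanish *)

Section Harmonic.
Context (W : groupType) (S : finType) (gen : S -> W).
Hypothesis hW : is_coxeter_system gen.
Context (C : chamber_system S) (dW : C -> C -> W).
Hypothesis hC : is_building gen dW.
Context (q : S -> nat).
Hypothesis hq : is_regular C q.
Implicit Types (u v : seq S) (w : W) (s : S) (c : C).

Definition sphere_of (c0 : C) w := sphere c0 (rev (reduced_expression gen w)).

Lemma sphere_of_spec c0 w :
  [/\ uniq (sphere_of c0 w),
      forall c, (c : {classic C}) \in sphere_of c0 w <-> dW c0 c = w
    & size (sphere_of c0 w) = q_weight gen q w].
Proof.
have [rw wE] := reduced_expressionP hW w.
have := @sphere_spec _ _ _ hW _ _ hC _ hq c0 (rev (reduced_expression gen w)).
rewrite revK wE => /(_ rw)[? ? ->]; split=> //.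
by rewrite /q_weight; apply: perm_big; rewrite perm_rev.
Qed.

(** Independence of the reduced expression is read off the building: for every reduced expression of
    w the product counts the same set, the chambers at distance w from [c0]. *)
Lemma q_weight_reduced (c0 : C) u : reduced gen u ->
  q_weight gen q (wprod gen u) = (\prod_(s <- u) q s)%N.
Proof.
move=> ru; have [u1 m1 s1] := sphere_of_spec c0 (wprod gen u).
have := @sphere_spec _ _ _ hW _ _ hC _ hq c0 (rev u); rewrite revK => /(_ ru)[u2 m2 s2].
rewrite -s1; have -> : (\prod_(s <- u) q s = size (sphere c0 (rev u)))%N.
  by rewrite s2; apply: perm_big; rewrite perm_sym perm_rev.
apply/perm_size/uniq_perm => // c.
by apply/idP/idP => [/m1 /m2|/m2 /m1].
Qed.

Lemma q_weight_rcons (c0 : C) u s : reduced gen (rcons u s) ->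
  q_weight gen q (wprod gen (rcons u s)) = (q_weight gen q (wprod gen u) * q s)%N.
Proof.
move=> rus; rewrite !(q_weight_reduced c0)//; last exact: reduced_rconsW rus.
by rewrite big_rcons /= mulnC.
Qed.

Lemma sphere_of_flatten_uniq c0 (l : seq W) : uniq l ->
  uniq (flatten [seq sphere_of c0 w | w <- l]).
Proof.
move=> ul; apply: uniq_flatten_map => // [w _|w1 w2 c _ _].
  by case: (sphere_of_spec c0 w).
have [_ m1 _] := sphere_of_spec c0 w1; have [_ m2 _] := sphere_of_spec c0 w2.
by move=> /m1 <- /m2 <-.
Qed.

(* With [B = 0] this averages a cycle over a sphere; with [B] the closure of the
   coboundaries it replaces a chamber by a whole sphere. *)
Lemma sphere_sum (Z : zmodType) (B : set Z) (f : {classic C} -> Z) c0 u :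
  B 0 -> (forall x y, B x -> B y -> B (x + y)) -> (forall x, B x -> B (- x)) ->
  (forall s (c : {classic C}), B (f c + \sum_(c' <- adj s c) f c')) ->
  B (\sum_(c <- sphere c0 u) f c - (if odd (size u) then - f c0 else f c0)).
Proof.
move=> B0 BD BN fP; elim: u => [|s u IH] /=; first by rewrite big_seq1 subrr.
rewrite big_flatten big_map.
have -> : \sum_(c <- sphere c0 u) \sum_(c' <- adj s c) f c' =
    \sum_(c <- sphere c0 u) (f c + \sum_(c' <- adj s c) f c') - \sum_(c <- sphere c0 u) f c.
  by rewrite big_split /= [X in X - _]addrC addrK.
rewrite -addrA; apply: (BD); first by apply: (big_ind B B0 BD) => c _; exact: fP.
suff -> : - \sum_(c <- sphere c0 u) f c - (if ~~ odd (size u) then - f c0 else f c0) =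
  - (\sum_(c <- sphere c0 u) f c - (if odd (size u) then - f c0 else f c0)) by exact: BN.
by rewrite opprB addrC; congr (_ - _); case: odd; rewrite ?opprK.
Qed.

Definition panel_balanced (Z : zmodType) (f : {classic C} -> Z) :=
  forall s (c : {classic C}), f c + \sum_(c' <- adj s c) f c' = 0.

Context (R : realType) (p : R).
Hypothesis p1 : 1 < p.

(** On the sphere of w the mean of |f| is at least |f c0| / q_w, and Jensen gives q_w (|f c0| /
    q_w)^p as a lower bound. Spheres for distinct w are disjoint, so [M] bounds their joint
    contribution. *)
Lemma panel_balanced_bound (f : {classic C} -> R) (c0 : C) M : panel_balanced f ->
  (forall l : seq {classic C}, uniq l -> \sum_(c <- l) `|f c| `^ p <= M) ->
  forall l : seq W, uniq l ->
  `|f c0| `^ p * \sum_(w <- l) (q_weight gen q w)%:R `^ (1 - p) <= M.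
Proof.
move=> fP fM l /(sphere_of_flatten_uniq c0) /fM; apply: le_trans.
rewrite big_flatten big_map mulr_sumr; apply: ler_sum => w _.
have [_ _ sz] := sphere_of_spec c0 w; set k := q_weight _ _ _ in sz *.
have fE : `|\sum_(c <- sphere_of c0 w) f c| = `|f c0|.
  have /eqP : [set 0 : R] (\sum_(c <- sphere_of c0 w) f c -
      (if odd (size (rev (reduced_expression gen w))) then - f c0 else f c0)).
    apply: sphere_sum => [//|x y /= -> ->|x /= ->|]; [by rewrite addr0|by rewrite oppr0|exact: fP].
  by rewrite subr_eq0 => /eqP ->; case: odd; rewrite ?normrN.
(* The mean needs a nonempty sphere. If the sphere is empty, its sum is 0, which forces f c0 = 0 and
   makes the left-hand term vanish. *)
have [k0|k0] := posnP k.
  have nilE : sphere_of c0 w = [::] by apply: size0nil; rewrite sz.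
  move: fE; rewrite nilE !big_nil normr0 => <-.
  by rewrite powR0 ?mul0r// gt_eqF// (lt_trans _ p1).
have kR : 0 < k%:R :> R by rewrite ltr0n.
have t0 : 0 <= `|f c0| / k%:R by rewrite divr_ge0.
have tE : \sum_(i <- sphere_of c0 w) `|f c0| / k%:R <= \sum_(i <- sphere_of c0 w) `|f i|.
  rewrite big_const_seq count_predT iter_addr_0 sz -(mulr_natr (_ / _)) divfK ?gt_eqF//.
  by rewrite -fE ler_norm_sum.
apply: le_trans (sum_powR_tangent p1 t0 tE).
rewrite big_const_seq count_predT iter_addr_0 sz -(mulr_natr (_ `^ _)) powRM// ?invr_ge0 ?(ltW kR)//.
rewrite -mulrA ler_wpM2l ?powR_ge0// -powR_inv1 ?(ltW kR)// -powRrM mulN1r.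
by rewrite -[X in _ * X](powRr1 (ltW kR)) -powRD ?(gt_eqF kR) ?implybT// addrC.
Qed.

Definition alternating_density (c0 : C) (c : {classic C}) : R :=
  (if odd (size (reduced_expression gen (dW c0 c))) then -1 else 1) /
    (q_weight gen q (dW c0 c))%:R.

Lemma alternating_densityE c0 (c : {classic C}) u : reduced gen u -> dW c0 c = wprod gen u ->
  alternating_density c0 c = (if odd (size u) then -1 else 1) / (q_weight gen q (wprod gen u))%:R.
Proof.
move=> ru dE; rewrite /alternating_density dE.
by have [rw wE] := reduced_expressionP hW (wprod gen u); rewrite (reduced_size rw ru wE).
Qed.

Hypothesis q_gt0 : forall s, (0 < q s)%N.

Lemma q_weight_gt0 w : (0 < q_weight gen q w)%N.
Proof. by rewrite /q_weight prodn_gt0. Qed.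

(** Listing the panel from its projection [c1], the first value is +-1/q_u and each of the q_s
    others is the opposite sign times 1/(q_u q_s). *)
Lemma alternating_density_balanced c0 : panel_balanced (alternating_density c0).
Proof.
move=> s c; have [u [c1 [rus d1 e1]]] := panel_bottom hW hC c0 c s.
have : \sum_(c' <- (c1 : {classic C}) :: adj s c1) alternating_density c0 c' =
    \sum_(c' <- c :: adj s c) alternating_density c0 c'.
  by apply: perm_big; exact: perm_panel.
rewrite !big_cons => <-; rewrite (alternating_densityE (reduced_rconsW rus) d1).
rewrite (eq_big_seq (fun=> (if odd (size (rcons u s)) then -1 else 1) / (q_weight gen q (wprod gen (rcons u s)))%:R)); last first.
  move=> c2 /(mem_adj hq) a; apply: alternating_densityE => //.
  exact (dW_ascent hC rus d1 a).
rewrite big_const_seq count_predT iter_addr_0 (size_adj hq) (q_weight_rcons c1)//.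
rewrite size_rcons /= -(mulr_natr (_ / _)) natrM.
have k0 : (q_weight gen q (wprod gen u))%:R != 0 :> R by rewrite pnatr_eq0 -lt0n q_weight_gt0.
have s0 : (q s)%:R != 0 :> R by rewrite pnatr_eq0 -lt0n.
by case: odd; rewrite /=; field; rewrite k0 s0.
Qed.

Lemma alternating_density_sum c0 w :
  \sum_(c <- sphere_of c0 w) `|alternating_density c0 c| `^ p = (q_weight gen q w)%:R `^ (1 - p).
Proof.
have [uw mw sw] := sphere_of_spec c0 w.
have kR : 0 < (q_weight gen q w)%:R :> R by rewrite ltr0n q_weight_gt0.
rewrite (eq_big_seq (fun=> ((q_weight gen q w)%:R^-1) `^ p)); last first.
  move=> c /mw dE; rewrite /alternating_density dE normrM normfV (ger0_norm (ltW kR)).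
  by case: odd; rewrite ?normrN normr1 mul1r.
rewrite big_const_seq count_predT iter_addr_0 sw -(mulr_natl (_ `^ _)) -powR_inv1 ?(ltW kR)// -powRrM mulN1r.
by rewrite -[X in X * _](powRr1 (ltW kR)) -powRD ?(gt_eqF kR) ?implybT.
Qed.

End Harmonic.

(** * Flags of spherical subsets *)

Section SeqSets.
Context (S : choiceType).
Implicit Types (u v : seq S) (s x y : S).

Definition setof u : {fset S} := [fset x in u]%fset.
Definition prefix_set i u := setof (take i u).

Lemma mem_setof u : setof u =i u.
Proof. by move=> x; rewrite /setof !inE. Qed.

Lemma card_setof u : uniq u -> #|` setof u| = size u.
Proof.
move=> uu; apply/perm_size/uniq_perm; rewrite ?fset_uniq// => x; exact: mem_setof.
Qed.

Lemma setof_fset (T : {fset S}) : setof (enum_fset T) = T.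
Proof. by apply/fsetP => x; rewrite mem_setof. Qed.

Lemma setof_perm u v : u =i v -> setof u = setof v.
Proof. by move=> uv; apply/fsetP => x; rewrite !mem_setof uv. Qed.

Lemma prefix_set0 u : prefix_set 0 u = fset0.
Proof. by rewrite /prefix_set take0; apply/fsetP => x; rewrite mem_setof inE. Qed.

Lemma card_prefix_set i u : uniq u -> (i <= size u)%N -> #|` prefix_set i u| = i.
Proof. by move=> uu iu; rewrite card_setof ?take_uniq// size_takel. Qed.

Lemma prefix_setS x0 i u : (i < size u)%N ->
  prefix_set i.+1 u = (nth x0 u i |` prefix_set i u)%fset.
Proof.
move=> iu; apply/fsetP => x; rewrite inE inE !mem_setof (take_nth x0)//.
by rewrite mem_rcons inE.
Qed.

Lemma nth_notin_prefix x0 i u : uniq u -> (i < size u)%N -> nth x0 u i \notin prefix_set i u.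
Proof.
move=> uu iu; rewrite mem_setof; have := take_uniq i.+1 uu.
by rewrite (take_nth x0)// rcons_uniq => /andP[].
Qed.

Lemma prefix_set_sub i j u : (i <= j)%N -> (prefix_set i u `<=` prefix_set j u)%fset.
Proof.
move=> ij; apply/fsubsetP => x; rewrite !mem_setof -(subnKC ij) takeD mem_cat.
by move=> ->.
Qed.

Lemma nth_prefix_eq x0 j u v : uniq u -> uniq v -> size u = size v -> (j < size u)%N ->
  prefix_set j u = prefix_set j v -> prefix_set j.+1 u = prefix_set j.+1 v ->
  nth x0 u j = nth x0 v j.
Proof.
move=> uu uv sz ju e1 e2; have := fset1U1 (nth x0 u j) (prefix_set j u).
rewrite -prefix_setS// e2 (prefix_setS x0) -?sz// in_fset1U -e1.
by rewrite (negbTE (nth_notin_prefix x0 uu ju)) orbF => /eqP.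
Qed.

Lemma prefix_set_inj u v : uniq u -> uniq v -> size u = size v ->
  (forall j, (j <= size u)%N -> prefix_set j u = prefix_set j v) -> u = v.
Proof.
move=> uu uv sz e; case: u uu sz e => [|x0 u] uu sz e.
  by move/esym: sz => /size0nil.
apply: (@eq_from_nth _ x0) => // j ju.
by apply: nth_prefix_eq => //; apply: e => //; exact: ltnW.
Qed.

(** Adjacent transpositions generate all permutations. [E] need not be compatible with prepending,
    so the induction runs behind an arbitrary prefix [a]. *)
Lemma perm_eq_adjacent_ind (E : seq S -> seq S -> Prop) :
  (forall u, E u u) -> (forall u v w, E u v -> E v w -> E u w) ->
  (forall a x y b, E (a ++ x :: y :: b) (a ++ y :: x :: b)) ->
  forall u v, perm_eq u v -> E u v.
Proof.
move=> refl trans swap u v uv; suff: forall a, E (a ++ u) (a ++ v) by move=> /(_ [::]).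
elim: u v uv => [|x u IH] v.
  by rewrite perm_sym => /perm_nilP -> a.
move=> uv a; have xv : x \in v by rewrite -(perm_mem uv) mem_head.
case/splitPr: v / xv uv => v1 v2.
rewrite -cat1s -[x :: v2]cat1s perm_sym perm_catCA /= perm_cons perm_sym => /IH h.
apply: (trans _ (a ++ x :: (v1 ++ v2))).
  by have := h (rcons a x); rewrite !cat_rcons.
elim: v1 a {h} => [|y v1 IHv] a //=.
apply: (trans _ _ _ (swap a x y (v1 ++ v2))).
by have := IHv (rcons a y); rewrite !cat_rcons.
Qed.

End SeqSets.

Lemma card_I2 (T : choiceType) (A : set T) : (A #= `I_2)%card ->
  exists x y, x != y /\ A = [set x; y].
Proof.
move=> A2; have finA : finite_set A by apply/finite_setP; exists 2%N.
have := card_fset_set A2; have memA z : A z <-> z \in enum_fset (fset_set A).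
  by rewrite in_fset_set// inE.
move: (fset_uniq (fset_set A)) memA; case: (enum_fset _) => [|x [|y [|]]]//= u memA _.
exists x, y; split; first by move: u; rewrite inE andbT.
apply/seteqP; split=> z /=; first by move=> /memA; rewrite !inE => /orP[]/eqP ->; [left|right].
by move=> [] ->; apply/memA; rewrite !inE eqxx ?orbT.
Qed.

(** * Orientation and connectedness of the flags of the nerve *)

Section Flags.
Context (W : groupType) (S : finType) (gen : S -> W) (m : nat).
Hypothesis hW : is_coxeter_system gen.
Hypothesis hL : pseudomanifold (nerve gen) m.
Implicit Types (u v : seq S) (s x y : S) (T : {fset S}).

(* A flag of spherical subsets of cardinalities [0, ..., m.+1], given by the
   order in which the generators are added. *)
Definition flag u := [/\ size u = m.+1, uniq u & spherical gen (setof u)].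

Lemma parabolic0 w : parabolic gen [set` (fset0 : {fset S})] w -> w = 1%g.
Proof.
move=> /(_ [set 1%g]); apply; split; last by move=> x [s /=]; rewrite inE.
by split=> [//|x y /= -> ->|x /= ->]; rewrite ?mulg1 ?invg1.
Qed.

Lemma parabolic1 s w : parabolic gen [set s] w -> w = 1%g \/ w = gen s.
Proof.
move=> /(_ [set x | x = 1%g \/ x = gen s]); apply; split.
  split=> [|x y /= [] -> [] ->|x /= [] ->]; rewrite ?mulg1 ?mul1g ?(genK hW) ?invg1 ?(genV hW) /=; tauto.
by move=> _ [t /= -> <-]; right.
Qed.

Lemma spherical_fset0 : spherical gen fset0.
Proof.
apply: (sub_finite_set (B := [set 1%g])); last exact: finite_set1.
exact: parabolic0.
Qed.

Lemma spherical_fset1 s : spherical gen [fset s]%fset.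
Proof.
apply: (sub_finite_set (B := [set 1%g; gen s])); last exact: finite_set2.
by move=> w; rewrite set_fset1 => /parabolic1.
Qed.

Lemma card_spherical T : spherical gen T -> (#|` T| <= m.+1)%N.
Proof.
move=> sT; have [->|T0] := eqVneq T fset0; first by rewrite cardfs0.
by have [_ [[_ h] _] _] := hL; apply: h.
Qed.

Lemma maximal_spherical T :
  maximal_simplices (nerve gen) T <-> spherical gen T /\ #|` T| = m.+1.
Proof.
have [_ [_ pure] _] := hL; split=> [[[T0 sT] Tmax]|[sT cT]].
  split=> //; have [T' [kT' cT'] TT'] := pure T (conj T0 sT).
  by rewrite -(Tmax _ kT' TT').
have T0 : T != fset0 by rewrite -cardfs_gt0 cT.
split=> // T' [T'0 sT'] TT'; apply/esym/eqP; rewrite eqEfcard TT' cT.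
exact: card_spherical.
Qed.

Lemma flag_prefix_spherical u i : flag u -> spherical gen (prefix_set i u).
Proof.
move=> [_ _ su]; apply: spherical_sub su _; apply/fsubsetP => x.
by rewrite !mem_setof; exact: mem_take.
Qed.

Lemma flag_perm u v : perm_eq u v -> flag u -> flag v.
Proof.
move=> uv [su uu sp]; split; first by rewrite -(perm_size uv).
  by rewrite -(perm_uniq uv).
by rewrite -(setof_perm (perm_mem uv)).
Qed.

Lemma flag_exists T : maximal_simplices (nerve gen) T -> flag (enum_fset T).
Proof. by move=> /maximal_spherical[sT cT]; split=> //; rewrite ?fset_uniq ?setof_fset. Qed.

Lemma flag_maximal u : flag u -> maximal_simplices (nerve gen) (setof u).
Proof. by move=> [su uu sp]; apply/maximal_spherical; rewrite card_setof. Qed.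

(** Panels of type [s] are visible only in flags whose first nonempty member is {s}; purity of the
    nerve provides one. *)
Lemma flag_through s : exists u, flag (s :: u).
Proof.
have [_ [_ pure] _] := hL.
have sK : nerve gen [fset s]%fset.
  by split; [apply/fset0Pn; exists s; rewrite inE|exact: spherical_fset1].
have [T [[T0 sT] cT] /fsubsetP /(_ s)] := pure _ sK; rewrite inE eqxx => /(_ isT) sinT.
exists (rem s (enum_fset T)); apply: flag_perm (perm_to_rem sinT) _.
by apply: flag_exists; apply/maximal_spherical.
Qed.

Lemma two_maximal T : spherical gen T -> #|` T| = m -> exists (T1 T2 : {fset S}),
  T1 != T2 /\ [set sg | maximal_simplices (nerve gen) sg /\ (T `<=` sg)%fset] = [set T1; T2].
Proof.
move=> sT cT; have [_ _ h] := hL; apply/card_I2/h; split=> //.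
by have [->|T0] := eqVneq T fset0; [right|left].
Qed.

Lemma mem_swap a x y (b : seq S) : a ++ x :: y :: b =i a ++ y :: x :: b.
Proof. by move=> z; rewrite !mem_cat !inE; case: (z == x); case: (z == y). Qed.

Lemma perm_swap a x y (b : seq S) : perm_eq (a ++ x :: y :: b) (a ++ y :: x :: b).
Proof. by rewrite perm_cat2l -cat1s -(cat1s y b) -(cat1s y) -(cat1s x b) perm_catCA. Qed.

Lemma prefix_set_swap a x y (b : seq S) (j : nat) : j != (size a).+1 ->
  prefix_set j (a ++ x :: y :: b) = prefix_set j (a ++ y :: x :: b).
Proof.
move=> ja; rewrite /prefix_set !take_cat; case: ltnP => // aj.
have [->|j1] := eqVneq j (size a); first by rewrite subnn !take0.
have [k ->] : exists k, (j - size a = k.+2)%N by move: (size a) ja j1 aj => k; exists (j - k - 2)%N; lia.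
by rewrite /=; apply: setof_perm; exact: mem_swap.
Qed.

(* [eps] is the fundamental class of a chamber, written in the basis of its
   flags; it exists because the link is an orientable pseudomanifold. *)
Definition flag_orientation (eps : seq S -> bool) :=
  (forall a x y b, flag (a ++ x :: y :: b) ->
    eps (a ++ y :: x :: b) = ~~ eps (a ++ x :: y :: b)) /\
  (forall a x y, flag (rcons a x) -> flag (rcons a y) -> x != y ->
    eps (rcons a y) = ~~ eps (rcons a x)).

(** For m > 0, [eps u] is the parity of the order [u] relative to the orientation of the simplex
    [setof u]. A transposition changes it, and across a codimension 1 face the vanishing of the
    boundary of the fundamental cycle forces opposite incidence numbers, hence opposite parities. *)
Lemma flag_orientation_exists : orientable (nerve gen) ->
  exists eps, flag_orientation eps.
Proof.
(* For m = 0 orientability says nothing, because the face between the two points is the empty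
   simplex; there [eps] just distinguishes the two points. *)
move=> [oL oK bd]; have [m0|m_gt0] := posnP m.
  have [T1 [T2 [T12 TE]]] := two_maximal spherical_fset0 (etrans (cardfs0 _) (esym m0)).
  exists (fun u => setof u == T1); split=> [a x y b [+ _ _]|a x y].
    by rewrite m0 size_cat /=; lia.
  move=> fx fy xy; have [sz _ _] := fx; have {}sz : a = [::].
    by move: sz; rewrite m0 size_rcons => -[/size0nil].
  move: fx fy; rewrite {a}sz /= => fx fy.
  have mem z : flag [:: z] -> setof [:: z] = T1 \/ setof [:: z] = T2.
    move=> fz; have : [set sg | maximal_simplices (nerve gen) sg /\ (fset0 `<=` sg)%fset] (setof [:: z]).
      by split; [exact: flag_maximal|exact: fsub0set].
    by rewrite TE => -[]; [left|right].
  have ne : setof [:: x] != setof [:: y].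
    apply: contra xy => /eqP E; have := mem_setof [:: x] y.
    by rewrite E mem_setof !inE eqxx => /esym; rewrite eq_sym.
  have := mem _ fx; have := mem _ fy.
  have T21 : (T2 == T1) = false by rewrite eq_sym (negbTE T12).
  by case=> Ey [] Ex; move: ne; rewrite Ex Ey ?eqxx ?T21.
pose eps u := odd (inversions (oL (setof u)) u).
have operm u : flag u -> uniq (oL (setof u)) /\ perm_eq (oL (setof u)) u.
  move=> fu; have [[ku _] [_ uu _]] := (flag_maximal fu, fu).
  have ou := oK _ ku; split; first by rewrite (perm_uniq ou) fset_uniq.
  apply: perm_trans ou _; apply: uniq_perm; rewrite ?fset_uniq// => z; exact: mem_setof.
exists eps; split=> [a x y b fu|a x y fx fy xy].
  rewrite /eps -(setof_perm (mem_swap a x y b)).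
  have [uo pu] := operm _ fu; have [_ uu _] := fu.
  by rewrite (inversions_trans uo pu (perm_swap a x y b)) inversions_swap// addbT.
have [sx ux spx] := fx; have [sy uy spy] := fy.
have sa : size a = m by move: sx; rewrite size_rcons => -[].
have xa : x \notin a by move: ux; rewrite rcons_uniq => /andP[].
have ya : y \notin a by move: uy; rewrite rcons_uniq => /andP[].
have ua : uniq a by move: ux; rewrite rcons_uniq => /andP[].
have spa : spherical gen (setof a).
  apply: spherical_sub spx _; apply/fsubsetP => z.
  by rewrite !mem_setof mem_rcons inE => ->; rewrite orbT.
have aK : nerve gen (setof a) by split=> //; rewrite -cardfs_gt0 card_setof// sa.
have [T1 [T2 [T12 TE]]] := two_maximal spa (etrans (card_setof ua) sa).
have remE z : z \notin a -> rem z (rcons a z) = a.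
  by move=> za; rewrite -cats1 rem_cat_notin//= eqxx cats0.
have incE z : flag (rcons a z) -> z \notin a ->
    incidence oL (setof (rcons a z)) (setof a) =
    (-1) ^+ (m + eps (rcons a z) + inversions a (oL (setof a))).
  move=> fz za; have [uo pz] := operm _ fz; have [kz _] := flag_maximal fz.
  have [_ uz _] := fz.
  have zin : z \in rcons a z by rewrite mem_rcons mem_head.
  have atm : setof a =i rem z (rcons a z) by move=> t; rewrite remE// mem_setof.
  rewrite (incidence_rem oK kz aK uz (mem_setof _) zin atm).
  rewrite remE// -cats1 index_cat (negbTE za) /= eqxx addn0 sa cats1.
  rewrite -signr_odd -[RHS]signr_odd !oddD oddb /eps.
  by rewrite (inversions_sym uo pz).
have mem z : flag (rcons a z) -> z \notin a -> setof (rcons a z) = T1 \/ setof (rcons a z) = T2.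
  move=> fz za; have : [set sg | maximal_simplices (nerve gen) sg /\ (setof a `<=` sg)%fset] (setof (rcons a z)).
    split; [exact: flag_maximal|apply/fsubsetP => t].
    by rewrite !mem_setof mem_rcons inE => ->; rewrite orbT.
  by rewrite TE => -[]; [left|right].
have ne : setof (rcons a x) != setof (rcons a y).
  apply: contra xy => /eqP E; have := mem_setof (rcons a x) y.
  by rewrite E mem_setof !mem_rcons !inE eqxx (negbTE ya) orbF /= eq_sym => /esym; rewrite orbF.
have [kx _] := flag_maximal fx; have [ky _] := flag_maximal fy.
(* The boundary is evaluated at the common face [a]; only the two maximal simplices containing it
   contribute, and two signs summing to 0 are opposite. *)
have := congr1 (fun f => f (setof a)) bd; rewrite /boundary asboolT//= /cst.
rewrite (@fsbigE _ _ _ _ _ [:: setof (rcons a x); setof (rcons a y)]).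
- rewrite !big_cons big_nil !ifT; [|exact: mem_set ky|exact: mem_set kx].
  rewrite !indicE (mem_set (flag_maximal fx)) (mem_set (flag_maximal fy)).
  rewrite /= !mulr1 addr0 !intz !incE// -signr_odd -[X in _ + X]signr_odd !oddD !oddb.
  by case: (eps _); case: (eps _); case: (odd m); case: (odd _).
- by rewrite /= inE ne.
- by move=> T; rewrite /= !inE => /orP[]/eqP ->; [exact: kx|exact: ky].
- move=> T kT; rewrite !inE negb_or => /andP[Tx Ty].
  have [/set_mem Tmax|Tmax] := boolP (T \in maximal_simplices (nerve gen)); last first.
    by rewrite indicE (negbTE Tmax) mulr0.
  have [aT|aT] := boolP (setof a `<=` T)%fset; last by rewrite /incidence (negbTE aT) /= mul0r.
  have : [set sg | maximal_simplices (nerve gen) sg /\ (setof a `<=` sg)%fset] T by [].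
  rewrite TE => TT; move: ne Tx Ty.
  by case: (mem _ fx xa) => ->; case: (mem _ fy ya) => ->; case: TT => ->; rewrite ?eqxx.
Qed.

Definition flag_adjacent (i : nat) u v := forall j : nat, (j <= m.+1)%N -> j != i ->
  prefix_set j u = prefix_set j v.

Lemma flag_adjacent_eq i u v : flag u -> flag v -> flag_adjacent i u v ->
  prefix_set i u = prefix_set i v -> u = v.
Proof.
move=> [su uu _] [sv uv _] a e; apply: prefix_set_inj => //; first by rewrite su sv.
by move=> j; rewrite su => jm; have [->|] := eqVneq j i; [|exact: a].
Qed.

Lemma flag_adjacent0 u v : flag u -> flag v -> flag_adjacent 0 u v -> u = v.
Proof. by move=> fu fv a; apply: flag_adjacent_eq a _ => //; rewrite !prefix_set0. Qed.

(** Between ranks i-1 and i+1 two generators are added, in one order or the other, so for i <= m the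
    partner is a transposition. At the top rank the last generator is exchanged, and the
    pseudomanifold condition gives exactly one other maximal simplex over the rest. *)
Lemma flag_partner eps u i : flag_orientation eps -> flag u -> (0 < i <= m.+1)%N ->
  exists v, [/\ flag v, u != v, eps v = ~~ eps u, flag_adjacent i u v
    & forall w, flag w -> flag_adjacent i u w -> w = u \/ w = v].
Proof.
move=> [epsS epsR] fu /andP[i0]; have [su uu spu] := fu.
rewrite leq_eqVlt => /orP[/eqP iE|im].
- case/lastP: u => [|a x] in fu su uu spu *; first by [].
  have sa : size a = m by move: su; rewrite size_rcons => -[].
  have [xa ua] : x \notin a /\ uniq a by move: uu; rewrite rcons_uniq => /andP[].
  have sub z : (setof a `<=` setof (rcons a z))%fset.
    by apply/fsubsetP => t; rewrite !mem_setof mem_rcons inE => ->; rewrite orbT.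
  have spa := spherical_sub spu (sub x).
  have [T1 [T2 [T12 TE]]] := two_maximal spa (etrans (card_setof ua) sa).
  have [T' [xT' T'm aT' T'E]] : exists T' : {fset S}, [/\ setof (rcons a x) != T',
      maximal_simplices (nerve gen) T', (setof a `<=` T')%fset &
      forall T, maximal_simplices (nerve gen) T -> (setof a `<=` T)%fset ->
        T = setof (rcons a x) \/ T = T'].
    have : [set sg | maximal_simplices (nerve gen) sg /\ (setof a `<=` sg)%fset] (setof (rcons a x)).
      by split; [exact: flag_maximal|exact: sub].
    have hT T : maximal_simplices (nerve gen) T -> (setof a `<=` T)%fset -> T = T1 \/ T = T2.
      move=> Tm aT; have : [set sg | maximal_simplices (nerve gen) sg /\ (setof a `<=` sg)%fset] T by [].
      by rewrite TE.
    have [m1 a1] : [set sg | maximal_simplices (nerve gen) sg /\ (setof a `<=` sg)%fset] T1.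
      by rewrite TE; left.
    have [m2 a2] : [set sg | maximal_simplices (nerve gen) sg /\ (setof a `<=` sg)%fset] T2.
      by rewrite TE; right.
    rewrite TE => -[] ->; [exists T2|exists T1]; split=> //; first by rewrite eq_sym.
    by move=> T Tm /(hT T Tm) []; tauto.
  have [sT' cT'] := (maximal_spherical T').1 T'm.
  have : ~~ (T' `<=` setof a)%fset.
    by apply/negP => /fsubset_leq_card; rewrite cT' card_setof// sa ltnn.
  move=> /fsubsetPn[y yT' ya]; rewrite mem_setof in ya.
  have ay : (setof (rcons a y) `<=` T')%fset.
    apply/fsubsetP => z; rewrite mem_setof mem_rcons inE => /orP[/eqP -> //|za].
    by apply: (fsubsetP aT'); rewrite mem_setof.
  have uy : uniq (rcons a y) by rewrite rcons_uniq ya.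
  have yE : setof (rcons a y) = T'.
    by apply/eqP; rewrite eqEfcard ay cT' card_setof// size_rcons sa leqnn.
  have fy : flag (rcons a y) by split; rewrite ?size_rcons ?sa ?yE.
  have xy : x != y by apply: contra xT' => /eqP ->; rewrite yE.
  have pj z j : (j <= m)%N -> prefix_set j (rcons a z) = prefix_set j a.
    by move=> jm; rewrite /prefix_set -cats1 takel_cat// sa.
  have full z j : (m < j)%N -> prefix_set j (rcons a z) = setof (rcons a z).
    by move=> jm; rewrite /prefix_set take_oversize// size_rcons sa.
  exists (rcons a y); split=> //.
  + by apply: contra xy => /eqP /rcons_inj[] /eqP.
  + exact: epsR.
  + move=> j jm ji; have jm' : (j <= m)%N by rewrite iE in ji; rewrite -ltnS ltn_neqAle ji.
    by rewrite !pj.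
  + move=> w fw aw; have [sw uw spw] := fw.
    have wE : setof w = prefix_set i w by rewrite /prefix_set iE -sw take_size.
    have aw' : setof a = prefix_set m w by rewrite -aw -?iE ?iE// ?neq_ltn ?ltnSn// pj// /prefix_set -sa take_size.
    have [wx|wy] : setof w = setof (rcons a x) \/ setof w = T'.
    * apply: T'E; first exact: flag_maximal.
      by rewrite aw' wE; apply: prefix_set_sub; rewrite iE.
    * left; apply/esym; apply: flag_adjacent_eq aw _ => //.
      by rewrite -wE wx full// iE.
    * right; apply: (@flag_adjacent_eq i) => //; last by rewrite -wE wy full ?yE// iE.
      move=> j jm ji; rewrite -aw//.
      have jm' : (j <= m)%N by rewrite iE in ji; rewrite -ltnS ltn_neqAle ji.
      by rewrite !pj.
- have [a [x [y [b [uE sa]]]]] : exists a x y b, u = a ++ x :: y :: b /\ size a = i.-1.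
    have iu : (i.-1.+1 < size u)%N by rewrite su prednK// ltnS.
    have := cat_take_drop i.-1 u.
    have := size_takel (ltnW (ltnW iu)).
    have := size_drop i.-1 u; case: (drop i.-1 u) => [|x [|y b]] /= sd sa uE; try lia.
    by exists (take i.-1 u), x, y, b.
  have iE : i = (size a).+1 by rewrite sa prednK.
  have [xa ya xy] : [/\ x \notin a, y \notin a & x != y].
    move: uu; rewrite uE cat_uniq /= !inE !negb_or => /and3P[_ /and3P[-> -> _]].
    by case/andP => /andP[].
  rewrite uE in fu su uu spu *.
  have fv : flag (a ++ y :: x :: b) by apply: flag_perm fu; exact: perm_swap.
  have av : flag_adjacent i (a ++ x :: y :: b) (a ++ y :: x :: b).
    by move=> j _ ji; apply: prefix_set_swap; rewrite -iE.
  exists (a ++ y :: x :: b); split=> //.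
  + by apply: contra xy => /eqP /(congr1 (nth x ^~ (size a))); rewrite !nth_cat ltnn subnn /= => ->.
  + exact: epsS.
  move=> w fw aw; have [sw uw spw] := fw.
  have nthE z t c : nth x (a ++ z :: t :: c) (size a) = z by rewrite nth_cat ltnn subnn.
  have iw : (size a < size w)%N by rewrite sw -iE ltnW.
  have a0 z t c : prefix_set (size a) (a ++ z :: t :: c) = setof a.
    by rewrite /prefix_set take_size_cat.
  have a1 z t c : prefix_set i (a ++ z :: t :: c) = setof (rcons a z).
    by rewrite /prefix_set iE -cat_rcons -(size_rcons a z) take_size_cat.
  have a2 z t c : prefix_set i.+1 (a ++ z :: t :: c) = setof (rcons (rcons a z) t).
    by rewrite /prefix_set iE -2!cat_rcons -(size_rcons a z) -(size_rcons _ t) take_size_cat.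
  have w0 : prefix_set (size a) w = setof a.
    by rewrite -aw ?a0//; [rewrite iE in im; rewrite ltnW// ltnW|rewrite iE neq_ltn ltnSn].
  have w2 : prefix_set i.+1 w = setof (rcons (rcons a x) y).
    by rewrite -aw ?a2// neq_ltn ltnSn orbT.
  have w1 : prefix_set i w = (nth x w (size a) |` setof a)%fset.
    by rewrite iE (prefix_setS x)// w0.
  have rE z : setof (rcons a z) = (z |` setof a)%fset.
    by apply/fsetP => t; rewrite in_fset1U !mem_setof mem_rcons inE.
  (* The generator that [w] adds at this rank lies in the set of rank i+1 but not in that of rank
     i-1, so it is [x] or [y]. *)
  have : nth x w (size a) \in prefix_set i.+1 w.
    by apply: (fsubsetP (prefix_set_sub _ (leqnSn i))); rewrite w1 fset1U1.
  have := nth_notin_prefix x uw iw; rewrite w0 w2 !mem_setof !mem_rcons !inE mem_rcons inE.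
  move=> /negbTE ->; rewrite orbF => /orP[/eqP zE|/eqP zE].
  + right; apply: (@flag_adjacent_eq i) => //; last by rewrite w1 a1 zE rE.
    by move=> j jm ji; rewrite -aw// av.
  + left; apply/esym; apply: flag_adjacent_eq aw _ => //.
    by rewrite w1 a1 zE rE.
Qed.

(** Two orders of one maximal simplex are linked by transpositions, which are adjacencies of rank at
    most m. Neighbouring maximal simplices are linked by listing their common face first, an
    adjacency of rank m+1. Rank 0 never occurs, so later applications stay inside one chamber. *)
Lemma flag_adjacent_connected (E : seq S -> seq S -> Prop) :
  gallery_connected (nerve gen) m ->
  (forall u, E u u) -> (forall u v w, E u v -> E v w -> E u w) ->
  (forall u v i, flag u -> flag v -> (0 < i <= m.+1)%N -> flag_adjacent i u v -> E u v) ->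
  forall u v, flag u -> flag v -> E u v.
Proof.
move=> conn Erefl Etrans Eadj.
have Eperm u v : flag u -> perm_eq u v -> E u v.
  move=> fu uv; have : perm_eq u u -> flag u -> E u v; last by apply.
  (* [E'] carries the permutation along, so that in a composition the intermediate word is known to
     be a flag. *)
  move: u v uv {fu}; pose E' u v := perm_eq u v /\ (flag u -> E u v).
  suff h u v : perm_eq u v -> E' u v by move=> u v /h[_ hE] _ fu; exact: hE.
  apply: perm_eq_adjacent_ind => {u v} [u|u v w [p1 e1] [p2 e2]|a x y b].
  - by split.
  - split; first exact: perm_trans p1 p2.
    by move=> fu; apply: Etrans (e1 fu) (e2 (flag_perm p1 fu)).
  - split; first exact: perm_swap.
    move=> fu; apply: (@Eadj _ _ (size a).+1) => //.
    + by apply: flag_perm fu; exact: perm_swap.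
    + by have [+ _ _] := fu; rewrite size_cat /=; lia.
    + by move=> j _; exact: prefix_set_swap.
have Eset u v : flag u -> flag v -> setof u = setof v -> E u v.
  move=> fu fv uv; apply: Eperm => //; have [_ uu _] := fu; have [_ uuv _] := fv.
  by apply: uniq_perm => // z; rewrite -(mem_setof u) uv mem_setof.
move=> u v fu fv; have := conn _ _ (flag_maximal fu) (flag_maximal fv).
pose P T1 T2 := forall u v, flag u -> flag v -> setof u = T1 -> setof v = T2 -> E u v.
suff h T1 T2 : maximal_simplices (nerve gen) T1 -> Relation_Operators.clos_refl_trans {fset S} (fun s1 s2 : {fset S} =>
      [/\ maximal_simplices (nerve gen) s1, maximal_simplices (nerve gen) s2
        & exists2 ta, codim1 (nerve gen) m ta & (ta `<=` s1)%fset /\ (ta `<=` s2)%fset]) T1 T2 ->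
    P T1 T2 /\ maximal_simplices (nerve gen) T2.
  by move=> /(h _ _ (flag_maximal fu))[/(_ u v fu fv erefl erefl)].
move=> m1 c; elim: c m1 => {T1 T2 u v fu fv} [T1 T2 [m1 m2 [ta [_ cta] [ta1 ta2]]] _|T|T1 T2 T3 _ h1 _ h2 m1].
- split=> // u v fu fv uT vT.
  have ext T : maximal_simplices (nerve gen) T -> (ta `<=` T)%fset ->
      exists2 s, flag (rcons (enum_fset ta) s) & setof (rcons (enum_fset ta) s) = T.
    move=> mT taT; have [sT cT] := (maximal_spherical T).1 mT.
    have : ~~ (T `<=` ta)%fset by apply/negP => /fsubset_leq_card; rewrite cT cta ltnn.
    move=> /fsubsetPn[s sT' sta].
    have us : uniq (rcons (enum_fset ta) s) by rewrite rcons_uniq sta fset_uniq.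
    have TE : setof (rcons (enum_fset ta) s) = T.
      apply/eqP; rewrite eqEfcard cT card_setof// size_rcons [size _]cta leqnn andbT.
      apply/fsubsetP => z; rewrite mem_setof mem_rcons inE => /orP[/eqP -> //|].
      exact: (fsubsetP taT).
    by exists s => //; split=> //; rewrite ?TE// size_rcons [size _]cta.
  have [s1 f1 E1] := ext _ m1 ta1; have [s2 f2 E2] := ext _ m2 ta2.
  apply: (Etrans _ (rcons (enum_fset ta) s1)); first by apply: Eset => //; rewrite uT E1.
  apply: (Etrans _ (rcons (enum_fset ta) s2)); last by apply: Eset => //; rewrite vT E2.
  apply: (@Eadj _ _ m.+1); rewrite ?leqnn// => j jm ji.
  have jm' : (j <= size (enum_fset ta))%N by rewrite [size _]cta -ltnS ltn_neqAle ji.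
  by rewrite /prefix_set -!cats1 !takel_cat.
- by move=> mT; split=> // u v fu fv uT vT; apply: Eset => //; rewrite uT vT.
- have [p1 m2] := h1 m1; have [p2 m3] := h2 m2; split=> // u v fu fv uT vT.
  apply: (Etrans _ (enum_fset T2)); first by apply: p1 => //; [exact: flag_exists|exact: setof_fset].
  by apply: p2 => //; [exact: flag_exists|exact: setof_fset].
Qed.

End Flags.

(** * The Davis realization *)

Section FullChains.
Context (S : choiceType).
Implicit Types (u : seq S) (T : {fset S}) (sg : {fset {fset S}}).

Definition is_chain sg := forall T T', T \in sg -> T' \in sg ->
  (T `<=` T')%fset \/ (T' `<=` T)%fset.

Lemma chain_card_inj sg : is_chain sg -> {in sg &, injective (fun T => #|` T|)}.
Proof.
move=> ch T T' Tsg T'sg /= cE; apply/eqP.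
by case: (ch _ _ Tsg T'sg) => sub; [|rewrite eq_sym]; rewrite eqEfcard sub cE leqnn.
Qed.

Lemma card_chain_le sg k : is_chain sg -> (forall T, T \in sg -> (#|` T| <= k)%N) ->
  (#|` sg| <= k.+1)%N.
Proof.
move=> /chain_card_inj inj le; rewrite -(size_iota 0 k.+1) -(size_map (fun T => #|` T|)).
apply: uniq_leq_size; first by rewrite map_inj_in_uniq ?fset_uniq.
by move=> i /mapP[T Tsg ->]; rewrite mem_iota ltnS le.
Qed.

(** Members of a chain have distinct cardinalities, so k+1 of them with at most k elements realise
    every cardinality. Removing the largest member and recording its one new element gives the order
    [u]. *)
Lemma full_chain k sg : is_chain sg -> (forall T, T \in sg -> (#|` T| <= k)%N) ->
  #|` sg| = k.+1 -> exists u, [/\ uniq u, size u = k &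
    sg =i [seq prefix_set i u | i <- iota 0 k.+1]].
Proof.
elim: k sg => [|k IH] sg ch le csg.
  exists [::]; split=> // T; rewrite /= inE.
  have /eqP/cardfs1P[T0 sgE] := csg; rewrite sgE inE.
  have := le T0; rewrite sgE inE eqxx leqn0 cardfs_eq0 => /(_ isT)/eqP ->.
  by rewrite prefix_set0.
have [T0 T0sg cT0] : exists2 T0, T0 \in sg & #|` T0| = k.+1.
  apply: contrapT => h; have : (#|` sg| <= k.+1)%N.
    apply: card_chain_le => // T Tsg; rewrite -ltnS ltn_neqAle le// andbT.
    by apply/negP => /eqP cT; apply: h; exists T.
  by rewrite csg ltnn.
have max T : T \in sg -> (T `<=` T0)%fset.
  move=> Tsg; case: (ch _ _ Tsg T0sg) => // sub.
  suff -> : T = T0 by exact: fsubset_refl.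
  by apply/esym/eqP; rewrite eqEfcard sub cT0 le.
have [|T||u [uu su uE]] := IH (sg `\ T0)%fset.
- by move=> T T'; rewrite !inE => /andP[_ ?] /andP[_ ?]; exact: ch.
- rewrite !inE => /andP[TT0 Tsg]; rewrite -ltnS ltn_neqAle le// andbT.
  apply: contra TT0 => /eqP cT; apply/eqP; apply: (chain_card_inj ch) => //.
  by rewrite cT cT0.
- by have := cardfsD1 T0 sg; rewrite T0sg csg => -[].
have : setof u \in (sg `\ T0)%fset.
  by rewrite uE; apply/mapP; exists k; [by rewrite mem_iota add0n ltnSn|by rewrite /prefix_set -su take_size].
rewrite !inE => /andP[uT0 usg].
have /fsubsetPn[s sT0 su'] : ~~ (T0 `<=` setof u)%fset.
  by apply/negP => /fsubset_leq_card; rewrite cT0 card_setof// su ltnn.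
rewrite mem_setof in su'.
have usu : uniq (rcons u s) by rewrite rcons_uniq su'.
have sE : setof (rcons u s) = T0.
  apply/eqP; rewrite eqEfcard cT0 card_setof// size_rcons su leqnn andbT.
  apply/fsubsetP => z; rewrite mem_setof mem_rcons inE => /orP[/eqP -> //|zu].
  by apply: (fsubsetP (max _ usg)); rewrite mem_setof.
exists (rcons u s); rewrite size_rcons su; split=> // T.
have -> : [seq prefix_set i (rcons u s) | i <- iota 0 k.+2] =
    [seq prefix_set i u | i <- iota 0 k.+1] ++ [:: T0].
  rewrite -[k.+2]addn1 iotaD map_cat add0n; congr (_ ++ _); last first.
    by rewrite /= /prefix_set take_oversize ?size_rcons ?su// sE.
  apply/eq_in_map => i; rewrite mem_iota add0n ltnS => /= ik.
  by rewrite /prefix_set -cats1 takel_cat// su.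
rewrite mem_cat -uE !inE.
by case: eqVneq => [->|]; rewrite ?T0sg ?orbF.
Qed.

End FullChains.

Section DavisRealization.
Context (W : groupType) (S : finType) (gen : S -> W) (m : nat).
Hypothesis hW : is_coxeter_system gen.
Hypothesis hL : pseudomanifold (nerve gen) m.
Context (C : chamber_system S) (dW : C -> C -> W).
Hypothesis hC : is_building gen dW.
Implicit Types (c : C) (s : S) (u v : seq S) (x T : {fset S}).

Let X := davis_realization gen dW.
Let cls := davis_class gen dW.

Lemma mirrors_atE x : spherical gen x -> mirrors_at gen x = [set` x].
Proof.
move=> sx; apply/seteqP; split=> s /=.
  by move=> [_ /(_ x)]; rewrite inE; exact.
move=> sinx; split; last by move=> T; rewrite inE => /eqP ->.
split; first by apply/fset0Pn; exists x; rewrite inE.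
- by move=> T; rewrite inE => /eqP ->.
- by move=> T T'; rewrite !inE => /eqP -> /eqP ->; left.
Qed.

Lemma parabolic_id (A : set S) : parabolic gen A 1%g.
Proof. by move=> H [[]]. Qed.

Lemma parabolicM (A : set S) w w' : parabolic gen A w -> parabolic gen A w' -> parabolic gen A (w * w')%g.
Proof. by move=> h h' H HA; have [[_ HM _] _] := HA; apply: HM; [exact: h|exact: h']. Qed.

Lemma parabolic_gen (A : set S) s : A s -> parabolic gen A (gen s).
Proof. by move=> As H [_]; apply; exists s. Qed.

Lemma davis_class_self c x : cls c x (c, x).
Proof. by split=> //=; rewrite (dW_refl hC); exact: parabolic_id. Qed.

Lemma davis_class_eq c c' x x' : cls c x = cls c' x' ->
  x = x' /\ (spherical gen x -> parabolic gen [set` x] (dW c c')).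
Proof.
move=> e; have := davis_class_self c' x'; rewrite -e => -[/= -> p]; split=> // sx.
by rewrite -mirrors_atE.
Qed.

Lemma davis_class_inj c : injective (cls c).
Proof. by move=> x x' /davis_class_eq[]. Qed.

(** Crossing an [s]-panel changes the distance at most by a factor [gen s], which lies in the
    parabolic subgroup of [x]. *)
Lemma davis_class_panel s c c' x : sequiv s c c' -> spherical gen x -> s \in x ->
  cls c x = cls c' x.
Proof.
move=> e sx sinx; apply/seteqP; split=> -[c2 x2] [/= xE p]; split=> //=; move: p;
  rewrite (mirrors_atE sx) => p.
- have [->//|->] := dW_sequivl hW hC c2 e.
  by apply: parabolicM => //; exact: parabolic_gen.
- have [->//|->] := dW_sequivl hW hC c2 (sequiv_sym e).
  by apply: parabolicM => //; exact: parabolic_gen.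
Qed.

(** Ranks 0 to m+1 give m+2 vertices. Listing them by rank is the reference order with which the
    arbitrary orientation is compared. *)
Definition std_vertices c u := [seq cls c (prefix_set i u) | i <- iota 0 m.+2].

Definition top_simplex c u := setof (std_vertices c u).

Lemma prefix_sets_uniq u : flag gen m u -> uniq [seq prefix_set i u | i <- iota 0 m.+2].
Proof.
move=> [su uu _]; rewrite map_inj_in_uniq ?iota_uniq// => i j.
rewrite !mem_iota !add0n !ltnS /= => im jm /(congr1 (fun T : {fset S} => #|` T|)).
by rewrite !card_prefix_set ?su.
Qed.

Lemma std_vertices_uniq c u : flag gen m u -> uniq (std_vertices c u).
Proof.
move=> fu; rewrite /std_vertices (map_comp (cls c)) map_inj_uniq; last exact: davis_class_inj.
exact: prefix_sets_uniq.
Qed.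

Lemma card_top_simplex c u : flag gen m u -> #|` top_simplex c u| = m.+2.
Proof. by move=> fu; rewrite card_setof ?std_vertices_uniq// size_map size_iota. Qed.

Lemma top_simplex_simplex c u : flag gen m u -> X (top_simplex c u).
Proof.
move=> fu; exists c, (setof [seq prefix_set i u | i <- iota 0 m.+2]); split.
- split.
  + by apply/fset0Pn; exists (prefix_set 0 u); rewrite mem_setof mem_head.
  + by move=> T; rewrite mem_setof => /mapP[i _ ->]; exact: flag_prefix_spherical fu.
  + move=> T T'; rewrite !mem_setof => /mapP[i _ ->] /mapP[j _ ->].
    by case: (leqP i j) => [|/ltnW] ij; [left|right]; exact: prefix_set_sub.
- rewrite /top_simplex /std_vertices; move: (iota _ _) => r.
  apply/fsetP => v; rewrite mem_setof; apply/mapP/imfsetP => /=.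
    by move=> [i im ->]; exists (prefix_set i u) => //; rewrite mem_setof (map_f (fun i => prefix_set i u)).
  by move=> [x]; rewrite mem_setof => /mapP[i im ->] ->; exists i.
Qed.

Lemma davis_chamber_chain sg : davis_chamber gen sg ->
  is_chain sg /\ forall T, T \in sg -> (#|` T| <= m.+1)%N.
Proof. by move=> [_ sp ch]; split=> // T /sp; exact: card_spherical. Qed.

Lemma card_davis_image c (sg : {fset {fset S}}) :
  #|` [fset cls c x | x in sg]%fset| = #|` sg|.
Proof. by rewrite card_imfset//; exact: davis_class_inj. Qed.

Lemma card_simplex_le sg : X sg -> (#|` sg| <= m.+2)%N.
Proof.
move=> [c [sg0 [sg0D ->]]]; have [ch le] := davis_chamber_chain sg0D.
rewrite card_davis_image; exact: card_chain_le.
Qed.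

Lemma top_simplexP sg : X sg -> #|` sg| = m.+2 ->
  exists c u, flag gen m u /\ sg = top_simplex c u.
Proof.
move=> [c [sg0 [sg0D ->]]]; have [ch le] := davis_chamber_chain sg0D.
rewrite card_davis_image => csg; have [u [uu su uE]] := full_chain ch le csg.
have fu : flag gen m u.
  split=> //; have [_ sp _] := sg0D; apply: sp; rewrite uE.
  by apply/mapP; exists m.+1; [by rewrite mem_iota add0n ltnSn|by rewrite /prefix_set -su take_size].
exists c, u; split=> //; move: uE; rewrite /top_simplex /std_vertices; move: (iota _ _) => r uE.
apply/fsetP => v; rewrite mem_setof; apply/imfsetP/mapP => /=.
  by move=> [x]; rewrite uE => /mapP[i im ->] ->; exists i.
by move=> [i im ->]; exists (prefix_set i u) => //; rewrite uE (map_f (fun i => prefix_set i u)).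
Qed.

Lemma has_dimension_davis n : has_dimension X n -> n = m.+1.
Proof.
move=> [[sg [sgX csg]] le]; apply/eqP; rewrite eqn_leq -ltnS -csg card_simplex_le//=.
have [_ [[[T [TK cT]] _] _] _] := hL; have [c _] := sgX.
have fT : flag gen m (enum_fset T) by apply: flag_exists hL _ _; apply/(maximal_spherical hL); case: TK.
by have := le _ (top_simplex_simplex c fT); rewrite card_top_simplex.
Qed.

Definition facet_vertices c u i :=
  [seq cls c (prefix_set j u) | j <- iota 0 m.+2 & j != i].

Definition facet c u i := setof (facet_vertices c u i).

Lemma index_std_vertices c u i : flag gen m u -> (i <= m.+1)%N ->
  index (cls c (prefix_set i u)) (std_vertices c u) = i.
Proof.
move=> fu im; have i1 : (i < size (iota 0 m.+2))%N by rewrite size_iota ltnS.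
have iE : cls c (prefix_set i u) = nth set0 (std_vertices c u) i.
  by rewrite (nth_map 0%N)// nth_iota.
by rewrite iE index_uniq ?std_vertices_uniq// size_map.
Qed.

Lemma facet_vertices_rem c u i : flag gen m u -> (i <= m.+1)%N ->
  rem (cls c (prefix_set i u)) (std_vertices c u) = facet_vertices c u i.
Proof.
move=> fu im; rewrite rem_filter ?std_vertices_uniq// /std_vertices filter_map.
congr map; apply: eq_in_filter => j; rewrite mem_iota add0n ltnS => /= jm.
congr negb; apply/eqP/eqP => [|-> //] /(congr1 (fun z => index z (std_vertices c u))).
by rewrite !index_std_vertices.
Qed.

Lemma mem_std_vertices c u i : (i <= m.+1)%N -> cls c (prefix_set i u) \in std_vertices c u.
Proof. by move=> im; rewrite (map_f (fun j => cls c (prefix_set j u)))// mem_iota add0n ltnS. Qed.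

Lemma mem_facet c u i j : (j <= m.+1)%N -> j != i -> cls c (prefix_set j u) \in facet c u i.
Proof.
move=> jm ji; rewrite mem_setof (map_f (fun j => cls c (prefix_set j u)))//.
by rewrite mem_filter ji mem_iota add0n ltnS.
Qed.

Lemma facet_vertices_uniq c u i : flag gen m u -> (i <= m.+1)%N -> uniq (facet_vertices c u i).
Proof. by move=> fu im; rewrite -facet_vertices_rem// rem_uniq// std_vertices_uniq. Qed.

Lemma facet_sub c u i : (facet c u i `<=` top_simplex c u)%fset.
Proof.
apply/fsubsetP => v; rewrite !mem_setof => /mapP[j]; rewrite mem_filter => /andP[_ jm] ->.
exact: (map_f (fun j => cls c (prefix_set j u))).
Qed.

Lemma card_facet c u i : flag gen m u -> (i <= m.+1)%N -> #|` facet c u i| = m.+1.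
Proof.
move=> fu im; rewrite card_setof ?facet_vertices_uniq// -facet_vertices_rem//.
by rewrite size_rem ?mem_std_vertices// size_map size_iota.
Qed.

Lemma facet_simplex c u i : flag gen m u -> (i <= m.+1)%N -> X (facet c u i).
Proof.
move=> fu im; apply: simplex_sub (top_simplex_simplex c fu) (facet_sub c u i) _.
by rewrite -cardfs_gt0 card_facet.
Qed.

Lemma facet_exists c u (ta : {fset set (C * {fset S})}) : flag gen m u ->
  (ta `<=` top_simplex c u)%fset -> #|` ta| = m.+1 ->
  exists2 i, (i <= m.+1)%N & ta = facet c u i.
Proof.
move=> fu sub cta.
have /fsubsetPn[v] : ~~ (top_simplex c u `<=` ta)%fset.
  by apply/negP => /fsubset_leq_card; rewrite card_top_simplex// cta ltnn.
rewrite mem_setof => /mapP[i im vE] vta.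
rewrite mem_iota add0n ltnS /= in im; exists i => //.
apply/eqP; rewrite eqEfcard cta card_facet// leqnn andbT.
apply/fsubsetP => z zta; rewrite mem_setof -facet_vertices_rem// mem_rem_uniq ?std_vertices_uniq// !inE.
rewrite -vE; apply/andP; split; first by apply: contra vta => /eqP <-.
by have := fsubsetP sub _ zta; rewrite mem_setof.
Qed.

(** A shared vertex of rank j gives equal sets of rank j and a distance from c to c' in their
    parabolic subgroup. If rank 0 is present, this subgroup is trivial, so the chambers agree. If it
    is the missing rank, rank 1 places the distance in {1, s}. *)
Lemma facet_in_top c c' u u' i : flag gen m u -> flag gen m u' ->
  (facet c u i `<=` top_simplex c' u')%fset ->
  [/\ flag_adjacent m i u u', i != 0%N -> c = c'
    & i = 0%N -> u = u' /\ forall s v, u = s :: v -> sequiv s c c'].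
Proof.
move=> fu fu' /fsubsetP sub; have [su uu spu] := fu; have [su' uu' _] := fu'.
have key j : (j <= m.+1)%N -> j != i ->
    prefix_set j u = prefix_set j u' /\ parabolic gen [set` prefix_set j u] (dW c c').
  move=> jm ji; have := sub _ (mem_facet c u jm ji).
  rewrite mem_setof => /mapP[j']; rewrite mem_iota add0n ltnS /= => j'm.
  move=> /davis_class_eq[e /(_ (flag_prefix_spherical _ fu)) p]; split=> //.
  rewrite [in LHS]e; congr prefix_set; apply/esym.
  by have := congr1 (fun T : {fset S} => #|` T|) e; rewrite !card_prefix_set ?su ?su'.
have adj : flag_adjacent m i u u' by move=> j jm ji; have [] := key j jm ji.
split=> //.
  move=> i0; have [_] := key 0%N isT (contra_neq (@esym _ _ _) i0).
  by rewrite prefix_set0 => /parabolic0 /(dW_eq1 hC).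
move=> i0; rewrite {}i0 in adj key *; split; first exact: (flag_adjacent0 fu fu' adj).
move=> s v uE; have [_] := key 1%N isT isT.
have -> : [set` prefix_set 1 u] = [set s].
  by apply/seteqP; split=> t /=; rewrite uE /prefix_set /= take0 mem_setof inE => /eqP.
move=> /(parabolic1 hW)[/(dW_eq1 hC) ->|/(dW_gen hW hC)[]//]; exact: sequiv_refl.
Qed.

Lemma top_simplex_inj c c' u u' : flag gen m u -> flag gen m u' ->
  top_simplex c u = top_simplex c' u' -> c = c' /\ u = u'.
Proof.
move=> fu fu' e.
have sub i : (facet c u i `<=` top_simplex c' u')%fset by rewrite -e facet_sub.
have [_ /(_ isT) -> _] := facet_in_top fu fu' (sub 1%N).
by have [_ _ /(_ erefl)[-> _]] := facet_in_top fu fu' (sub 0%N).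
Qed.

Lemma facet_vertices_adjacent c u v i : flag_adjacent m i u v ->
  facet_vertices c u i = facet_vertices c v i.
Proof.
move=> a; apply/eq_in_map => j; rewrite mem_filter mem_iota add0n ltnS => /andP[ji /= jm].
by rewrite a.
Qed.

Lemma facet_vertices_panel s c c' u : flag gen m (s :: u) -> sequiv s c c' ->
  facet_vertices c (s :: u) 0 = facet_vertices c' (s :: u) 0.
Proof.
move=> fu e; apply/eq_in_map => j; rewrite mem_filter => /andP[j0 _].
apply: (davis_class_panel e); first exact: flag_prefix_spherical fu.
by case: j j0 => // j _; rewrite mem_setof /= mem_head.
Qed.

(** * Incidence numbers of top simplices and their facets *)

Section Signs.
Context (eps : seq S -> bool).
Hypothesis heps : flag_orientation gen m eps.
Context (o : {fset set (C * {fset S})} -> seq (set (C * {fset S}))).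
Hypothesis ho : is_orientation X o.

(** The coefficient of [top_simplex c u] in the fundamental class of the chamber: the comparison of
    the order by rank with [o], times the sign given by [eps]. *)
Definition flag_sign c u : int :=
  (-1) ^+ (inversions (std_vertices c u) (o (top_simplex c u)) + eps u).

Definition facet_sign c u i : int :=
  (-1) ^+ (i + inversions (facet_vertices c u i) (o (facet c u i))).

(** In the order by rank the incidence number is (-1)^i; passing to [o] adds one comparison sign for
    the simplex and one for the facet. The former is cancelled by [flag_sign], so apart from [eps u]
    only data of the ordered facet remain. *)
Lemma incidence_facet c u i : flag gen m u -> (i <= m.+1)%N ->
  incidence o (top_simplex c u) (facet c u i) * flag_sign c u = facet_sign c u i * (-1) ^+ eps u.
Proof.
move=> fu im; have kt := top_simplex_simplex c fu; have kf := facet_simplex c fu im.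
have fE : facet c u i =i rem (cls c (prefix_set i u)) (std_vertices c u).
  by move=> z; rewrite facet_vertices_rem// mem_setof.
rewrite (incidence_rem ho kt kf (std_vertices_uniq c fu) (mem_setof _) (mem_std_vertices c u im) fE).
rewrite index_std_vertices// facet_vertices_rem// /flag_sign /facet_sign -!exprD.
by rewrite -signr_odd -[RHS]signr_odd !oddD; do 4!case: (odd _).
Qed.

(** The two flags give the same ordered facet but opposite values of [eps], which is why the
    rescaled incidence numbers are opposite. *)
Lemma star_interior c u v i : flag gen m u -> flag gen m v -> u != v ->
  (0 < i <= m.+1)%N -> flag_adjacent m i u v ->
  [/\ top_simplex c u != top_simplex c v,
      forall sg, X sg -> #|` sg| = m.+2 ->
        ((facet c u i `<=` sg)%fset <-> sg = top_simplex c u \/ sg = top_simplex c v)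
    & incidence o (top_simplex c v) (facet c u i) * flag_sign c v =
      - (incidence o (top_simplex c u) (facet c u i) * flag_sign c u)].
Proof.
move=> fu fv uv /[dup] /andP[i0 im] i0m a.
have [w [fw uw ew aw wP]] := flag_partner hL heps fu i0m.
have vw : v = w by case: (wP v fv a) => // vu; rewrite vu eqxx in uv.
subst w; have fE : facet c u i = facet c v i by rewrite /facet (facet_vertices_adjacent c a).
split.
- by apply: contra uv => /eqP /(top_simplex_inj fu fv)[_ ->].
- move=> sg ksg csg; split=> [|[] ->]; [|exact: facet_sub|by rewrite fE facet_sub].
  have [c' [u' [fu' ->]]] := top_simplexP ksg csg.
  move=> /(facet_in_top fu fu')[a' /(_ _)cE _]; rewrite -cE -?lt0n//.
  by case: (wP u' fu' a') => ->; [left|right].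
- have := incidence_facet c fv im; rewrite -fE => ->.
  rewrite (incidence_facet c fu im) ew; have -> : facet_sign c v i = facet_sign c u i.
    by rewrite /facet_sign -fE (facet_vertices_adjacent c a).
  by rewrite -mulrN; congr (_ * _); case: (eps u).
Qed.

(** All chambers of the panel share the ordered facet and also the flag, hence [eps]. Their rescaled
    incidence numbers therefore agree, and a cycle has plain panel sums equal to 0. *)
Lemma star_panel s c u : flag gen m (s :: u) ->
  (forall sg, X sg -> #|` sg| = m.+2 ->
    ((facet c (s :: u) 0 `<=` sg)%fset <->
     exists2 c', sequiv s c c' & sg = top_simplex c' (s :: u))) /\
  (forall c', sequiv s c c' ->
    incidence o (top_simplex c' (s :: u)) (facet c (s :: u) 0) * flag_sign c' (s :: u) =
    facet_sign c (s :: u) 0 * (-1) ^+ eps (s :: u)).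
Proof.
move=> fu; have fE c' : sequiv s c c' -> facet c (s :: u) 0 = facet c' (s :: u) 0.
  by move=> e; rewrite /facet (facet_vertices_panel fu e).
split=> [sg ksg csg|c' e]; last first.
  rewrite [in LHS](fE _ e) incidence_facet//; congr (_ * _).
  by rewrite /facet_sign -(fE _ e) (facet_vertices_panel fu e).
split=> [|[c' e ->]]; last by rewrite (fE _ e) facet_sub.
have [c' [u' [fu' ->]]] := top_simplexP ksg csg.
move=> /(facet_in_top fu fu')[_ _ /(_ erefl)[<- /(_ _ _ erefl) e]].
by exists c'.
Qed.

Lemma flag_sign_sqr c u : flag_sign c u * flag_sign c u = 1.
Proof. by rewrite /flag_sign -expr2 sqrr_sign. Qed.

End Signs.

End DavisRealization.

(** * Boundary and coboundary operators *)

Lemma quotient_trivial (T : Type) (A : pzRingType) (Z B : set (T -> A)) :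
  Z (cst 0) -> B (cst 0) -> (forall a b, B a -> B b -> B (a \+ b)) ->
  (forall a, B a -> B (\- a)) -> quotient Z B = [set B] <-> Z `<=` B.
Proof.
move=> Z0 B0 BD BN; split=> [e z Zz|ZB].
  have : quotient Z B [set z \+ b | b in B] by exists z.
  rewrite e => <-; exists (cst 0) => //.
  by apply/funext => x; rewrite /= addr0.
have cosetE z : Z z -> [set z \+ b | b in B] = B.
  move=> /ZB Bz; apply/seteqP; split=> [_ [b Bb <-]|b Bb]; first exact: BD.
  exists (b \+ (\- z)); first by apply: BD => //; exact: BN.
  by apply/funext => x; rewrite /= addrC subrK.
apply/seteqP; split=> [_ [z Zz <-]|_ ->]; first exact: cosetE.
by exists (cst 0) => //; exact: cosetE.
Qed.

(** Jensen at the mean gives the factor k^(p-1) for k terms; the cruder k^p is enough for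
    boundedness of the coboundary. *)
Lemma powR_sum_le (R : realType) (I : eqType) (p : R) (l : seq I) (F : I -> R) : 1 < p ->
  `|\sum_(i <- l) F i| `^ p <= (size l)%:R `^ p * \sum_(i <- l) `|F i| `^ p.
Proof.
move=> p1; have p0 : p != 0 by rewrite gt_eqF//; lra.
have [l0|l0] := posnP (size l).
  by rewrite (size0nil l0) !big_nil normr0 mulr0 powR0.
have kR : 1 <= (size l)%:R :> R by rewrite ler1n.
have k0 : 0 < (size l)%:R :> R by lra.
have t0 : 0 <= `|\sum_(i <- l) F i| / (size l)%:R by rewrite divr_ge0// ltW.
have := @sum_powR_tangent R I p _ l F p1 t0.
rewrite !big_const_seq !count_predT !iter_addr_0 -!(mulr_natr (_ / _)) divfK ?gt_eqF//.
move=> /(_ (ler_norm_sum _ _ _)) h.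
rewrite -[X in X `^ p](divfK (lt0r_neq0 k0)) powRM// ?(ltW k0)// mulrC ler_wpM2l ?powR_ge0//.
apply: le_trans h; rewrite -(mulr_natr (_ `^ _)); apply: ler_peMr => //; exact: powR_ge0.
Qed.

Section IncidenceSums.
Context (A : pzRingType) (V : choiceType) (K : simplicial_complex V).
Context (o : {fset V} -> seq V).
Implicit Types (sg ta : {fset V}) (a b : {fset V} -> A).

Lemma incidence_eq0 sg ta : ~~ ((ta `<=` sg)%fset && (#|` sg| == #|` ta|.+1)) ->
  incidence o sg ta = 0.
Proof. by rewrite /incidence => /negbTE ->. Qed.

Lemma coboundary_sum b sg : coboundary K o b sg = if `[< K sg >] then
  \sum_(ta <- fpowerset sg | `[< K ta >]) (incidence o sg ta)%:~R * b ta else 0.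
Proof.
rewrite /coboundary; case: asboolP => // ksg.
have u : uniq [seq ta <- fpowerset sg | `[< K ta >]] by rewrite filter_uniq ?fset_uniq.
rewrite (fsbigE (A := simplex K) [seq ta <- fpowerset sg | `[< K ta >]])//.
- rewrite -[RHS]big_filter big_mkcond [RHS]big_seq big_seq; apply: eq_bigr => ta.
  by rewrite mem_filter => /andP[/asboolP kta _]; rewrite mem_set.
- by move=> ta /=; rewrite mem_filter => /andP[/asboolP].
- move=> ta kta; rewrite mem_filter asboolT//= => h.
  by rewrite incidence_eq0 ?mul0r// -fpowersetE negb_and h.
Qed.

Lemma boundary_sum a ta (st : seq {fset V}) : K ta -> uniq st ->
  (forall sg, sg \in st -> K sg) ->
  (forall sg, K sg -> sg \notin st -> (ta `<=` sg)%fset -> #|` sg| = #|` ta|.+1 -> a sg = 0) ->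
  boundary K o a ta = \sum_(sg <- st) (incidence o sg ta)%:~R * a sg.
Proof.
move=> kta ust stK st0; rewrite /boundary asboolT//.
rewrite (fsbigE (A := simplex K) st)//.
- rewrite big_mkcond [RHS]big_seq big_seq; apply: eq_bigr => sg /stK ksg.
  by rewrite mem_set.
- move=> sg ksg nst; have [/andP[sub /eqP c]|h] := boolP ((ta `<=` sg)%fset && (#|` sg| == #|` ta|.+1)).
    by rewrite st0 ?mulr0.
  by rewrite incidence_eq0 ?mul0r.
Qed.

End IncidenceSums.

Section Incidence.
Context (R : realType) (V : choiceType) (K : simplicial_complex V).
Context (o : {fset V} -> seq V).
Implicit Types (sg ta : {fset V}) (a b : {fset V} -> R).

Let D := coboundary K o (R := R).

Lemma incidence_norm_le1 sg ta : `|(incidence o sg ta)%:~R : R| <= 1.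
Proof.
by rewrite /incidence; case: ifP => _; rewrite ?normr0// rmorphXn/= rmorphN1 normrX normrN1 expr1n.
Qed.

Lemma coboundaryE b sg : D b sg = if `[< K sg >] then
  \sum_(ta <- fpowerset sg | `[< K ta >]) (incidence o sg ta)%:~R * b ta else 0.
Proof. exact: coboundary_sum. Qed.

Lemma coboundaryD a b sg : D (fun ta => a ta + b ta) sg = D a sg + D b sg.
Proof.
rewrite !coboundaryE; case: ifP; rewrite ?addr0// -big_split.
by move=> _; apply: eq_bigr => ta _; rewrite mulrDr.
Qed.

Lemma coboundaryZ c b sg : D (fun ta => c * b ta) sg = c * D b sg.
Proof.
rewrite !coboundaryE; case: ifP; rewrite ?mulr0// mulr_sumr.
by move=> _; apply: eq_bigr => ta _; rewrite mulrCA.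
Qed.

Lemma coboundary0 : D (fun=> 0) = fun=> 0.
Proof.
apply/funext => sg; rewrite coboundaryE; case: ifP => // _.
by rewrite big1// => ta _; rewrite mulr0.
Qed.

Definition unit_at ta : {fset V} -> R := fun sg => (sg == ta)%:R.

Lemma coboundary_unit_at ta sg : K ta ->
  D (unit_at ta) sg = if `[< K sg >] then (incidence o sg ta)%:~R else 0.
Proof.
move=> kta; rewrite coboundaryE; case: ifP => // _.
have [sub|nsub] := boolP (ta `<=` sg)%fset; last first.
  rewrite incidence_eq0 ?(negbTE nsub)// big1_seq// => t; rewrite fpowersetE => /andP[_ tsg].
  by rewrite /unit_at (_ : (t == ta) = false) ?mulr0//; apply: contraNF nsub => /eqP <-.
rewrite big_mkcond (bigD1_seq ta) ?fset_uniq ?fpowersetE//= asboolT//.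
rewrite /unit_at eqxx mulr1 big1 ?addr0// => t /negbTE ->.
by rewrite mulr0 if_same.
Qed.

Context (p : R) (k N : nat).
Hypothesis p1 : 1 < p.
Hypothesis star_bound : forall ta, K ta -> #|` ta| = k -> exists l : seq {fset V},
  (size l <= N)%N /\ forall sg, K sg -> #|` sg| = k.+1 -> (ta `<=` sg)%fset -> sg \in l.

(** A simplex with k+1 vertices has at most 2^(k+1) faces, which gives the first factor through
    [powR_sum_le]; a face lies in at most [N] such simplices, which gives the second after
    exchanging the sums. *)
Lemma coboundary_psum_le b M : (forall ta, ~ (K ta /\ #|` ta| = k) -> b ta = 0) ->
  psum_le p b M -> psum_le p (D b) ((2 ^ k.+1)%:R `^ p * N%:R * M).
Proof.
move=> bsupp bM l ul; have p0 : 0 < p by apply: lt_trans p1.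
have M0 := psum_le_ge0 bM.
pose good sg := `[< K sg /\ #|` sg| = k.+1 >].
have Dbad sg : ~~ good sg -> D b sg = 0.
  move=> /asboolPn h; rewrite coboundaryE; case: asboolP => // ksg.
  rewrite big1_seq// => ta /andP[_ _].
  have [[kta cta]|nta] := pselect (K ta /\ #|` ta| = k); last by rewrite bsupp ?mulr0.
  rewrite incidence_eq0 ?mul0r// negb_and; apply/orP; right.
  by apply/negP => /eqP csg; apply: h; rewrite csg cta.
rewrite (bigID good) /= [X in _ + X]big1 ?addr0 => [|sg /Dbad ->]; last first.
  by rewrite normr0 powR0// gt_eqF.
rewrite -big_filter; set l' := [seq _ <- _ | _].
have ul' : uniq l' by rewrite filter_uniq.
have l'P sg : sg \in l' -> K sg /\ #|` sg| = k.+1.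
  by rewrite mem_filter => /andP[/asboolP].
apply: le_trans (_ : \sum_(sg <- l') (2 ^ k.+1)%:R `^ p *
    (\sum_(ta <- fpowerset sg) `|b ta| `^ p) <= _).
  rewrite !big_seq; apply: ler_sum => sg /l'P[ksg csg].
  rewrite coboundaryE asboolT// -big_filter; set P := [seq _ <- _ | _].
  have szP : (size P <= 2 ^ k.+1)%N.
    by rewrite size_filter (leq_trans (count_size _ _))// -csg -card_fpowerset.
  apply: le_trans (powR_sum_le _ _ p1) _; apply: ler_pM; rewrite ?powR_ge0//.
  - by apply: sumr_ge0 => ta _; exact: powR_ge0.
  - by apply: ge0_ler_powR; rewrite ?nnegrE ?ler_nat// ltW.
  apply: le_trans (_ : \sum_(ta <- P) `|b ta| `^ p <= _).
    apply: ler_sum => ta _; apply: ge0_ler_powR; rewrite ?nnegrE// ?(ltW p0)//.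
    by rewrite normrM ler_piMl// incidence_norm_le1.
  apply: sum_uniq_le; rewrite ?filter_uniq ?fset_uniq//.
  by move=> ta; rewrite mem_filter => /andP[].
rewrite -mulr_sumr -mulrA ler_wpM2l ?powR_ge0//.
pose A := undup (flatten [seq enum_fset (fpowerset sg) | sg <- l']).
have -> : \sum_(sg <- l') \sum_(ta <- fpowerset sg) `|b ta| `^ p =
    \sum_(ta <- A) \sum_(sg <- l' | (ta `<=` sg)%fset) `|b ta| `^ p.
  rewrite (exchange_big_dep xpredT)//=; apply: eq_big_seq => sg sgl.
  rewrite -[RHS]big_filter; apply: perm_big; apply: uniq_perm.
  - exact: fset_uniq.
  - by rewrite filter_uniq ?undup_uniq.
  move=> ta; rewrite mem_filter mem_undup fpowersetE; case: fsubsetP => //= sub.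
  apply/esym/flattenP; exists (enum_fset (fpowerset sg)); first exact: map_f.
  by rewrite fpowersetE; apply/fsubsetP.
apply: le_trans (_ : \sum_(ta <- A) N%:R * `|b ta| `^ p <= _).
  apply: ler_sum => ta _.
  have [[kta cta]|nta] := pselect (K ta /\ #|` ta| = k); last first.
    rewrite bsupp// normr0 powR0 ?gt_eqF// mulr0.
    by rewrite big1.
  have [st [szst stP]] := star_bound kta cta.
  rewrite -big_filter big_const_seq count_predT iter_addr_0 -(mulr_natl (_ `^ _)).
  rewrite ler_wpM2r ?powR_ge0// ler_nat; apply: leq_trans szst.
  apply: uniq_leq_size; first by rewrite filter_uniq.
  by move=> sg; rewrite mem_filter => /andP[tasg /l'P[ksg csg]]; exact: stP.
by rewrite -mulr_sumr ler_wpM2l// bM// undup_uniq.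
Qed.

End Incidence.

(** * Homology and reduced cohomology in top degree *)

Section TopDegree.
Context (R : realType) (W : groupType) (S : finType) (gen : S -> W) (m : nat).
Hypothesis hW : is_coxeter_system gen.
Hypothesis hL : pseudomanifold (nerve gen) m.
Hypothesis hG : gallery_connected (nerve gen) m.
Context (eps : seq S -> bool).
Hypothesis heps : flag_orientation gen m eps.
Context (C : chamber_system S) (dW : C -> C -> W).
Hypothesis hC : is_building gen dW.
Context (q : S -> nat).
Hypothesis hq : is_regular C q.
Context (o : {fset set (C * {fset S})} -> seq (set (C * {fset S}))).
Let X := davis_realization gen dW.
Hypothesis ho : is_orientation X o.

Let V := set (C * {fset S}).
Let top := top_simplex gen m dW.
Let sgn c u : R := (flag_sign gen m dW eps o c u)%:~R.
Let inc (sg ta : {fset V}) : R := (incidence o sg ta)%:~R.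

Lemma sgn_sqr c u : sgn c u * sgn c u = 1.
Proof. by rewrite /sgn -intrM flag_sign_sqr. Qed.

Lemma normr_sgn c u : `|sgn c u| = 1.
Proof.
have : `|sgn c u| ^+ 2 = 1 by rewrite -normrX expr2 sgn_sqr normr1.
by move=> /eqP; rewrite sqrf_eq1 => /orP[/eqP //|/eqP E]; have := normr_ge0 (sgn c u); rewrite E; lra.
Qed.

(** A sign is recorded as a real [k] with k * k = 1, the form in which it is later cancelled from
    equations. *)
Lemma incidence_facetR c u i : flag gen m u -> (i <= m.+1)%N ->
  exists2 k : R, k * k = 1 & inc (top c u) (facet gen m dW c u i) = k * sgn c u.
Proof.
move=> fu im; have h := incidence_facet hC eps ho c fu im.
exists ((facet_sign gen m dW o c u i)%:~R * (-1) ^+ eps u).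
  by rewrite mulrACA -intrM -!expr2 !sqrr_sign mulr1.
have -> : (-1) ^+ eps u = ((-1) ^+ eps u : int)%:~R :> R by rewrite rmorphXn rmorphN1.
by rewrite -intrM -h intrM -/(sgn c u) -mulrA sgn_sqr mulr1.
Qed.

Lemma interior_facet c u v i : flag gen m u -> flag gen m v -> u != v ->
  (0 < i <= m.+1)%N -> flag_adjacent m i u v ->
  exists2 k : R, k * k = 1 &
    inc (top c u) (facet gen m dW c u i) = k * sgn c u /\
    inc (top c v) (facet gen m dW c u i) = - k * sgn c v.
Proof.
move=> fu fv uv i0m a; have im : (i <= m.+1)%N by case/andP: i0m.
have [k k1 kE] := incidence_facetR c fu im; exists k => //; split=> //.
have [_ _ h] := star_interior hW hL hC heps ho c fu fv uv i0m a.
have := congr1 (fun z : int => z%:~R * sgn c v : R) h.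
rewrite intrM -mulrA -/(sgn c v) sgn_sqr mulr1 mulrNz intrM => E; rewrite [LHS]E.
by rewrite -/(inc (top c u) (facet gen m dW c u i)) kE -mulrA -/(sgn c u) sgn_sqr mulr1.
Qed.

Lemma panel_facet s c u : flag gen m (s :: u) ->
  exists2 k : R, k * k = 1 &
    forall c', sequiv s c c' -> inc (top c' (s :: u)) (facet gen m dW c (s :: u) 0) = k * sgn c' (s :: u).
Proof.
move=> fu; have [k k1 kE] := incidence_facetR c fu (leq0n m.+1); exists k => // c' e.
have [_ h] := star_panel hW hL hC eps ho c fu.
have := congr1 (fun z : int => z%:~R * sgn c' (s :: u) : R) (etrans (h c' e) (esym (h c (sequiv_refl s c)))).
rewrite intrM -mulrA -/(sgn c' _) sgn_sqr mulr1 intrM => E; rewrite [LHS]E.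
by rewrite -/(inc (top c (s :: u)) (facet gen m dW c (s :: u) 0)) kE -/(sgn c (s :: u)) -(mulrA k) sgn_sqr mulr1.
Qed.

Definition panel_list s c : seq {classic C} := (c : {classic C}) :: adj s c.

Lemma panel_listP s c (c' : C) : (c' : {classic C}) \in panel_list s c <-> sequiv s c c'.
Proof.
rewrite inE; split.
  by move=> /orP[/eqP ->|/(mem_adj hq)[]//]; exact: sequiv_refl.
move=> e; have [//|ne] := eqVneq (c' : {classic C}) c; apply/(mem_adj hq); split=> // E.
by rewrite E eqxx in ne.
Qed.

Lemma panel_list_uniq s c : uniq (panel_list s c).
Proof. by rewrite /= adj_uniq andbT; apply/negP => /(mem_adj hq)[]. Qed.

Lemma top_inj c c' u u' : flag gen m u -> flag gen m u' -> top c u = top c' u' -> c = c' /\ u = u'.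
Proof. exact: top_simplex_inj. Qed.

Lemma panel_tops_uniq s c u : flag gen m u ->
  uniq [seq top (c' : {classic C}) u | c' <- panel_list s c].
Proof.
move=> fu; rewrite map_inj_in_uniq ?panel_list_uniq// => c1 c2 _ _.
by move=> /(top_inj fu fu)[].
Qed.

(** Stands in for purity of the realization: a simplex in no top simplex is harmless, as boundaries
    of top chains vanish there. *)
Lemma star_cases (ta : {fset V}) : X ta -> #|` ta| = m.+1 ->
  (forall sg, X sg -> #|` sg| = m.+2 -> ~ (ta `<=` sg)%fset) \/
  exists c u i, [/\ flag gen m u, (i <= m.+1)%N & ta = facet gen m dW c u i].
Proof.
move=> kta cta; apply: contrapT => /not_orP[]; apply: contra_notP => h sg ksg csg sub.
apply: h; have [c [u [fu sgE]]] := top_simplexP hL hC ksg csg; rewrite sgE in sub.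
have [i im taE] := facet_exists hC fu sub cta.
by apply; exists c, u, i.
Qed.

(** A facet on an [s]-panel lies in q_s + 1 top simplices and any other facet in two; the sum over
    all s makes the bound uniform. *)
Lemma facet_star_bound : exists N, forall ta : {fset V}, X ta -> #|` ta| = m.+1 ->
  exists l : seq {fset V}, (size l <= N)%N /\
    forall sg, X sg -> #|` sg| = m.+2 -> (ta `<=` sg)%fset -> sg \in l.
Proof.
exists (\sum_(s : S) q s + 2)%N => ta kta cta.
have [h|[c [u [i [fu im ->]]]]] := star_cases kta cta.
  by exists [::]; split=> // sg ksg csg /(h sg ksg csg).
have [i0|i0] := posnP i.
  rewrite {}i0 {i im} in im *; case: u fu => [[]//|s u] fu.
  exists [seq top (c' : {classic C}) (s :: u) | c' <- panel_list s c]; split.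
    by rewrite size_map /= (size_adj hq) addn2 ltnS (bigD1 s)//= -addnS leq_addr.
  move=> sg ksg csg; have [h _] := star_panel hW hL hC eps ho c fu.
  move=> /(h sg ksg csg)[c' e ->]; apply: (map_f (fun c' : {classic C} => top c' (s :: u))).
  exact/panel_listP.
have i0m : (0 < i <= m.+1)%N by rewrite i0.
have [v [fv uv _ a _]] := flag_partner hL heps fu i0m.
exists [:: top c u; top c v]; split; first by rewrite /= leq_addl.
move=> sg ksg csg; have [_ h _] := star_interior hW hL hC heps ho c fu fv uv i0m a.
by move=> /(h sg ksg csg)[] ->; rewrite !inE eqxx ?orbT.
Qed.

Definition top_supported (a : {fset V} -> R) :=
  forall sg, ~ (X sg /\ #|` sg| = m.+2) -> a sg = 0.

Lemma boundary_interior a c u v i : flag gen m u -> flag gen m v -> u != v ->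
  (0 < i <= m.+1)%N -> flag_adjacent m i u v -> exists2 k : R, k * k = 1 &
  boundary X o a (facet gen m dW c u i) = k * (sgn c u * a (top c u) - sgn c v * a (top c v)).
Proof.
move=> fu fv uv i0m a'; have im : (i <= m.+1)%N by case/andP: i0m.
have [k k1 [ku kv]] := interior_facet c fu fv uv i0m a'; exists k => //.
have kuE : (incidence o (top c u) (facet gen m dW c u i))%:~R = k * sgn c u by exact: ku.
have kvE : (incidence o (top c v) (facet gen m dW c u i))%:~R = - k * sgn c v by exact: kv.
have [tuv st _] := star_interior hW hL hC heps ho c fu fv uv i0m a'.
rewrite (@boundary_sum _ _ X o a _ [:: top c u; top c v]).
- rewrite !big_cons big_nil addr0 kuE kvE.
  by move: (sgn c u) (sgn c v) => x y; rewrite mulNr mulrBr !mulrA mulNr.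
- exact: facet_simplex.
- by rewrite /= inE tuv.
- by move=> sg; rewrite !inE => /orP[]/eqP ->; exact: top_simplex_simplex.
move=> sg ksg nin sub; rewrite card_facet// => csg.
by case/(st sg ksg csg): sub => E; rewrite E !inE eqxx ?orbT in nin.
Qed.

Lemma boundary_panel a s c u : flag gen m (s :: u) -> exists2 k : R, k * k = 1 &
  boundary X o a (facet gen m dW c (s :: u) 0) =
  k * (\sum_(c' <- panel_list s c) sgn c' (s :: u) * a (top c' (s :: u))).
Proof.
move=> fu; have [k k1 kE] := panel_facet c fu; exists k => //.
have [st _] := star_panel hW hL hC eps ho c fu.
rewrite (@boundary_sum _ _ X o a _ [seq top (c' : {classic C}) (s :: u) | c' <- panel_list s c]).
- rewrite big_map mulr_sumr; apply: eq_big_seq => c' /panel_listP e.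
  by rewrite mulrA -kE.
- exact: facet_simplex.
- exact: panel_tops_uniq.
- by move=> sg /mapP[c' _ ->]; exact: top_simplex_simplex.
move=> sg ksg nin sub; rewrite card_facet// => csg.
case/(st sg ksg csg): sub => c' e E; rewrite E in nin.
case/negP: nin; apply: (map_f (fun c' : {classic C} => top c' (s :: u))); exact/panel_listP.
Qed.

Lemma boundary_eq0 a : top_supported a ->
  (forall c u i, flag gen m u -> (i <= m.+1)%N -> boundary X o a (facet gen m dW c u i) = 0) ->
  boundary X o a = cst 0.
Proof.
move=> supp h; apply/funext => ta; rewrite /cst.
have [kta|nta] := pselect (X ta); last by rewrite /boundary asboolF.
have bd0 : (forall sg, X sg -> (ta `<=` sg)%fset -> #|` sg| = #|` ta|.+1 -> a sg = 0) ->
    boundary X o a ta = 0.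
  move=> h0; rewrite (@boundary_sum _ _ X o a ta [::])// ?big_nil// => sg ksg _.
  exact: h0.
have [cta|cta] := eqVneq #|` ta| m.+1.
  have [h0|[c [u [i [fu im ->]]]]] := star_cases kta cta; last exact: h.
  by apply: bd0 => sg ksg sub; rewrite cta => csg; case: (h0 sg ksg csg).
apply: bd0 => sg ksg sub csg; apply: supp => -[_ csg'].
by move/eqP: cta; apply; rewrite csg in csg'; case: csg'.
Qed.

Lemma sqr1_neq0 (k : R) : k * k = 1 -> k != 0.
Proof. by apply: contra_eq_neq => ->; rewrite mulr0 eq_sym oner_eq0. Qed.

Lemma cycle_flag_indep a c u v : boundary X o a = cst 0 -> flag gen m u -> flag gen m v ->
  sgn c u * a (top c u) = sgn c v * a (top c v).
Proof.
move=> bd fu fv; pose E u v := sgn c u * a (top c u) = sgn c v * a (top c v).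
apply: (@flag_adjacent_connected _ _ _ _ hL E hG _ _ _ u v fu fv); rewrite /E.
- by [].
- by move=> u1 u2 u3 -> ->.
move=> {}u {}v i {}fu {}fv i0m adj; have [->//|uv] := eqVneq u v.
have [k k1] := boundary_interior a c fu fv uv i0m adj.
rewrite bd /cst => /esym/eqP; rewrite mulf_eq0 (negbTE (sqr1_neq0 k1)) subr_eq0.
by move=> /eqP.
Qed.

Lemma cycle_balanced a u : boundary X o a = cst 0 -> flag gen m u ->
  panel_balanced (fun c : {classic C} => sgn c u * a (top c u)).
Proof.
(* The facet on the [s]-panel exists only for flags starting with [s], so the coefficient is first
   moved from [u] to such a flag. *)
move=> bd fu s c; have [v fv] := flag_through hW hL s.
have E c' := cycle_flag_indep c' bd fu fv.
rewrite E; under eq_bigr do rewrite E.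
have [k k1] := boundary_panel a c fv; rewrite bd /cst /panel_list big_cons => /esym/eqP.
by rewrite mulf_eq0 (negbTE (sqr1_neq0 k1)) => /eqP.
Qed.

(* The sum of the fundamental classes of the chambers [c], weighted by [f c]. *)
Definition chamber_chain (f : C -> R) (sg : {fset V}) : R :=
  match pselect (exists cu : C * seq S, flag gen m cu.2 /\ sg = top cu.1 cu.2) with
  | left e => let cu := projT1 (cid e) in sgn cu.1 cu.2 * f cu.1
  | right _ => 0
  end.

Lemma chamber_chain_top f c u : flag gen m u -> chamber_chain f (top c u) = sgn c u * f c.
Proof.
move=> fu; rewrite /chamber_chain; case: pselect => [e|[]]; last by exists (c, u).
by case: cid => -[c' u'] /= [fu'] /(top_inj fu fu')[-> ->].
Qed.

Lemma chamber_chain_supported f : top_supported (chamber_chain f).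
Proof.
move=> sg h; rewrite /chamber_chain; case: pselect => // -[[c u] /= [fu E]].
by case: h; rewrite E; split; [exact: top_simplex_simplex|exact: card_top_simplex].
Qed.

Lemma chamber_chain_cycle f : panel_balanced (f : {classic C} -> R) ->
  boundary X o (chamber_chain f) = cst 0.
Proof.
move=> fP; apply: boundary_eq0; first exact: chamber_chain_supported.
have sE c u : flag gen m u -> sgn c u * chamber_chain f (top c u) = f c.
  by move=> fu; rewrite chamber_chain_top// mulrA sgn_sqr mul1r.
move=> c u i fu im; have [i0|i0] := posnP i.
  rewrite {}i0 {i im} in im *; case: u fu => [[]//|s u] fu.
  have [k _ ->] := boundary_panel (chamber_chain f) c fu.
  under eq_bigr do rewrite (sE _ _ fu).
  by rewrite /panel_list big_cons fP mulr0.
have i0m : (0 < i <= m.+1)%N by rewrite i0.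
have [v [fv uv _ adj _]] := flag_partner hL heps fu i0m.
have [k _ ->] := boundary_interior (chamber_chain f) c fu fv uv i0m adj.
by rewrite !sE// subrr mulr0.
Qed.

Definition flag_list : seq (seq S) :=
  [seq u <- [seq tval t | t <- enum {: m.+1.-tuple S}] | `[< flag gen m u >]].

Lemma mem_flag_list u : u \in flag_list <-> flag gen m u.
Proof.
rewrite mem_filter; split=> [/andP[/asboolP]//|fu]; apply/andP; split; first exact/asboolP.
have [/eqP su _ _] := fu.
by apply/mapP; exists (Tuple su); rewrite ?mem_enum.
Qed.

(** Each chamber contributes |f c|^p once per flag, and there are finitely many flags. The finitely
    many simplices of a partial sum lie in chambers of finitely many spheres, whose full sums are
    bounded by [M]. *)
Lemma chamber_chain_psum_le (p : R) f M : 1 < p -> forall c0 : C,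
  (forall l : seq W, uniq l ->
    \sum_(w <- l) \sum_(c <- sphere_of gen c0 w) `|f c| `^ p <= M) ->
  psum_le p (chamber_chain f) (M * (size flag_list)%:R).
Proof.
move=> p1 c0 fM l ul; have p0 : p != 0 by rewrite gt_eqF// (lt_trans _ p1).
pose good sg := `[< exists cu : C * seq S, flag gen m cu.2 /\ sg = top cu.1 cu.2 >].
have bad0 sg : ~~ good sg -> chamber_chain f sg = 0.
  by move=> /asboolPn h; rewrite /chamber_chain; case: pselect.
rewrite (bigID good) /= [X in _ + X]big1 ?addr0 => [|sg /bad0 ->]; last by rewrite normr0 powR0.
rewrite -big_filter; set l' := [seq _ <- _ | _].
have /choice[ch chP] (sg : {fset V}) : exists c : C, good sg -> exists2 u, flag gen m u & sg = top c u.
  have [/asboolP[[c u] /= [fu E]]|ng] := boolP (good sg); first by exists c => _; exists u.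
  by exists c0.
pose lw := undup [seq dW c0 (ch sg) | sg <- l'].
pose big := flatten [seq flatten [seq [seq top (c : {classic C}) u | u <- flag_list] | c <- sphere_of gen c0 w] | w <- lw].
apply: le_trans (_ : \sum_(sg <- big) `|chamber_chain f sg| `^ p <= _).
  apply: sum_uniq_le; [by rewrite filter_uniq| |by move=> sg; exact: powR_ge0].
  move=> sg sgl; have gsg : good sg by move: sgl; rewrite mem_filter => /andP[].
  have [u fu E] := chP sg gsg.
  apply/flatten_mapP; exists (dW c0 (ch sg)); first by rewrite mem_undup map_f.
  have [_ mw _] := sphere_of_spec hW hC hq c0 (dW c0 (ch sg)).
  apply/(@flatten_mapP {classic C}); exists (ch sg); first exact/mw.
  by rewrite {1}E map_f//; apply/mem_flag_list.
rewrite /big big_flatten big_map.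
apply: le_trans (_ : \sum_(w <- lw) (\sum_(c <- sphere_of gen c0 w) `|f c| `^ p) * (size flag_list)%:R <= _).
  apply: ler_sum => w _; rewrite big_flatten big_map mulr_suml; apply: ler_sum => c _.
  rewrite big_map (eq_big_seq (fun=> `|f c| `^ p)) => [|u /mem_flag_list fu].
    by rewrite big_const_seq count_predT iter_addr_0 -(mulr_natr (_ `^ _)).
  by rewrite chamber_chain_top// normrM normr_sgn mul1r.
by rewrite -mulr_suml ler_wpM2r// fM// undup_uniq.
Qed.

Lemma chain_chamber_psum_le (p : R) (a : {fset V} -> R) u M : flag gen m u -> psum_le p a M ->
  forall l : seq {classic C}, uniq l -> \sum_(c <- l) `|sgn c u * a (top c u)| `^ p <= M.
Proof.
move=> fu aM l ul; rewrite (eq_bigr (fun c => `|a (top c u)| `^ p)) => [|c _].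
  rewrite -(big_map (fun c : {classic C} => top c u) xpredT (fun sg => `|a sg| `^ p)).
  apply: aM; rewrite map_inj_uniq// => c c' /(top_inj fu fu)[//].
by rewrite normrM normr_sgn mul1r.
Qed.

Context (p : R).
Hypothesis p1 : 1 < p.
Hypothesis q_ge2 : forall s, (2 <= q s)%N.

Let p0 : 0 < p := lt_trans ltr01 p1.
Let q_gt0 s : (0 < q s)%N := ltnW (q_ge2 s).

Lemma flag_inhabited : exists u, flag gen m u.
Proof.
have [_ [[[T [TK cT]] _] _] _] := hL; exists (enum_fset T).
by apply: (flag_exists hL); apply/(maximal_spherical hL); case: TK.
Qed.

Lemma lp_chainP k a : lp_chain X p k a <->
  (forall sg, ~ (X sg /\ #|` sg| = k) -> a sg = 0) /\ exists M, psum_le p a M.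
Proof. by split=> -[s /(lp_norm_fin p0) n]. Qed.

Lemma lp_chain_above k a : (m.+2 < k)%N -> lp_chain X p k a -> a = cst 0.
Proof.
move=> mk [supp _]; apply/funext => sg; apply: supp => -[ksg csg].
by have := card_simplex_le hL hC ksg; rewrite csg leqNgt mk.
Qed.

Lemma lp_chain0 k : lp_chain X p k (fun=> 0).
Proof. by apply/lp_chainP; split=> //; exists 0; exact: psum_le0. Qed.

Lemma boundary0 : boundary X o (cst 0 : {fset V} -> R) = cst 0.
Proof.
apply/funext => ta; rewrite /boundary /cst; case: asboolP => // _.
by rewrite fsbig1// => sg _; rewrite mulr0.
Qed.

(** There are no simplices above the top dimension, so homology in this degree is the space of
    cycles itself. *)
Lemma lp_boundaries_top : lp_boundaries X o p m.+1 = [set cst 0].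
Proof.
apply/seteqP; split=> [_ [a /lp_chain_above -> // <-]|_ ->]; first exact: boundary0.
by exists (cst 0); [exact: lp_chain0|exact: boundary0].
Qed.

Lemma lp_homology_nonzeroP : lp_homology_nonzero X o p m.+1 <->
  exists2 a, lp_cycles X o p m.+1 a & a <> cst 0.
Proof.
rewrite /lp_homology_nonzero /lp_homology lp_boundaries_top.
rewrite (@quotient_trivial _ _ (lp_cycles X o p m.+1) [set cst 0])//.
- split=> [h|[a az a0] h]; last exact: a0 (h a az).
  by apply: contra_notP h => h a az; apply: contra_notP h => a0; exists a.
- by split; [exact: lp_chain0|exact: boundary0].
- by move=> a b -> ->; apply/funext => x; rewrite /= addr0.
- by move=> a ->; apply/funext => x; rewrite /= oppr0.
Qed.

Section BaseChamber.
Context (c0 : C).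

Let g := chamber_chain (alternating_density gen dW q R c0).

Lemma alternating_chain_psum_le (p' : R) : 1 < p' -> @weight_summable W S gen q R (p' - 1) ->
  exists M, psum_le p' g M.
Proof.
move=> p'1 [M hM]; exists (M * (size flag_list)%:R).
apply: (@chamber_chain_psum_le p' (alternating_density gen dW q R c0) M p'1 c0) => l ul.
apply: le_trans (hM l ul); rewrite le_eqVlt; apply/orP; left; apply/eqP; apply: eq_bigr => w _.
by rewrite (alternating_density_sum hW hC hq)// opprB.
Qed.

Lemma alternating_chain_cycle : boundary X o g = cst 0.
Proof. by apply: chamber_chain_cycle; exact: alternating_density_balanced. Qed.

Lemma alternating_chain_neq0 u : flag gen m u -> g (top c0 u) != 0.
Proof.
move=> fu; rewrite /g chamber_chain_top// /alternating_density.
rewrite mulf_eq0 -normr_eq0 normr_sgn oner_eq0 /= mulf_eq0 invr_eq0.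
rewrite pnatr_eq0 -[_ == 0%N]negbK -lt0n q_weight_gt0//= orbF.
by case: odd; rewrite ?oppr_eq0 oner_eq0.
Qed.

Lemma homology_summable : lp_homology_nonzero X o p m.+1 <->
  weight_summable gen q (p - 1).
Proof.
split=> [/lp_homology_nonzeroP[a [/lp_chainP[supp [M aM]] bd] a0]|sm].
  have [sg asg] : exists sg, a sg <> 0.
    by apply: contra_notP a0 => h; apply/funext => sg; apply: contra_notP h => h; exists sg.
  have [ksg csg] : X sg /\ #|` sg| = m.+2 by apply: contra_notP asg; exact: supp.
  have [c [u [fu sgE]]] := top_simplexP hL hC ksg csg.
  have fP := cycle_balanced bd fu.
  have := panel_balanced_bound hW hC hq p1 c fP (chain_chamber_psum_le fu aM).
  set z := `|_| `^ p => h; have z0 : 0 < z.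
    by rewrite powR_gt0// normrM normr_sgn mul1r normr_gt0 (_ : top c u = sg)//; apply/eqP.
  exists (M / z) => l ul; rewrite ler_pdivlMr// mulrC.
  by under eq_bigr do rewrite opprB; exact: h.
have [G gG] := alternating_chain_psum_le p1 sm; apply/lp_homology_nonzeroP; exists g.
  split; last exact: alternating_chain_cycle.
  by apply/lp_chainP; split; [exact: chamber_chain_supported|exists G].
have [u fu] := flag_inhabited; move/(congr1 (fun f => f (top c0 u))) => /eqP.
by rewrite (negbTE (alternating_chain_neq0 fu)).
Qed.

End BaseChamber.

(** * Reduced cohomology through limits of coboundaries *)

Let D : ({fset V} -> R) -> {fset V} -> R := coboundary X o (R := R).

(** Closure of the coboundaries, with p-th power sums as the measure of distance; [lp_closureP]
    compares it with [lp_closure]. *)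
Definition approx_coboundary (h : {fset V} -> R) := forall e : R, 0 < e ->
  exists2 b, lp_chain X p m.+1 b & psum_le p (fun sg => h sg - D b sg) e.

(** The divisor offsets the constant 2^p of [psum_leD], so that two errors of this size add up to
    [e]. *)
Let half (e : R) := e / (2 `^ p * 2).

Lemma half_gt0 e : 0 < e -> 0 < half e.
Proof. by move=> e0; rewrite divr_gt0// mulr_gt0// powR_gt0. Qed.

Lemma halfE e : 2 `^ p * (half e + half e) = e.
Proof.
have h : 2 `^ p != 0 :> R by rewrite gt_eqF// powR_gt0.
by rewrite /half; field; rewrite h.
Qed.

Lemma lp_chainD k a b : lp_chain X p k a -> lp_chain X p k b -> lp_chain X p k (fun sg => a sg + b sg).
Proof.
move=> /lp_chainP[sa [A aA]] /lp_chainP[sb [B bB]]; apply/lp_chainP; split.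
  by move=> sg h; rewrite sa// sb// addr0.
by exists (2 `^ p * (A + B)); exact: psum_leD.
Qed.

Lemma lp_chainZ k c a : lp_chain X p k a -> lp_chain X p k (fun sg => c * a sg).
Proof.
move=> /lp_chainP[sa [A aA]]; apply/lp_chainP; split.
  by move=> sg h; rewrite sa// mulr0.
by exists (`|c| `^ p * A); exact: psum_leZ.
Qed.

Lemma approx_coboundaryD h h' : approx_coboundary h -> approx_coboundary h' ->
  approx_coboundary (fun sg => h sg + h' sg).
Proof.
move=> ah ah' e e0; have [b bc bh] := ah _ (half_gt0 e0); have [b' bc' bh'] := ah' _ (half_gt0 e0).
exists (fun sg => b sg + b' sg); first exact: lp_chainD.
rewrite -[e]halfE; have := psum_leD p0 bh bh'; apply: psum_le_mono => // sg.
by rewrite /D coboundaryD addrACA -opprD.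
Qed.

Lemma approx_coboundaryZ c h : approx_coboundary h -> approx_coboundary (fun sg => c * h sg).
Proof.
move=> ah e e0; have c1 : 0 < `|c| `^ p + 1 by rewrite ltr_wpDl ?powR_ge0.
have [b bc bh] := ah (e / (`|c| `^ p + 1)) (divr_gt0 e0 c1).
exists (fun sg => c * b sg); first exact: lp_chainZ.
apply: (@psum_leW _ _ _ _ (`|c| `^ p * (e / (`|c| `^ p + 1)))).
  by rewrite mulrCA ler_piMr ?(ltW e0)// ler_pdivrMr// mul1r lerDl.
have := psum_leZ c bh; apply: psum_le_mono => // sg.
by rewrite /D coboundaryZ mulrBr.
Qed.

Lemma approx_coboundary_chain b : lp_chain X p m.+1 b -> approx_coboundary (D b).
Proof.
move=> bc e e0; exists b => //; have := @psum_le0 R {fset V} p p0 e (ltW e0).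
by apply: psum_le_mono => // sg; rewrite subrr.
Qed.

Lemma approx_coboundary0 : approx_coboundary (fun=> 0).
Proof. by have := approx_coboundary_chain (lp_chain0 m.+1); rewrite /D coboundary0. Qed.

Lemma approx_coboundary_ext h h' : h =1 h' -> approx_coboundary h -> approx_coboundary h'.
Proof. by move=> /funext ->. Qed.

Lemma approx_coboundary_sum (I : eqType) (l : seq I) (F : I -> {fset V} -> R) :
  (forall i, i \in l -> approx_coboundary (F i)) ->
  approx_coboundary (fun sg => \sum_(i <- l) F i sg).
Proof.
elim: l => [|i l IH] h.
  by apply: approx_coboundary_ext approx_coboundary0 => sg; rewrite big_nil.
apply: (@approx_coboundary_ext (fun sg => F i sg + \sum_(j <- l) F j sg)).
  by move=> sg; rewrite big_cons.
apply: approx_coboundaryD; first by apply: h; exact: mem_head.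
by apply: IH => j jl; apply: h; rewrite inE jl orbT.
Qed.

Lemma approx_coboundary_limit h :
  (forall e, 0 < e -> exists2 h', approx_coboundary h' & psum_le p (fun sg => h sg - h' sg) e) ->
  approx_coboundary h.
Proof.
move=> H e e0; have [h' ah' hh'] := H _ (half_gt0 e0); have [b bc bh] := ah' _ (half_gt0 e0).
exists b => //; rewrite -[e]halfE; have := psum_leD p0 hh' bh; apply: psum_le_mono => // sg.
by rewrite addrA subrK.
Qed.

Lemma unit_at_psum_le (ta : {fset V}) : psum_le p (unit_at R ta) 1.
Proof.
move=> l ul; have [tl|tl] := boolP (ta \in l).
  rewrite (bigD1_seq ta)//= /unit_at eqxx normr1 powR1 big1 ?addr0// => t /negbTE ->.
  by rewrite normr0 powR0// gt_eqF.
rewrite big1_seq// => t /andP[_ tin]; rewrite /unit_at (_ : (t == ta) = false).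
  by rewrite normr0 powR0// gt_eqF.
by apply: contraNF tl => /eqP <-.
Qed.

Lemma lp_chain_unit_at (ta : {fset V}) : X ta -> lp_chain X p #|` ta| (unit_at R ta).
Proof.
move=> kta; apply/lp_chainP; split; last by exists 1; exact: unit_at_psum_le.
move=> sg h; rewrite /unit_at; case: eqP => // E; case: h.
by rewrite E.
Qed.

Lemma coboundary_unit_star (ta : {fset V}) (st : seq {fset V}) : X ta -> #|` ta| = m.+1 -> uniq st ->
  (forall sg, sg \in st -> X sg) ->
  (forall sg, X sg -> #|` sg| = m.+2 -> (ta `<=` sg)%fset -> sg \in st) ->
  D (unit_at R ta) = fun sg => \sum_(t <- st) inc t ta * unit_at R t sg.
Proof.
move=> kta cta ust stX st0; apply/funext => sg; rewrite /D coboundary_unit_at//.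
have [sgst|sgst] := boolP (sg \in st).
  rewrite asboolT; last exact: stX.
  rewrite (bigD1_seq sg)//= /unit_at eqxx mulr1 big1 ?addr0// => t ts.
  by rewrite eq_sym (negbTE ts) mulr0.
rewrite big1_seq => [|t /andP[_ tst]]; last first.
  rewrite /unit_at (_ : (sg == t) = false) ?mulr0//.
  by apply: contraNF sgst => /eqP ->.
case: asboolP => // ksg; rewrite incidence_eq0//; apply: contra sgst => /andP[sub /eqP csg].
by apply: st0 => //; rewrite csg cta.
Qed.

(** A top simplex oriented as in the fundamental class of its chamber. Modulo limits of coboundaries
    it depends on [c] alone and stands for that chamber. *)
Let E c u (sg : {fset V}) : R := sgn c u * unit_at R (top c u) sg.

Lemma approx_interior c u v i : flag gen m u -> flag gen m v ->
  (0 < i <= m.+1)%N -> flag_adjacent m i u v -> approx_coboundary (fun sg => E c u sg - E c v sg).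
Proof.
move=> fu fv i0m a; have [->|uv] := eqVneq u v.
  by apply: approx_coboundary_ext approx_coboundary0 => sg; rewrite subrr.
have im : (i <= m.+1)%N by case/andP: i0m.
have [tuv st _] := star_interior hW hL hC heps ho c fu fv uv i0m a.
have [k k1 [ku kv]] := interior_facet c fu fv uv i0m a.
have kta := facet_simplex hC c fu im; have cta := card_facet hC c fu im.
have DE := @coboundary_unit_star _ [:: top c u; top c v] kta cta.
have {}DE : D (unit_at R (facet gen m dW c u i)) = fun sg => k * (E c u sg - E c v sg).
  rewrite DE.
  - apply/funext => sg; rewrite !big_cons big_nil addr0 ku kv /E.
    by move: (sgn c u) (sgn c v) => x y; rewrite mulNr mulrBr !mulrA mulNr.
  - by rewrite /= inE tuv.
  - by move=> sg; rewrite !inE => /orP[]/eqP ->; exact: top_simplex_simplex.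
  - by move=> sg ksg csg /(st sg ksg csg)[] ->; rewrite !inE eqxx ?orbT.
apply: (@approx_coboundary_ext (fun sg => k * D (unit_at R (facet gen m dW c u i)) sg)).
  by move=> sg; rewrite DE mulrA k1 mul1r.
by apply/approx_coboundaryZ/approx_coboundary_chain; rewrite -cta; exact: lp_chain_unit_at.
Qed.

Lemma approx_flags c u v : flag gen m u -> flag gen m v ->
  approx_coboundary (fun sg => E c u sg - E c v sg).
Proof.
move=> fu fv; pose P u v := approx_coboundary (fun sg => E c u sg - E c v sg).
apply: (@flag_adjacent_connected _ _ _ _ hL P hG _ _ _ u v fu fv); rewrite /P.
- by move=> w; apply: approx_coboundary_ext approx_coboundary0 => sg; rewrite subrr.
- move=> u1 u2 u3 a12 a23.
  apply: approx_coboundary_ext (approx_coboundaryD a12 a23) => sg.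
  by rewrite addrA subrK.
- by move=> u1 u2 i; exact: approx_interior.
Qed.

(** The panel sum is, up to sign, the coboundary of the panel facet when the flag starts with [s];
    [approx_flags] then exchanges that flag for [u] in each chamber. *)
Lemma approx_panel s c u : flag gen m u ->
  approx_coboundary (fun sg => \sum_(c' <- panel_list s c) E c' u sg).
Proof.
move=> fu; have [v fv] := flag_through hW hL s.
have [st _] := star_panel hW hL hC eps ho c fv.
have [k k1 kE] := panel_facet c fv.
have kta := facet_simplex hC c fv (leq0n m.+1); have cta := card_facet hC c fv (leq0n m.+1).
have DE := @coboundary_unit_star _ [seq top (c' : {classic C}) (s :: v) | c' <- panel_list s c] kta cta
  (panel_tops_uniq s c fv).
have {}DE : D (unit_at R (facet gen m dW c (s :: v) 0)) =
    fun sg => k * \sum_(c' <- panel_list s c) E c' (s :: v) sg.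
  rewrite DE.
  - apply/funext => sg; rewrite big_map mulr_sumr; apply: eq_big_seq => c' /panel_listP e.
    by rewrite kE// mulrA.
  - by move=> sg /mapP[c' _ ->]; exact: top_simplex_simplex.
  - move=> sg ksg csg /(st sg ksg csg)[c' e ->].
    apply: (map_f (fun c' : {classic C} => top c' (s :: v))); exact/panel_listP.
apply: (@approx_coboundary_ext (fun sg => k * D (unit_at R (facet gen m dW c (s :: v) 0)) sg +
    \sum_(c' <- panel_list s c) (E c' u sg - E c' (s :: v) sg))).
  by move=> sg; rewrite DE mulrA k1 mul1r -big_split; apply: eq_bigr => c' _ /=; rewrite subrKC.
apply: approx_coboundaryD.
  by apply/approx_coboundaryZ/approx_coboundary_chain; rewrite -cta; exact: lp_chain_unit_at.
by apply: approx_coboundary_sum => c' _; exact: approx_flags.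
Qed.

(** Equal to p' - 1 for the conjugate exponent p' = p / (p - 1). *)
Let r := (p - 1)^-1.

Section Averaging.
Context (c0 : C).

Let sg_of w : R := if odd (size (reduced_expression gen w)) then -1 else 1.

Lemma approx_sphere w u : flag gen m u ->
  approx_coboundary (fun sg => E c0 u sg - sg_of w * \sum_(c <- sphere_of gen c0 w) E c u sg).
Proof.
move=> fu; pose F (c : {classic C}) : {fset V} -> R := E c u.
have BN x : approx_coboundary x -> approx_coboundary (- x).
  by move=> ax; apply: approx_coboundary_ext (approx_coboundaryZ (-1) ax) => sg; rewrite mulN1r.
have FP s (c : {classic C}) : approx_coboundary (F c + \sum_(c' <- adj s c) F c').
  apply: approx_coboundary_ext (approx_panel s c fu) => sg.
  by rewrite /panel_list big_cons [in RHS]fctE fct_sumE.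
have h := @sphere_sum S C _ approx_coboundary F c0 (rev (reduced_expression gen w))
  approx_coboundary0 approx_coboundaryD BN FP.
apply: approx_coboundary_ext (approx_coboundaryZ (- sg_of w) h) => sg.
rewrite size_rev /sg_of !fctE fct_sumE -/(sphere_of gen c0 w).
by case: odd => /=; rewrite ?fctE /F; ring.
Qed.

Lemma combination_psum_le u (l : seq {classic C}) (f : C -> R) : flag gen m u -> uniq l ->
  psum_le p (fun sg => \sum_(c <- l) f c * E c u sg) (\sum_(c <- l) `|f c| `^ p).
Proof.
move=> fu ul; set F := fun sg => _; move=> L uL.
have neqT c c' : c != c' :> {classic C} -> unit_at R (top c' u) (top c u) = 0.
  move=> cc; rewrite /unit_at (_ : (_ == _) = false)//.
  by apply/negbTE; apply: contra cc => /eqP /(top_inj fu fu)[-> _].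
have FE (c : {classic C}) : c \in l -> `|F (top c u)| = `|f c|.
  move=> cl; rewrite /F (bigD1_seq c)//= big1 ?addr0 => [|c' cc].
    by rewrite !normrM normr_sgn /unit_at eqxx normr1 !mulr1.
  by rewrite /E neqT ?mulr0// eq_sym.
pose T := [seq top (c : {classic C}) u | c <- l].
have F0 sg : sg \notin T -> F sg = 0.
  move=> sgT; rewrite /F big1_seq// => c /andP[_ cl].
  rewrite /E /unit_at (_ : (_ == _) = false) ?mulr0//.
  by apply: contraNF sgT => /eqP ->; apply: (map_f (fun c : {classic C} => top c u)).
rewrite (bigID (mem T)) /= [X in _ + X]big1 ?addr0 => [|sg /F0 ->]; last by rewrite normr0 powR0// gt_eqF.
rewrite -big_filter; apply: le_trans (_ : \sum_(sg <- T) `|F sg| `^ p <= _).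
  apply: sum_uniq_le; rewrite ?filter_uniq// => sg.
    by rewrite mem_filter => /andP[].
by rewrite big_map le_eqVlt; apply/orP; left; apply/eqP; apply: eq_big_seq => c /FE ->.
Qed.

Let wt w : R := (q_weight gen q w)%:R `^ (- r).

Lemma wt_gt0 w : 0 < wt w.
Proof. by rewrite powR_gt0// ltr0n q_weight_gt0. Qed.

(* Among all averages over the spheres [sphere_of gen c0 w], [w \in l], the one
   with weights proportional to [wt w] has the least l^p norm. *)
Lemma average_psum_le u (l : seq W) : flag gen m u -> uniq l -> 0 < \sum_(w <- l) wt w ->
  exists2 h', approx_coboundary h' &
    psum_le p (fun sg => E c0 u sg - h' sg) ((\sum_(w <- l) wt w) `^ (1 - p)).
Proof.
move=> fu ul; set Z := \sum_(w <- l) wt w => Z0.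
pose f c : R := wt (dW c0 c) / Z * sg_of (dW c0 c).
pose cs := flatten [seq sphere_of gen c0 w | w <- l].
have ucs : uniq cs by exact: (sphere_of_flatten_uniq hW hC hq).
exists (fun sg => \sum_(w <- l) wt w / Z * (E c0 u sg - sg_of w * \sum_(c <- sphere_of gen c0 w) E c u sg)).
  by apply: approx_coboundary_sum => w _; apply: approx_coboundaryZ; exact: approx_sphere.
have HE sg : E c0 u sg - \sum_(w <- l) wt w / Z * (E c0 u sg - sg_of w * \sum_(c <- sphere_of gen c0 w) E c u sg)
    = \sum_(c <- cs) f c * E c u sg.
  rewrite /cs big_flatten big_map.
  have -> : \sum_(w <- l) \sum_(c <- sphere_of gen c0 w) f c * E c u sg =
      \sum_(w <- l) wt w / Z * (sg_of w * \sum_(c <- sphere_of gen c0 w) E c u sg).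
    apply: eq_bigr => w _; rewrite mulrA mulr_sumr; apply: eq_big_seq => c.
    have [_ mw _] := sphere_of_spec hW hC hq c0 w.
    by move=> /mw dE; rewrite /f dE.
  have {1}-> : E c0 u sg = \sum_(w <- l) wt w / Z * E c0 u sg.
    by rewrite -!mulr_suml -/Z divff ?mul1r// gt_eqF.
  rewrite -sumrB; apply: eq_bigr => w _; ring.
suff <- : \sum_(c <- cs) `|f c| `^ p = Z `^ (1 - p).
  have := combination_psum_le f fu ucs; apply: psum_le_mono => // sg.
  by rewrite HE.
have q0 w : 0 < (q_weight gen q w)%:R :> R by rewrite ltr0n q_weight_gt0.
(* By this identity the sphere of w contributes q_w (q_w^(-r) / Z)^p = q_w^(-r) Z^(-p), and summing
   over w gives Z^(1-p). *)
have pr : 1 - r * p = - r by rewrite /r; have := p1; move=> p1'; field; rewrite subr_eq0 gt_eqF.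
rewrite /cs big_flatten big_map (eq_bigr (fun w => wt w * Z `^ (- p))); last first.
  move=> w _; have [_ mw sw] := sphere_of_spec hW hC hq c0 w.
  rewrite (eq_big_seq (fun=> (wt w / Z) `^ p)); last first.
    move=> c /mw dE; rewrite /f dE normrM ger0_norm ?divr_ge0 ?(ltW Z0) ?(ltW (wt_gt0 w))//.
    by rewrite /sg_of; case: odd; rewrite ?normrN normr1 mulr1.
  rewrite big_const_seq count_predT iter_addr_0 sw -(mulr_natl (_ `^ _)).
  rewrite powRM ?invr_ge0 ?(ltW Z0) ?(ltW (wt_gt0 w))// -powR_inv1 ?(ltW Z0)// -powRrM mulN1r mulrA.
  congr (_ * _); rewrite /wt -powRrM mulNr -{1}[_%:R](powRr1 (ltW (q0 w))) -powRD.
    by rewrite pr.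
  by rewrite (gt_eqF (q0 w)) implybT.
by rewrite -mulr_suml -/Z -{1}[Z](powRr1 (ltW Z0)) -powRD// (gt_eqF Z0) implybT.
Qed.

Lemma not_summable_approx u : flag gen m u -> ~ @weight_summable W S gen q R r ->
  approx_coboundary (E c0 u).
Proof.
move=> fu ns; apply: approx_coboundary_limit => e e0.
(* The threshold solves Z^(1-p) = e, because r (p - 1) = 1; divergence provides a list whose total
   weight exceeds it. *)
have M0 : 0 < e `^ (- r) by exact: powR_gt0.
have [l ul Ml] : exists2 l : seq W, uniq l & e `^ (- r) < \sum_(w <- l) wt w.
  apply: contra_notP ns => h; exists (e `^ (- r)) => l ul.
  by rewrite leNgt; apply/negP => lt; apply: h; exists l.
have [h' ah' hh'] := average_psum_le fu ul (lt_trans M0 Ml); exists h' => //.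
apply: psum_leW hh'; rewrite -(opprB p 1).
have pm0 : 0 <= p - 1 by rewrite subr_ge0 ltW.
apply: le_trans (powRN_le pm0 M0 (ltW Ml)) _.
rewrite -powRrM mulrNN /r mulVf ?powRr1 ?(ltW e0)//.
by rewrite subr_eq0 gt_eqF.
Qed.

End Averaging.

Lemma coboundary_combination (I : eqType) (l : seq I) (f : I -> R) (F : I -> {fset V} -> R) sg :
  D (fun ta => \sum_(i <- l) f i * F i ta) sg = \sum_(i <- l) f i * D (F i) sg.
Proof.
elim: l sg => [|i l IH] sg.
  rewrite big_nil (_ : (fun _ => _) = fun=> 0) ?/D ?coboundary0//.
  by apply/funext => ta; rewrite big_nil.
rewrite big_cons -IH /D -coboundaryZ -coboundaryD; congr (coboundary X o _ sg).
by apply/funext => ta; rewrite big_cons.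
Qed.

Lemma coboundary_top z : lp_chain X p m.+2 z -> D z = cst 0.
Proof.
move=> /lp_chainP[supp _]; apply/funext => sg; rewrite /D coboundaryE /cst.
case: asboolP => // ksg; rewrite big1// => ta _.
have [[kta cta]|nta] := pselect (X ta /\ #|` ta| = m.+2); last by rewrite supp ?mulr0.
rewrite incidence_eq0 ?mul0r// negb_and; apply/orP; right; rewrite cta.
by apply: contraTN (card_simplex_le hL hC ksg) => /eqP ->; rewrite -ltnNge.
Qed.

Lemma lp_closureP h : lp_closure p (lp_coboundaries X o p m.+1) h <->
  (exists M, psum_le p h M) /\ approx_coboundary h.
Proof.
split=> [[/(lp_norm_fin p0) hf ha]|[hf ha]]; split=> //.
- move=> e e0; have e'0 : 0 < e `^ p^-1 by exact: powR_gt0.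
  have [_ [b bc <-] /(lp_norm_lt p0 _ e'0)[M Me hM]] := ha _ e'0.
  exists b => //; apply: psum_leW hM; apply: ltW; move: Me.
  by rewrite -powRrM mulVf ?gt_eqF// powRr1// ltW.
- exact/(lp_norm_fin p0).
- move=> e e0; have e2 : 0 < e `^ p / 2 by rewrite divr_gt0// powR_gt0.
  have [b bc hb] := ha _ e2; exists (D b); first by exists b.
  apply/(lp_norm_lt p0 _ e0); exists (e `^ p / 2) => //.
  by have := powR_gt0 p e0; lra.
Qed.

Lemma reduced_cohomology_nonzeroP : lp_reduced_cohomology_nonzero X o p m.+1 <->
  exists2 z, lp_chain X p m.+2 z & ~ approx_coboundary z.
Proof.
rewrite /lp_reduced_cohomology_nonzero /lp_reduced_cohomology quotient_trivial.
- split=> [h|[z zc za] h].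
    apply: contra_notP h => h z [zc _]; apply/lp_closureP; split.
      by have /lp_chainP[] := zc.
    by apply: contra_notP h => za; exists z.
  by apply: za; have /lp_closureP[] := h z (conj zc (coboundary_top zc)).
- by split; [exact: lp_chain0|exact: coboundary_top (lp_chain0 _)].
- by apply/lp_closureP; split; [exists 0; exact: psum_le0|exact: approx_coboundary0].
- move=> a b /lp_closureP[[A aA] aa] /lp_closureP[[B bB] ab]; apply/lp_closureP; split.
    by exists (2 `^ p * (A + B)); exact: psum_leD.
  exact: approx_coboundaryD.
- move=> a /lp_closureP[[A aA] aa]; apply/lp_closureP; split.
    by exists A; exact: psum_leN.
  by apply: approx_coboundary_ext (approx_coboundaryZ (-1) aa) => sg; rewrite mulN1r.
Qed.

(** Up to an error in l^p, [z] is a finite combination of single top simplices, and each of these is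
    a limit of coboundaries by [not_summable_approx]. *)
Lemma not_summable_approx_all z : ~ @weight_summable W S gen q R r ->
  lp_chain X p m.+2 z -> approx_coboundary z.
Proof.
move=> ns /lp_chainP[supp [M zM]]; apply: approx_coboundary_limit => e e0.
have [l ul lz] := psum_le_tail p0 zM e0.
exists (fun sg => \sum_(t <- l) z t * unit_at R t sg).
  apply: approx_coboundary_sum => t _.
  have [[kt ct]|nt] := pselect (X t /\ #|` t| = m.+2); last first.
    by apply: approx_coboundary_ext approx_coboundary0 => sg; rewrite supp ?mul0r.
  have [c [u [fu ->]]] := top_simplexP hL hC kt ct.
  apply: approx_coboundary_ext (approx_coboundaryZ (z (top c u) * sgn c u) (not_summable_approx c fu ns)) => sg.
  by rewrite /E -mulrA [sgn c u * _]mulrA sgn_sqr mul1r.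
apply: (psum_le_mono p0 _ lz) => sg; have [sgl|sgl] := boolP (sg \in l).
  rewrite (bigD1_seq sg)//= /unit_at eqxx mulr1 big1 ?addr0 ?subrr// => t ts.
  by rewrite eq_sym (negbTE ts) mulr0.
rewrite big1_seq ?subr0// => t /andP[_ tl]; rewrite /unit_at (_ : (_ == _) = false) ?mulr0//.
by apply: contraNF sgl => /eqP ->.
Qed.

(** The cycle [g] lies in l^p' and is nonzero on this simplex, while it annihilates coboundaries of
    finite cochains. If the simplex were close to some D b, it would be close to D b' for a finite
    truncation b', and the pairing of the difference with [g] would be both small and equal to the
    value of [g] there. *)
Lemma summable_not_approx (c0 : C) u : flag gen m u -> @weight_summable W S gen q R r ->
  ~ approx_coboundary (unit_at R (top c0 u)).
Proof.
move=> fu sm ha; pose p' := p / (p - 1); pose g := chamber_chain (alternating_density gen dW q R c0).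
have pm0 : 0 < p - 1 by rewrite subr_gt0.
have p'0 : 0 < p' by exact: divr_gt0.
have rE : p' - 1 = r by rewrite /p' /r; field; exact: lt0r_neq0.
have p'1 : 1 < p' by rewrite -subr_gt0 rE invr_gt0.
have pp' : p^-1 + p'^-1 = 1 by rewrite /p' invf_div; field; exact: lt0r_neq0.
rewrite -rE in sm; have [G gG] := alternating_chain_psum_le c0 p'1 sm.
have e0 : 0 < `|g (top c0 u)| by rewrite normr_gt0; exact: alternating_chain_neq0.
have [d d0 small] := pairing_small p0 p'0 pp' gG e0.
have [N starN] := facet_star_bound.
(* [K] bounds the coboundary on cochains of codimension 1, so a tail of size at most half d / (K +
   1) has a coboundary of size at most [half d]. *)
pose K := (2 ^ m.+2)%:R `^ p * N%:R : R.
have K1 : 0 < K + 1 by rewrite ltr_wpDl// mulr_ge0 ?powR_ge0.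
have [b bc hb] := ha _ (half_gt0 d0); have /lp_chainP[bsupp [M bM]] := bc.
have [A uA bA] := psum_le_tail p0 bM (divr_gt0 (half_gt0 d0) K1).
pose good (ta : {fset V}) := `[< X ta /\ #|` ta| = m.+1 >].
pose A' := [seq ta <- A | good ta].
have goodA ta : ta \in A' -> X ta /\ #|` ta| = m.+1 by rewrite mem_filter => /andP[/asboolP].
have uA' : uniq A' by rewrite filter_uniq.
pose b' ta := \sum_(t <- A') b t * unit_at R t ta.
have b'E ta : b ta - b' ta = if ta \in A then 0 else b ta.
  rewrite /b'; have [tA'|tA'] := boolP (ta \in A').
    have -> : ta \in A by move: tA'; rewrite mem_filter => /andP[].
    rewrite (bigD1_seq ta)//= /unit_at eqxx mulr1 big1 ?addr0 ?subrr// => t tt.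
    by rewrite eq_sym (negbTE tt) mulr0.
  rewrite big1_seq ?subr0 => [|t /andP[_ tl]]; last first.
    by rewrite /unit_at (_ : (_ == _) = false) ?mulr0//; apply: contraNF tA' => /eqP ->.
  case: ifP => // tA; apply: bsupp => h; case/negP: tA'; rewrite mem_filter tA andbT.
  exact/asboolP.
pose h sg := unit_at R (top c0 u) sg - D b' sg.
have hd : psum_le p h d.
  have suppb ta : ~ (X ta /\ #|` ta| = m.+1) -> (if ta \in A then 0 else b ta) = 0.
    by move=> nt; case: ifP => // _; exact: bsupp.
  have Dt := coboundary_psum_le o p1 starN suppb bA.
  rewrite -[d]halfE; have := psum_leD p0 hb (psum_leW _ Dt); move=> /(_ (half d)) Dh; apply: (psum_le_mono p0 _ (Dh _)).
    move=> sg; rewrite /h; suff -> : D b' sg = D b sg - D (fun ta => if ta \in A then 0 else b ta) sg.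
      by rewrite le_eqVlt; apply/orP; left; apply/eqP; congr (`|_|); rewrite /D; ring.
    rewrite (_ : (fun ta => _) = fun ta => b ta + -1 * b' ta); last first.
      by apply/funext => ta; rewrite mulN1r b'E.
    by rewrite /D coboundaryD coboundaryZ; ring.
  by rewrite -/K mulrCA ler_piMr ?(ltW (half_gt0 d0))// ler_pdivrMr// mul1r lerDl.
have /choice[st stP] (ta : {fset V}) : exists l : seq {fset V}, good ta ->
    forall sg, X sg -> #|` sg| = m.+2 -> (ta `<=` sg)%fset -> sg \in l.
  have [/asboolP[kta cta]|_] := boolP (good ta); last by exists [::].
  by have [l [_ hl]] := starN ta kta cta; exists l.
(* [L] contains every top simplex over a face in [A'], so the sum over [L] computes the full
   boundary of [g] at each of these faces, and exchanging the finite sums gives 0. *)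
pose L := undup [seq sg <- top c0 u :: flatten [seq st ta | ta <- A'] | `[< X sg >]].
have LX sg : sg \in L -> X sg by rewrite mem_undup mem_filter => /andP[/asboolP].
have topL : top c0 u \in L.
  by rewrite mem_undup mem_filter mem_head andbT; apply/asboolP; exact: top_simplex_simplex.
have := small h hd L (undup_uniq _); suff -> : \sum_(sg <- L) h sg * g sg = g (top c0 u) by rewrite ltxx.
have -> : \sum_(sg <- L) h sg * g sg = \sum_(sg <- L) unit_at R (top c0 u) sg * g sg -
    \sum_(sg <- L) D b' sg * g sg.
  by rewrite -sumrB; apply: eq_bigr => sg _; rewrite /h mulrBl.
rewrite (bigD1_seq _ topL (undup_uniq _))/= {1}/unit_at eqxx mul1r big1 ?addr0; last first.
  by move=> t /negbTE tt; rewrite /unit_at tt mul0r.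
have -> : \sum_(sg <- L) D b' sg * g sg = \sum_(sg <- L) \sum_(ta <- A') b ta * (inc sg ta * g sg).
  apply: eq_big_seq => sg /LX ksg; rewrite /b' coboundary_combination mulr_suml.
  apply: eq_big_seq => ta /goodA[kta _]; rewrite /D coboundary_unit_at// asboolT//.
  by rewrite -/(inc sg ta) mulrA.
rewrite exchange_big /= big1_seq ?subr0// => ta /andP[_ tA']; have [kta cta] := goodA _ tA'.
have := congr1 (fun f => f ta) (alternating_chain_cycle c0); rewrite /cst.
rewrite (@boundary_sum _ _ X o _ _ L)//; last 2 first.
- exact: undup_uniq.
- move=> sg ksg sgL sub; rewrite cta => csg; case/negP: sgL.
  rewrite mem_undup mem_filter asboolT//= inE; apply/orP; right.
  apply/flatten_mapP; exists ta => //; apply: stP => //; exact/asboolP.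
by rewrite -mulr_sumr => ->; rewrite mulr0.
Qed.

Lemma reduced_cohomology_summable (c0 : C) : lp_reduced_cohomology_nonzero X o p m.+1 <->
  @weight_summable W S gen q R r.
Proof.
split=> [/reduced_cohomology_nonzeroP[z zc za]|sm].
  by apply: contra_notP za => ns; exact: not_summable_approx_all.
have [u fu] := flag_inhabited; apply/reduced_cohomology_nonzeroP; exists (unit_at R (top c0 u)).
  by rewrite -(card_top_simplex hC c0 fu); apply: lp_chain_unit_at; exact: top_simplex_simplex.
exact: summable_not_approx.
Qed.

End TopDegree.

(** * From the abscissa of convergence to the two critical exponents *)

Theorem theorem1p1 (R : realType) (W : groupType) (S : finType) (gen : S -> W)
    (hW : is_coxeter_system gen) (W_infinite : infinite_set [set: W])
    (hPM : type_PM gen)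
    (C : chamber_system S) (dW : C -> C -> W) (hC : is_building gen dW)
    (q : S -> nat) (hq : is_regular C q) (q_ge2 : forall s, (2 <= q s)%N)
    (n : nat) (hn : has_dimension (davis_realization gen dW) n)
    (o : {fset set (C * {fset S})} -> seq (set (C * {fset S})))
    (ho : is_orientation (davis_realization gen dW) o) :
  ((1 + growth_exponent gen R q =
      ereal_inf [set p%:E | p in
        [set p : R | (1 < p)%R /\
           lp_homology_nonzero (davis_realization gen dW) o p n]])%E) /\
  ((1 + (growth_exponent gen R q)^-1 =
      ereal_sup [set p%:E | p in
        [set p : R | (1 < p)%R /\
           lp_reduced_cohomology_nonzero (davis_realization gen dW) o p n]])%E).
Proof.
have [m [hL hO hG]] := hPM; have nE := has_dimension_davis hL hC hn; subst n.
(* The base chamber comes from the simplex of dimension n whose existence is part of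
   [has_dimension]. *)
have [[_ [[c0 _] _]] _] := hn; have [eps heps] := flag_orientation_exists hL hO.
have hom p : 1 < p -> lp_homology_nonzero (davis_realization gen dW) o p m.+1 <->
    @weight_summable W S gen q R (p - 1).
  by move=> p1; exact: (homology_summable hW hL hG heps hC hq ho p1 q_ge2 c0).
have coh p : 1 < p -> lp_reduced_cohomology_nonzero (davis_realization gen dW) o p m.+1 <->
    @weight_summable W S gen q R (p - 1)^-1.
  by move=> p1; exact: (reduced_cohomology_summable hW hL hG heps hC hq ho p1 q_ge2 c0).
have gt := weight_summable_gt hW q_ge2 (R := R).
have lt := weight_summable_lt hW q_ge2 (R := R).
have ef := growth_exponent_fin hW q_ge2 R; have := growth_exponent_ge0 hW q_ge2 R.
rewrite -(fineK ef) lee_fin in gt lt *; move: (fine _) gt lt => e gt lt e0.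
split.
- apply/eqP; rewrite eq_le; apply/andP; split.
    apply: le_ereal_inf_tmp => _ [p [p1 /(hom _ p1) sm] <-].
    by have := lt (p - 1); rewrite subr_ge0 (ltW p1) -EFinD !lee_fin => /(_ isT sm); lra.
  (* Nothing is claimed about the series at t = e itself, so 1 + e is only approached from above,
     through the exponents 1 + e + d. *)
  apply/lee_addgt0Pr => d d0; rewrite -!EFinD; apply: ereal_inf_lbound.
  exists (1 + e + d) => //; have p1 : 1 < 1 + e + d by lra.
  by split=> //; apply/hom => //; apply: gt; rewrite lte_fin; lra.
have mem p : 1 < p -> e < (p - 1)^-1 -> (p%:E <= ereal_sup [set p%:E | p in
    [set p : R | (1 < p)%R /\ lp_reduced_cohomology_nonzero (davis_realization gen dW) o p m.+1]])%E.
  move=> p1 ep; apply: ereal_sup_ubound; exists p => //; split=> //.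
  by apply/coh => //; apply: gt; rewrite lte_fin.
(* For e = 0 the series converges for all t > 0, so every p > 1 qualifies and both sides are +oo. *)
have [e00|eN0] := eqVneq e 0.
  rewrite e00 inve0 addey//; apply/esym/eq_infty => t.
  apply: le_trans (mem (Num.max t 2) _ _); first by rewrite lee_fin le_max lexx.
    by rewrite lt_max; apply/orP; right; lra.
  by rewrite e00 invr_gt0 subr_gt0 lt_max; apply/orP; right; lra.
have epos : 0 < e by rewrite lt_neqAle eq_sym eN0.
rewrite inver (negbTE eN0) -EFinD; have x0 : 0 < e^-1 by rewrite invr_gt0.
apply/eqP; rewrite eq_le; apply/andP; split; last first.
  apply: ge_ereal_sup => _ [p [p1 /(coh _ p1) sm] <-].
  have p0 : 0 < p - 1 by lra.
  have := lt (p - 1)^-1; rewrite invr_ge0 (ltW p0) lee_fin => /(_ isT sm).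
  have p0' : 0 < (p - 1)^-1 by rewrite invr_gt0.
  by rewrite -(lef_pV2 p0' epos) invrK !lee_fin; lra.
apply/lee_addgt0Pr => d d0.
(* The first entry brings p within d of 1 + 1/e; the second keeps p > 1 when d is large. Both stay
   below 1/e, so that 1/(p-1) > e. *)
pose p := 1 + Num.max (e^-1 - d) (e^-1 / 2).
have pe : p - 1 < e^-1 by rewrite /p addrAC subrr add0r gt_max; apply/andP; split; lra.
have p1 : 1 < p by rewrite /p ltrDl lt_max; apply/orP; right; lra.
have p0 : 0 < p - 1 by lra.
apply: le_trans (_ : (p%:E + d%:E <= _)%E).
  by rewrite -EFinD lee_fin -addrA lerD2l -lerBlDr le_max lexx.
rewrite leeD2r// mem// -(invrK e) ltf_pV2// posrE.
Qed.
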